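(* Let $N\in\mathbb{N}$ and $x\in\mathbb{C}\setminus(-\infty,0]$. For $k\in\mathbb{N}$ define $$\mathscr{B}(k,N,x):=\begin{cases}(-1)^{k+N+1}x^{1/N}\zeta\left(1+\frac{k}{N}\right) & \text{if } k=N,\\ 0 & \text{if } k\neq N.\end{cases}$$ (a) If $k\in\mathbb{N}$ satisfies $1<k\le N$, then $$x^{\frac{1-k}{N}}\mathscr{F}_{k,N}(x)-\frac{(-1)^k}{N}\sum_{j=-(N-1)}^{(N-1)}{}''\, e^{i\pi j(k-1)/N}\mathscr{F}_{\frac{N+k-1}{N},\frac{1}{N}}\left(\frac{e^{-i\pi j/N}}{x^{1/N}}\right)$$ $$=\frac{\pi}{N}\frac{\zeta\left(1+\frac{k-1}{N}\right)}{\sin\left(\frac{\pi}{N}(k-1)\right)}+x^{\frac{1-k}{N}}\Big(-(\gamma+\log x)\zeta(k)+N\zeta'(k)\Big)-\frac{\zeta(k+N)}{x^{\frac{N+k-1}{N}}}+\mathscr{B}(k,N,x).$$ (b) Moreover, $$\mathscr{F}_{1,N}(x)+\frac{1}{N}\sum_{j=-(N-1)}^{(N-1)}{}''\,\mathscr{F}_{1,\frac{1}{N}}\left(\frac{e^{-i\pi j/N}}{x^{1/N}}\right)=\frac{1}{N}\left\{\frac{\pi^2}{6}-(N-1)\gamma\log x+\frac12(\log x)^2-N\gamma^2-(N^2+1)\gamma_1\right\}-\frac{\zeta(N+1)}{x}+\mathscr{B}(1,N,x).$$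
   Context: For positive real numbers $k,N$ with $k+N>1$ and $x\in\mathbb{C}\setminus(-\infty,0]$, the extended higher Herglotz function is $\mathscr{F}_{k,N}(x):=\sum_{n=1}^{\infty}\frac{\psi(n^Nx)-\log(n^Nx)}{n^k}$, where $\psi=\Gamma'/\Gamma$ is the digamma function and $\log$ is the principal branch. All non-integer powers are principal branches. The notation $\sum_{j=-(N-1)}^{(N-1)}{}''$ denotes a sum over $j=-(N-1),-(N-3),\dots,N-3,N-1$ (step $2$). $\zeta$ is the Riemann zeta function, $\gamma$ is Euler's constant and $\gamma_1$ is the first Stieltjes constant. *)

(* Defs.v *)
From Stdlib Require Import Reals ZArith Arith.
From Coquelicot Require Export Coquelicot.

Open Scope R_scope.

Definition CLim_seq (u : nat -> C) : C :=
  (real (Lim_seq (fun n => Re (u n))), real (Lim_seq (fun n => Im (u n)))).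

Definition CSeries (a : nat -> C) : C :=
  (Series (fun n => Re (a n)), Series (fun n => Im (a n))).

Definition Cexp (z : C) : C :=
  (exp (Re z) * cos (Im z), exp (Re z) * sin (Im z)).

(* Principal argument, with values in (-PI, PI] for z <> 0. *)
Definition Carg (z : C) : R :=
  if Rle_dec 0 (Im z) then acos (Re z / Cmod z) else - acos (Re z / Cmod z).

Definition Clog (z : C) : C := (ln (Cmod z), Carg z).

Definition Cpower (z a : C) : C := Cexp (a * Clog z).

(* The complement of (-infinity, 0]. *)
Definition slit_plane (z : C) : Prop := ~ (Im z = 0 /\ Re z <= 0).

(* z (z + 1) ... (z + n) *)
Fixpoint Crising (z : C) (n : nat) : C :=
  match n with
  | O => z
  | S m => Crising z m * (z + INR n)
  end%C.

(* Euler-Gauss product formula, valid on C minus the non-positive integers. *)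
Definition CGamma (z : C) : C :=
  CLim_seq (fun n => Cpower (INR n) z * INR (fact n) / Crising z n)%C.

(* [C_derive] takes the limit of the difference quotient along the real direction;
   it is the complex derivative wherever the latter exists ([is_C_derive_unique]). *)
Definition Cdigamma (z : C) : C := (C_derive CGamma z / CGamma z)%C.

(* Riemann zeta function on Re s > 1. *)
Definition Czeta (s : C) : C :=
  CSeries (fun n => Cpower (INR (S n)) (- s)).

Definition euler_gamma : R :=
  real (Lim_seq (fun n =>
    sum_n_m (fun m => / INR m) 1 n - ln (INR n))).

Definition stieltjes_gamma1 : R :=
  real (Lim_seq (fun n =>
    sum_n_m (fun m => ln (INR m) / INR m) 1 n - (ln (INR n)) ^ 2 / 2)).

(* The summand of index n is the term n + 1 of the series, which starts at 1. *)
Definition Herglotz (k N : R) (x : C) : C :=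
  CSeries (fun n =>
    let y := (Rpower (INR (S n)) N * x)%C in
    ((Cdigamma y - Clog y) / Rpower (INR (S n)) k)%C).

(* Sum of f j over j = -(N-1), -(N-3), ..., N-3, N-1 (N terms), for N >= 1. *)
Definition sum_step2 (N : nat) (f : Z -> C) : C :=
  sum_n (fun l => f (2 * Z.of_nat l - (Z.of_nat N - 1))%Z) (N - 1).

Definition Bterm (k N : nat) (x : C) : C :=
  if Nat.eq_dec k N then
    ((-1) ^ (k + N + 1) * Cpower x (1 / INR N)%R * Czeta (1 + INR k / INR N)%R)%C
  else 0.

(* Main.v *)
(** Everything rests on the limit
    [psi (y + 1) - log y = lim_M (log M - log y - sum_(m <= M) 1 / (m + y))] and on the partial
    fraction expansion of [t^(N-k) / (t^N + m/x)] over the points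
    [y_j = exp (- i pi j / N) (m/x)^(1/N)].  Inserting them, the two Herglotz sums become the two
    iterated sums of the kernel [b (m, n) = n^(N-k) / (m (n^N + m/x))], because
    [n^(-k) / (m + n^N x) + b (m, n) = n^(-k) / m].  For [k > 1] the kernel is absolutely summable
    and the identity is Fubini's theorem.  For [k = 1] one truncates at [n <= P] and [m <= P^N];
    what remains besides harmonic sums is
    [sum_(n <= P) log (1 + x (n/P)^N) / n + 1/N sum_(m <= P^N) log (1 + m / (P^N x)) / m], whose
    derivative along [s -> exp (s log x)] tends to [s (log x)^2 / N]; its limit at [x = 1] is found
    from the values at [x = i] and [x = - i], which relate the exponents [N] and [2 N]. *)

Require Import Defs.
From Stdlib Require Import Reals ZArith Arith Lra Lia Psatz.
From Coquelicot Require Import Coquelicot.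

Open Scope R_scope.

(** Working with [psi (y + 1)] instead of [psi y] adds [1/y] to each summand. These extra terms sum
    to [zeta (k + N) / x] and, over the points [y_j], to a root-of-unity sum that vanishes unless
    [k = N]: they account for the last two terms of the identity, and only the double sum is left.
    The obstacle at [k = 1] is twofold: where [n^N] exceeds [m] the kernel is of size [1/(m n)],
    hence not absolutely summable, and the weights of the sum over [j] no longer add up to zero, so
    that logarithms survive. Cutting at [P] and [P^N] keeps [n] and [m^(1/N)] in the same range and
    puts both sides on one rectangle. All error terms must be uniform in the summation index. This
    comes from the single inequality [|s z + t| >= c (s |z| + t)], whose constant depends only on
    the argument of [z] and so is shared by all [n^N x]. Only derivatives in a real parameter occur.
    Identities between principal logarithms are proved by a vanishing derivative along a segment,
    without tracking arguments; termwise differentiation is replaced by second-order remainders that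
    pass to the limit. *)

(** * Real part, imaginary part and modulus *)

Lemma Ceq (z w : C) : Re z = Re w -> Im z = Im w -> z = w.
Proof. destruct z, w; simpl; intros -> ->; reflexivity. Qed.

Lemma Cmod_sqr (z : C) : Cmod z * Cmod z = Re z * Re z + Im z * Im z.
Proof. generalize (Cmod2_alt z); simpl; lra. Qed.

Lemma Rabs_Im_le_Cmod (z : C) : Rabs (Im z) <= Cmod z.
Proof.
  apply Rle_trans with (2 := Rmax_Cmod z). apply Rmax_r.
Qed.

Lemma Cmod_le_Re_Im (z : C) : Cmod z <= Rabs (Re z) + Rabs (Im z).
Proof.
  generalize (Cmod_sqr z) (Cmod_ge_0 z) (Rabs_pos (Re z)) (Rabs_pos (Im z)).
  generalize (Rsqr_abs (Re z)) (Rsqr_abs (Im z)). unfold Rsqr. nra.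
Qed.

Lemma Cmod_minus_sym (z w : C) : Cmod (z - w) = Cmod (w - z).
Proof. rewrite <- Cmod_opp. f_equal. ring. Qed.

Lemma im_plus (a b : C) : Im (a + b) = Im a + Im b.
Proof. reflexivity. Qed.

Lemma re_minus (a b : C) : Re (a - b) = Re a - Re b.
Proof. reflexivity. Qed.

Lemma im_minus (a b : C) : Im (a - b) = Im a - Im b.
Proof. reflexivity. Qed.

Lemma RtoC_neq_0 (r : R) : r <> 0 -> RtoC r <> 0%C.
Proof. intros H E. apply H. apply (f_equal Re E). Qed.

Lemma Cmod_RtoC_pos (r : R) : 0 <= r -> Cmod r = r.
Proof. intros. rewrite Cmod_R. apply Rabs_pos_eq; auto. Qed.

(** * Limits and finite sums of complex numbers *)

Definition Clim (u : nat -> C) (l : C) : Prop :=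
  is_lim_seq (fun n => Cmod (u n - l)) 0.

Lemma is_lim_seq_squeeze_0 (u v : nat -> R) :
  (forall n, 0 <= u n <= v n) -> is_lim_seq v 0 -> is_lim_seq u 0.
Proof.
  intros H Hv. apply is_lim_seq_le_le with (fun _ => 0) v; auto.
  apply is_lim_seq_const.
Qed.

Lemma Clim_intro (u : nat -> C) (l : C) (v : nat -> R) :
  (forall n, Cmod (u n - l) <= v n) -> is_lim_seq v 0 -> Clim u l.
Proof.
  intros H. apply is_lim_seq_squeeze_0. intros n; split; auto using Cmod_ge_0.
Qed.

Lemma is_lim_seq_plus_0 (u v : nat -> R) :
  is_lim_seq u 0 -> is_lim_seq v 0 -> is_lim_seq (fun n => u n + v n) 0.
Proof.
  intros Hu Hv. replace (Finite 0) with (Finite (0 + 0)) by (f_equal; ring).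
  apply is_lim_seq_plus'; auto.
Qed.

Lemma is_lim_seq_mult_0 (c : R) (u : nat -> R) :
  is_lim_seq u 0 -> is_lim_seq (fun n => c * u n) 0.
Proof.
  intros Hu. replace (Finite 0) with (Finite (c * 0)) by (f_equal; ring).
  apply is_lim_seq_mult'; auto. apply is_lim_seq_const.
Qed.

Lemma Clim_ext (u v : nat -> C) (l : C) :
  (forall n, u n = v n) -> Clim u l -> Clim v l.
Proof.
  intros H. apply is_lim_seq_ext. intros n. rewrite H; auto.
Qed.

Lemma Clim_const (c : C) : Clim (fun _ => c) c.
Proof.
  apply is_lim_seq_ext with (fun _ => 0); [| apply is_lim_seq_const].
  intros n. replace (c - c)%C with (RtoC 0) by ring. rewrite Cmod_0; auto.
Qed.

Lemma Clim_plus (u v : nat -> C) (a b : C) :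
  Clim u a -> Clim v b -> Clim (fun n => u n + v n)%C (a + b)%C.
Proof.
  intros Hu Hv.
  apply Clim_intro with (fun n => Cmod (u n - a) + Cmod (v n - b)).
  - intros n. replace (u n + v n - (a + b))%C with ((u n - a) + (v n - b))%C by ring.
    apply Cmod_triangle.
  - apply is_lim_seq_plus_0; auto.
Qed.

Lemma Clim_scal (c : C) (u : nat -> C) (a : C) :
  Clim u a -> Clim (fun n => c * u n)%C (c * a)%C.
Proof.
  intros Hu.
  apply Clim_intro with (fun n => Cmod c * Cmod (u n - a)).
  - intros n. replace (c * u n - c * a)%C with (c * (u n - a))%C by ring.
    rewrite Cmod_mult. apply Rle_refl.
  - apply is_lim_seq_mult_0; auto.
Qed.

Lemma Clim_opp (u : nat -> C) (a : C) :
  Clim u a -> Clim (fun n => - u n)%C (- a)%C.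
Proof.
  intros H. apply is_lim_seq_ext with (2 := H). intros n.
  rewrite <- Cmod_opp. f_equal. ring.
Qed.

Lemma Clim_minus (u v : nat -> C) (a b : C) :
  Clim u a -> Clim v b -> Clim (fun n => u n - v n)%C (a - b)%C.
Proof. intros Hu Hv. apply Clim_plus; auto. apply Clim_opp; auto. Qed.

Lemma Clim_Re (u : nat -> C) (l : C) :
  Clim u l -> is_lim_seq (fun n => Re (u n)) (Re l).
Proof.
  intros H.
  assert (H1 : is_lim_seq (fun n => Re (u n - l)) 0).
  { apply is_lim_seq_abs_0. apply is_lim_seq_squeeze_0 with (2 := H).
    intros n; split; [apply Rabs_pos | apply re_le_Cmod]. }
  apply is_lim_seq_ext with (fun n => Re (u n - l) + Re l).
  - intros n. rewrite re_minus. ring.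
  - replace (Finite (Re l)) with (Finite (0 + Re l)) by (f_equal; ring).
    apply is_lim_seq_plus'; auto. apply is_lim_seq_const.
Qed.

Lemma Clim_Im (u : nat -> C) (l : C) :
  Clim u l -> is_lim_seq (fun n => Im (u n)) (Im l).
Proof.
  intros H.
  assert (H1 : is_lim_seq (fun n => Im (u n - l)) 0).
  { apply is_lim_seq_abs_0. apply is_lim_seq_squeeze_0 with (2 := H).
    intros n; split; [apply Rabs_pos | apply Rabs_Im_le_Cmod]. }
  apply is_lim_seq_ext with (fun n => Im (u n - l) + Im l).
  - intros n. rewrite im_minus. ring.
  - replace (Finite (Im l)) with (Finite (0 + Im l)) by (f_equal; ring).
    apply is_lim_seq_plus'; auto. apply is_lim_seq_const.
Qed.

Lemma is_lim_seq_minus_self (u : nat -> R) (l : R) :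
  is_lim_seq u l -> is_lim_seq (fun n => Rabs (u n - l)) 0.
Proof.
  intros H. apply (is_lim_seq_abs_0 (fun n => u n - l)).
  replace (Finite 0) with (Finite (l - l)) by (f_equal; ring).
  apply is_lim_seq_minus'; auto. apply is_lim_seq_const.
Qed.

Lemma Clim_Re_Im (u : nat -> C) (l : C) :
  is_lim_seq (fun n => Re (u n)) (Re l) -> is_lim_seq (fun n => Im (u n)) (Im l) ->
  Clim u l.
Proof.
  intros H1 H2.
  apply Clim_intro with (fun n => Rabs (Re (u n) - Re l) + Rabs (Im (u n) - Im l)).
  - intros n. apply Cmod_le_Re_Im.
  - apply is_lim_seq_plus_0; apply is_lim_seq_minus_self; auto.
Qed.

Lemma Clim_RtoC (u : nat -> R) (l : R) :
  is_lim_seq u l -> Clim (fun n => RtoC (u n)) l.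
Proof.
  intros H. apply Clim_Re_Im; simpl; auto. apply is_lim_seq_const.
Qed.

Lemma CLim_seq_unique (u : nat -> C) (l : C) : Clim u l -> CLim_seq u = l.
Proof.
  intros H. apply Ceq; unfold CLim_seq; simpl.
  - rewrite (is_lim_seq_unique _ _ (Clim_Re _ _ H)); reflexivity.
  - rewrite (is_lim_seq_unique _ _ (Clim_Im _ _ H)); reflexivity.
Qed.

Lemma Clim_unique (u : nat -> C) (a b : C) : Clim u a -> Clim u b -> a = b.
Proof. intros Ha Hb. rewrite <- (CLim_seq_unique _ _ Ha). apply CLim_seq_unique; auto. Qed.

Lemma Clim_subseq (u : nat -> C) (l : C) (f : nat -> nat) :
  filterlim f eventually eventually -> Clim u l -> Clim (fun n => u (f n)) l.
Proof.
  intros Hf H. apply (is_lim_seq_subseq (fun n => Cmod (u n - l)) 0 f); auto.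
Qed.

Lemma Clim_incr_1 (u : nat -> C) (l : C) : Clim (fun n => u (S n)) l <-> Clim u l.
Proof.
  unfold Clim. symmetry. apply (is_lim_seq_incr_1 (fun n => Cmod (u n - l))).
Qed.

Lemma Clim_Cmod_le (u : nat -> C) (l a : C) (M : R) :
  Clim u l -> (forall n, Cmod (u n - a) <= M) -> Cmod (l - a) <= M.
Proof.
  intros H HM.
  assert (Hle : forall n, Cmod (l - a) - M <= Cmod (u n - l)).
  { intros n. specialize (HM n).
    generalize (Cmod_triangle (l - u n) (u n - a)).
    replace (l - u n + (u n - a))%C with (l - a)%C by ring.
    rewrite (Cmod_minus_sym l (u n)). lra. }
  generalize (is_lim_seq_le _ _ _ _ Hle (is_lim_seq_const _) H). simpl. lra.
Qed.

(** There are [n] terms, against [n + 1] in [sum_n]: the empty sum is available, and with summands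
    in [S i] the bound [n] is the last index of the mathematical sum. *)
Fixpoint csum (f : nat -> C) (n : nat) : C :=
  match n with O => 0 | S m => csum f m + f m end%C.

Fixpoint rsum (f : nat -> R) (n : nat) : R :=
  match n with O => 0 | S m => rsum f m + f m end.

Lemma csum_S (f : nat -> C) (n : nat) : csum f (S n) = (csum f n + f n)%C.
Proof. reflexivity. Qed.

Lemma csum_ext (f g : nat -> C) (n : nat) :
  (forall i, (i < n)%nat -> f i = g i) -> csum f n = csum g n.
Proof.
  induction n; intros H; simpl; auto. rewrite IHn, H; auto.
Qed.

Lemma csum_plus (f g : nat -> C) (n : nat) :
  csum (fun i => f i + g i)%C n = (csum f n + csum g n)%C.
Proof. induction n; simpl; [ring | rewrite IHn; ring]. Qed.

Lemma csum_scal (c : C) (f : nat -> C) (n : nat) :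
  csum (fun i => c * f i)%C n = (c * csum f n)%C.
Proof. induction n; simpl; [ring | rewrite IHn; ring]. Qed.

Lemma csum_minus (f g : nat -> C) (n : nat) :
  csum (fun i => f i - g i)%C n = (csum f n - csum g n)%C.
Proof. induction n; simpl; [ring | rewrite IHn; ring]. Qed.

Lemma csum_const (c : C) (n : nat) : csum (fun _ => c) n = (INR n * c)%C.
Proof.
  induction n; simpl csum; [simpl; ring |].
  rewrite IHn, S_INR, RtoC_plus. ring.
Qed.

Lemma csum_switch (f : nat -> nat -> C) (m n : nat) :
  csum (fun i => csum (f i) n) m = csum (fun j => csum (fun i => f i j) m) n.
Proof.
  induction m; simpl.
  - rewrite csum_const. ring.
  - rewrite IHm, csum_plus. reflexivity.
Qed.

Lemma csum_RtoC (f : nat -> R) (n : nat) :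
  csum (fun i => RtoC (f i)) n = RtoC (rsum f n).
Proof. induction n; simpl; auto. rewrite IHn, RtoC_plus; auto. Qed.

Lemma Cmod_csum_le (f : nat -> C) (g : nat -> R) (n : nat) :
  (forall i, (i < n)%nat -> Cmod (f i) <= g i) -> Cmod (csum f n) <= rsum g n.
Proof.
  induction n; intros H; simpl.
  - rewrite Cmod_0; lra.
  - eapply Rle_trans; [apply Cmod_triangle|].
    apply Rplus_le_compat; auto.
Qed.

Lemma rsum_le (f g : nat -> R) (n : nat) :
  (forall i, (i < n)%nat -> f i <= g i) -> rsum f n <= rsum g n.
Proof.
  induction n; intros H; simpl; [lra|]. apply Rplus_le_compat; auto.
Qed.

Lemma rsum_scal (c : R) (f : nat -> R) (n : nat) :
  rsum (fun i => c * f i) n = c * rsum f n.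
Proof. induction n; simpl; [ring | rewrite IHn; ring]. Qed.

Lemma rsum_const (c : R) (n : nat) : rsum (fun _ => c) n = INR n * c.
Proof. induction n; simpl rsum; [simpl; ring | rewrite IHn, S_INR; ring]. Qed.

Lemma rsum_sum_n (f : nat -> R) (n : nat) : rsum f (S n) = sum_n f n.
Proof.
  induction n.
  - rewrite sum_O. simpl. ring.
  - rewrite sum_Sn, <- IHn. reflexivity.
Qed.

Lemma csum_sum_n (f : nat -> C) (n : nat) : csum f (S n) = sum_n f n.
Proof.
  induction n.
  - rewrite sum_O. simpl. ring.
  - rewrite sum_Sn, <- IHn. reflexivity.
Qed.

Lemma Re_csum (f : nat -> C) (n : nat) : Re (csum f n) = rsum (fun i => Re (f i)) n.
Proof. induction n; simpl; auto. rewrite <- IHn; auto. Qed.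

Lemma Im_csum (f : nat -> C) (n : nat) : Im (csum f n) = rsum (fun i => Im (f i)) n.
Proof. induction n; simpl; auto. rewrite <- IHn; auto. Qed.

Lemma is_series_rsum (a : nat -> R) (l : R) :
  is_series a l <-> is_lim_seq (rsum a) l.
Proof.
  rewrite is_lim_seq_incr_1. split; intros H.
  - apply is_lim_seq_ext with (sum_n a); [| exact H].
    intros n; symmetry; apply rsum_sum_n.
  - apply (is_lim_seq_ext _ (sum_n a)) in H; [exact H|].
    intros n; apply rsum_sum_n.
Qed.

Lemma CSeries_unique (a : nat -> C) (l : C) : Clim (csum a) l -> CSeries a = l.
Proof.
  intros H. apply Ceq; unfold CSeries; simpl; apply is_series_unique, is_series_rsum.
  - apply is_lim_seq_ext with (2 := Clim_Re _ _ H). apply Re_csum.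
  - apply is_lim_seq_ext with (2 := Clim_Im _ _ H). apply Im_csum.
Qed.

Lemma Clim_csum_dominated (a : nat -> C) (b : nat -> R) :
  (forall n, Cmod (a n) <= b n) -> ex_series b -> exists l, Clim (csum a) l.
Proof.
  intros H Hb.
  assert (H1 : ex_series (fun n => Re (a n))).
  { apply (@ex_series_le R_AbsRing R_CompleteNormedModule _ b); auto. intros n.
    apply Rle_trans with (2 := H n). apply re_le_Cmod. }
  assert (H2 : ex_series (fun n => Im (a n))).
  { apply (@ex_series_le R_AbsRing R_CompleteNormedModule _ b); auto. intros n.
    apply Rle_trans with (2 := H n). apply Rabs_Im_le_Cmod. }
  destruct H1 as [l1 H1], H2 as [l2 H2]. exists (l1, l2).
  apply Clim_Re_Im; simpl.
  - apply is_lim_seq_ext with (rsum (fun n => Re (a n))).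
    intros n; symmetry; apply Re_csum. apply is_series_rsum, H1.
  - apply is_lim_seq_ext with (rsum (fun n => Im (a n))).
    intros n; symmetry; apply Im_csum. apply is_series_rsum, H2.
Qed.

(** * Complex-valued functions of a real variable *)

Definition Cderiv (f : R -> C) (t : R) (l : C) : Prop :=
  is_derive (fun s => Re (f s)) t (Re l) /\ is_derive (fun s => Im (f s)) t (Im l).

Lemma is_derive_eq (f : R -> R) (t a b : R) : is_derive f t a -> a = b -> is_derive f t b.
Proof. intros H <-; exact H. Qed.

Lemma Cderiv_eq (f : R -> C) (t : R) (a b : C) : Cderiv f t a -> a = b -> Cderiv f t b.
Proof. intros H <-; exact H. Qed.

Lemma Cderiv_ext (f g : R -> C) (t : R) (a : C) :
  (forall s, f s = g s) -> Cderiv f t a -> Cderiv g t a.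
Proof.
  intros E [H1 H2]; split.
  - apply is_derive_ext with (2 := H1). intros; rewrite E; auto.
  - apply is_derive_ext with (2 := H2). intros; rewrite E; auto.
Qed.

Lemma Cderiv_const (c : C) (t : R) : Cderiv (fun _ => c) t 0.
Proof. split; apply @is_derive_const. Qed.

Lemma Cderiv_plus (f g : R -> C) (t : R) (a b : C) :
  Cderiv f t a -> Cderiv g t b -> Cderiv (fun s => f s + g s)%C t (a + b)%C.
Proof.
  intros [H1 H2] [H3 H4]; split.
  - apply (is_derive_plus (fun s => Re (f s)) (fun s => Re (g s))); auto.
  - apply (is_derive_plus (fun s => Im (f s)) (fun s => Im (g s))); auto.
Qed.

Lemma Cderiv_opp (f : R -> C) (t : R) (a : C) :
  Cderiv f t a -> Cderiv (fun s => - f s)%C t (- a)%C.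
Proof.
  intros [H1 H2]; split.
  - apply (is_derive_opp (fun s => Re (f s))); auto.
  - apply (is_derive_opp (fun s => Im (f s))); auto.
Qed.

Lemma Cderiv_minus (f g : R -> C) (t : R) (a b : C) :
  Cderiv f t a -> Cderiv g t b -> Cderiv (fun s => f s - g s)%C t (a - b)%C.
Proof. intros. apply Cderiv_plus; auto. apply Cderiv_opp; auto. Qed.

Lemma is_derive_Rmult (f g : R -> R) (t a b : R) :
  is_derive f t a -> is_derive g t b ->
  is_derive (fun s => f s * g s) t (a * g t + f t * b).
Proof. intros. apply (is_derive_mult f g); auto. intros; apply Rmult_comm. Qed.

Lemma Cderiv_mult (f g : R -> C) (t : R) (a b : C) :
  Cderiv f t a -> Cderiv g t b ->
  Cderiv (fun s => f s * g s)%C t (a * g t + f t * b)%C.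
Proof.
  intros [H1 H2] [H3 H4]; split.
  - eapply is_derive_eq.
    + apply (is_derive_minus (fun s => Re (f s) * Re (g s)) (fun s => Im (f s) * Im (g s)));
        apply is_derive_Rmult; eassumption.
    + rewrite re_plus, !re_mult. unfold minus, plus, opp; simpl. ring.
  - eapply is_derive_eq.
    + apply (is_derive_plus (fun s => Re (f s) * Im (g s)) (fun s => Im (f s) * Re (g s)));
        apply is_derive_Rmult; eassumption.
    + rewrite im_plus, !im_mult. unfold plus; simpl. ring.
Qed.

Lemma Cderiv_scal (c : C) (f : R -> C) (t : R) (a : C) :
  Cderiv f t a -> Cderiv (fun s => c * f s)%C t (c * a)%C.
Proof.
  intros H. eapply Cderiv_eq.
  - apply Cderiv_mult; [apply Cderiv_const | exact H].
  - simpl. ring.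
Qed.

Lemma Cderiv_RtoC (f : R -> R) (t a : R) :
  is_derive f t a -> Cderiv (fun s => RtoC (f s)) t a.
Proof. intros H; split; simpl; auto. apply @is_derive_const. Qed.

Lemma Cderiv_id (t : R) : Cderiv RtoC t 1.
Proof. apply (Cderiv_RtoC (fun s => s)). apply @is_derive_id. Qed.

Lemma Cderiv_csum (f : nat -> R -> C) (df : nat -> C) (t : R) (n : nat) :
  (forall i, (i < n)%nat -> Cderiv (f i) t (df i)) ->
  Cderiv (fun s => csum (fun i => f i s) n) t (csum df n).
Proof.
  induction n; intros H; simpl.
  - apply Cderiv_const.
  - apply Cderiv_plus; auto.
Qed.

Lemma Cderiv_comp (f : R -> C) (g : R -> R) (t : R) (a : C) (b : R) :
  Cderiv f (g t) a -> is_derive g t b -> Cderiv (fun s => f (g s)) t (b * a)%C.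
Proof.
  intros [H1 H2] H; split.
  - eapply is_derive_eq.
    apply (is_derive_comp (fun s => Re (f s)) g); eassumption.
    rewrite re_scal_l. reflexivity.
  - eapply is_derive_eq.
    apply (is_derive_comp (fun s => Im (f s)) g); eassumption.
    rewrite im_scal_l. reflexivity.
Qed.

Lemma is_derive_continuity_pt (f : R -> R) (t l : R) : is_derive f t l -> continuity_pt f t.
Proof.
  intros H. apply continuity_pt_filterlim. apply (ex_derive_continuous f t). exists l; auto.
Qed.

(* Projecting [f] on the direction of [f b - f a] reduces to the real mean value theorem. *)
Lemma Cmod_mean_value (f df : R -> C) (a b M : R) :
  (forall t, Rmin a b <= t <= Rmax a b -> Cderiv f t (df t)) ->
  (forall t, Rmin a b <= t <= Rmax a b -> Cmod (df t) <= M) ->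
  Cmod (f b - f a) <= M * Rabs (b - a).
Proof.
  intros Hd HM.
  set (u := (f b - f a)%C).
  set (g := fun t => Re (Cconj u * f t)).
  set (dg := fun t => Re (Cconj u * df t)).
  assert (Hg : forall t, Rmin a b <= t <= Rmax a b -> is_derive g t (dg t)).
  { intros t Ht. apply (Cderiv_scal (Cconj u) f t (df t) (Hd t Ht)). }
  destruct (MVT_gen g a b dg) as [c [Hc E]].
  - intros t Ht; apply Hg; lra.
  - intros t Ht. apply is_derive_continuity_pt with (dg t). auto.
  - assert (E1 : g b - g a = Cmod u * Cmod u).
    { unfold g. rewrite <- re_minus.
      replace (Cconj u * f b - Cconj u * f a)%C with (Cconj u * u)%C by (unfold u; ring).
      rewrite Cmod_sqr, re_mult. unfold Cconj; simpl. unfold Re, Im. ring. }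
    assert (E2 : Rabs (dg c) <= Cmod u * M).
    { unfold dg. eapply Rle_trans; [apply re_le_Cmod|].
      rewrite Cmod_mult, Cmod_conj. apply Rmult_le_compat_l; auto using Cmod_ge_0. }
    generalize (Cmod_ge_0 u); intros Hu.
    destruct (Rle_lt_or_eq_dec 0 _ Hu) as [Hlt | Heq].
    + apply Rmult_le_reg_l with (Cmod u); auto.
      rewrite <- E1, E. eapply Rle_trans; [apply Rle_abs|].
      rewrite Rabs_mult, <- Rmult_assoc.
      apply Rmult_le_compat_r; auto using Rabs_pos.
    + rewrite <- Heq. apply Rmult_le_pos; [|apply Rabs_pos].
      apply Rle_trans with (Cmod (df c)); auto using Cmod_ge_0.
Qed.

Lemma Cderiv_0_const (f : R -> C) (a b : R) :
  (forall t, Rmin a b <= t <= Rmax a b -> Cderiv f t 0) -> f b = f a.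
Proof.
  intros H. apply Ceq_minus, Cmod_eq_0, Rle_antisym; [|apply Cmod_ge_0].
  rewrite <- (Rmult_0_l (Rabs (b - a))).
  apply Cmod_mean_value with (fun _ => RtoC 0); auto.
  intros; rewrite Cmod_0; lra.
Qed.

(** * Exponential and principal logarithm *)

Lemma Cexp_plus (z w : C) : Cexp (z + w) = (Cexp z * Cexp w)%C.
Proof.
  apply Ceq; unfold Cexp; rewrite ?re_mult, ?im_mult, re_plus, im_plus, exp_plus; simpl.
  - rewrite cos_plus. ring.
  - rewrite sin_plus. ring.
Qed.

Lemma Cexp_0 : Cexp 0 = 1.
Proof. apply Ceq; unfold Cexp; simpl; rewrite exp_0, ?cos_0, ?sin_0; ring. Qed.

Lemma Cmod_Cexp (z : C) : Cmod (Cexp z) = exp (Re z).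
Proof.
  generalize (Cmod_sqr (Cexp z)) (Cmod_ge_0 (Cexp z)) (exp_pos (Re z)).
  generalize (sin2_cos2 (Im z)). unfold Cexp, Rsqr. simpl. intros H E H1 H2.
  assert (Cmod (Cexp z) * Cmod (Cexp z) = exp (Re z) * exp (Re z)).
  { unfold Cexp. rewrite E.
    transitivity (exp (Re z) * exp (Re z) * (sin (Im z) * sin (Im z) + cos (Im z) * cos (Im z))).
    ring. rewrite H; ring. }
  unfold Cexp in *. nra.
Qed.

Lemma Cexp_neq_0 (z : C) : Cexp z <> 0.
Proof. apply Cmod_gt_0. rewrite Cmod_Cexp. apply exp_pos. Qed.

Lemma Cexp_opp (z : C) : Cexp (- z) = (/ Cexp z)%C.
Proof.
  assert (E : (Cexp (- z) * Cexp z)%C = 1).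
  { rewrite <- Cexp_plus. replace (- z + z)%C with (RtoC 0) by ring. apply Cexp_0. }
  generalize (Cexp_neq_0 z); intros H.
  replace (Cexp (- z)) with (Cexp (- z) * Cexp z / Cexp z)%C by (field; auto).
  rewrite E. field; auto.
Qed.

Lemma Cexp_INR_mult (n : nat) (z : C) : Cexp (INR n * z) = (Cexp z ^ n)%C.
Proof.
  induction n.
  - simpl. rewrite Cmult_0_l. apply Cexp_0.
  - rewrite S_INR, RtoC_plus, Cpow_S, <- IHn, <- Cexp_plus. f_equal. ring.
Qed.

Lemma Cexp_RtoC (r : R) : Cexp r = exp r.
Proof. apply Ceq; unfold Cexp; simpl; rewrite ?cos_0, ?sin_0; ring. Qed.

Lemma slit_plane_neq_0 (z : C) : slit_plane z -> z <> 0%C.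
Proof. intros H E. apply H. rewrite E; simpl; split; lra. Qed.

Lemma slit_plane_Cmod_pos (z : C) : slit_plane z -> 0 < Cmod z.
Proof. intros H. apply Cmod_gt_0, slit_plane_neq_0; auto. Qed.

Lemma slit_plane_Cmod_Re (z : C) : slit_plane z -> 0 < Cmod z + Re z.
Proof.
  intros H. generalize (Cmod_sqr z) (Cmod_ge_0 z); intros E H0.
  destruct (Req_dec (Im z) 0) as [Hi | Hi].
  - assert (0 < Re z). { apply Rnot_le_lt. intros Hr; apply H; auto. } lra.
  - assert (0 < Im z * Im z) by nra. nra.
Qed.

Lemma slit_plane_scal (r : R) (z : C) : 0 < r -> slit_plane z -> slit_plane (r * z)%C.
Proof.
  intros Hr H [H1 H2]. apply H. rewrite im_scal_l in H1. rewrite re_scal_l in H2. split; nra.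
Qed.

Lemma slit_plane_plus (z : C) (t : R) : 0 <= t -> slit_plane z -> slit_plane (z + t)%C.
Proof.
  intros Ht H [H1 H2]. apply H. rewrite im_plus in H1. rewrite re_plus in H2.
  simpl in *. split; lra.
Qed.

Lemma slit_plane_RtoC (r : R) : 0 < r -> slit_plane r.
Proof. intros H [H1 H2]. simpl in H2. lra. Qed.

Lemma slit_plane_affine (z : C) (s t : R) :
  0 <= s -> 0 <= t -> 0 < s + t -> slit_plane z -> slit_plane (t + s * z)%C.
Proof.
  intros Hs Ht Hst H. destruct (Rle_lt_or_eq_dec 0 s Hs) as [H1 | <-].
  - rewrite Cplus_comm. apply slit_plane_plus; auto. apply slit_plane_scal; auto.
  - rewrite Cmult_0_l, Cplus_0_r. apply slit_plane_RtoC. lra.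
Qed.

Lemma slit_plane_Cexp (z : C) : Rabs (Im z) < PI -> slit_plane (Cexp z).
Proof.
  intros H [H1 H2]. unfold Cexp in *; simpl in *.
  generalize (exp_pos (Re z)); intros He.
  assert (Hs : sin (Im z) = 0) by nra.
  assert (Hc : cos (Im z) <= 0) by nra.
  apply Rabs_def2 in H. destruct H as [Ha Hb].
  destruct (Rtotal_order (Im z) 0) as [Hlt | [Heq | Hgt]].
  - assert (0 < sin (- Im z)) by (apply sin_gt_0; lra).
    rewrite sin_neg in *. lra.
  - rewrite Heq, cos_0 in Hc. lra.
  - assert (0 < sin (Im z)) by (apply sin_gt_0; lra). lra.
Qed.

Lemma Clog_Cexp (w : C) : Rabs (Im w) < PI -> Clog (Cexp w) = w.
Proof.
  intros H. apply Ceq; unfold Clog; simpl.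
  - rewrite Cmod_Cexp. apply ln_exp.
  - unfold Carg. rewrite Cmod_Cexp. unfold Cexp; simpl.
    generalize (exp_pos (Re w)); intros He.
    replace (exp (Re w) * cos (Im w) / exp (Re w)) with (cos (Im w)) by (field; lra).
    apply Rabs_def2 in H. destruct H as [Ha Hb].
    destruct (Rle_dec 0 (exp (Re w) * sin (Im w))) as [Hs | Hs].
    + destruct (Rle_dec 0 (Im w)) as [Hi | Hi].
      * apply acos_cos; lra.
      * assert (0 < sin (- Im w)) by (apply sin_gt_0; lra).
        rewrite sin_neg in *. nra.
    + destruct (Rle_dec 0 (Im w)) as [Hi | Hi].
      * assert (0 <= sin (Im w)) by (apply sin_ge_0; lra). nra.
      * rewrite <- (cos_neg (Im w)), acos_cos; lra.
Qed.

Lemma cos_2_atan (u : R) : cos (2 * atan u) = (1 - u * u) / (1 + u * u).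
Proof.
  assert (H : 0 < 1 + u * u) by nra.
  rewrite cos_2a_cos, cos_atan. unfold Rsqr.
  replace (2 * (1 / sqrt (1 + u * u)) * (1 / sqrt (1 + u * u)) - 1)
    with (2 / (sqrt (1 + u * u) * sqrt (1 + u * u)) - 1).
  - rewrite sqrt_sqrt; [field|]; lra.
  - field. apply Rgt_not_eq, sqrt_lt_R0; auto.
Qed.

Lemma sin_2_atan (u : R) : sin (2 * atan u) = 2 * u / (1 + u * u).
Proof.
  assert (H : 0 < 1 + u * u) by nra.
  rewrite sin_2a, cos_atan, sin_atan. unfold Rsqr.
  replace (2 * (u / sqrt (1 + u * u)) * (1 / sqrt (1 + u * u)))
    with (2 * u / (sqrt (1 + u * u) * sqrt (1 + u * u))).
  - rewrite sqrt_sqrt; [field|]; lra.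
  - field. apply Rgt_not_eq, sqrt_lt_R0; auto.
Qed.

(* Unlike the arc cosine, the half-angle formula is differentiable on the whole slit plane. *)
Definition half_angle_log (z : C) : C := (ln (Cmod z), 2 * atan (Im z / (Cmod z + Re z))).

Lemma Cexp_half_angle_log (z : C) : slit_plane z -> Cexp (half_angle_log z) = z.
Proof.
  intros H. generalize (slit_plane_Cmod_pos z H) (slit_plane_Cmod_Re z H) (Cmod_sqr z).
  intros Hr HD E. set (r := Cmod z) in *.
  assert (HD2 : (r + Re z) * (r + Re z) + Im z * Im z <> 0) by nra.
  (* With [u] the tangent of half the argument, [(r + Re z)^2 + (Im z)^2 = 2 r (r + Re z)], because
     [r^2 = (Re z)^2 + (Im z)^2]. *)
  assert (Hu : 1 + Im z / (r + Re z) * (Im z / (r + Re z))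
    = 2 * r / (r + Re z)).
  { apply Rmult_eq_reg_r with ((r + Re z) * (r + Re z)); [|nra].
    field_simplify; [|lra|lra]. nra. }
  apply Ceq; unfold Cexp, half_angle_log; simpl; fold r; rewrite exp_ln by auto.
  - rewrite cos_2_atan, Hu.
    replace (1 - Im z / (r + Re z) * (Im z / (r + Re z))) with (2 - 2 * r / (r + Re z)) by lra.
    field; lra.
  - rewrite sin_2_atan, Hu. field; lra.
Qed.

Lemma Clog_half_angle (z : C) : slit_plane z -> Clog z = half_angle_log z.
Proof.
  intros H. rewrite <- (Cexp_half_angle_log z H) at 1. apply Clog_Cexp.
  unfold half_angle_log; simpl.
  generalize (atan_bound (Im z / (Cmod z + Re z))). intros. apply Rabs_def1; lra.
Qed.

Lemma Cexp_Clog (z : C) : slit_plane z -> Cexp (Clog z) = z.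
Proof. intros H. rewrite Clog_half_angle; auto using Cexp_half_angle_log. Qed.

Lemma Im_Clog_bound (z : C) : slit_plane z -> Rabs (Im (Clog z)) < PI.
Proof.
  intros H. rewrite Clog_half_angle; auto. unfold half_angle_log; simpl.
  generalize (atan_bound (Im z / (Cmod z + Re z))). intros. apply Rabs_def1; lra.
Qed.

Lemma Clog_RtoC (r : R) : 0 < r -> Clog r = ln r.
Proof.
  intros H. rewrite <- (exp_ln r H) at 1. rewrite <- Cexp_RtoC, Clog_Cexp; auto.
  simpl. rewrite Rabs_R0. apply PI_RGT_0.
Qed.

Lemma Clog_scal (r : R) (z : C) : 0 < r -> slit_plane z -> Clog (r * z) = (ln r + Clog z)%C.
Proof.
  intros Hr H. rewrite <- (Cexp_Clog z H) at 1. rewrite <- (exp_ln r Hr) at 1.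
  rewrite <- Cexp_RtoC, <- Cexp_plus, Clog_Cexp; auto.
  rewrite im_plus. simpl Im at 1. rewrite Rplus_0_l. apply Im_Clog_bound; auto.
Qed.

Lemma Cinv_eq_Cexp (z : C) : slit_plane z -> (/ z)%C = Cexp (- Clog z).
Proof. intros H. rewrite Cexp_opp, Cexp_Clog; auto. Qed.

Lemma slit_plane_inv (z : C) : slit_plane z -> slit_plane (/ z)%C.
Proof.
  intros H. rewrite Cinv_eq_Cexp; auto. apply slit_plane_Cexp.
  simpl. rewrite Rabs_Ropp. apply (Im_Clog_bound z H).
Qed.

Lemma Clog_inv (z : C) : slit_plane z -> Clog (/ z) = (- Clog z)%C.
Proof.
  intros H. rewrite Cinv_eq_Cexp; auto. apply Clog_Cexp.
  simpl. rewrite Rabs_Ropp. apply (Im_Clog_bound z H).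
Qed.

Lemma Cderiv_Cexp (f : R -> C) (t : R) (a : C) :
  Cderiv f t a -> Cderiv (fun s => Cexp (f s)) t (a * Cexp (f t))%C.
Proof.
  intros [H1 H2].
  assert (He : is_derive (fun s => exp (Re (f s))) t (Re a * exp (Re (f t)))).
  { apply (is_derive_comp exp (fun s => Re (f s))); auto. apply is_derive_exp. }
  assert (Hc : is_derive (fun s => cos (Im (f s))) t (Im a * - sin (Im (f t)))).
  { apply (is_derive_comp cos (fun s => Im (f s))); auto. apply is_derive_cos. }
  assert (Hs : is_derive (fun s => sin (Im (f s))) t (Im a * cos (Im (f t)))).
  { apply (is_derive_comp sin (fun s => Im (f s))); auto. apply is_derive_sin. }
  split; unfold Cexp; simpl.
  - eapply is_derive_eq; [apply is_derive_Rmult; eassumption|].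
    unfold Re, Im; simpl. ring.
  - eapply is_derive_eq; [apply is_derive_Rmult; eassumption|].
    unfold Re, Im; simpl. ring.
Qed.

Lemma locally_is_derive_pos (f : R -> R) (t l : R) :
  is_derive f t l -> 0 < f t -> locally t (fun s => 0 < f s).
Proof.
  intros H Hp.
  assert (Hc : continuous f t) by (apply (ex_derive_continuous f t); exists l; auto).
  apply (Hc (fun y => 0 < y)). apply open_gt. exact Hp.
Qed.

Lemma Re_Im_Cinv (z : C) :
  Re (/ z) = Re z / (Re z * Re z + Im z * Im z) /\
  Im (/ z) = - Im z / (Re z * Re z + Im z * Im z).
Proof. unfold Cinv, Re, Im; simpl. rewrite !Rmult_1_r. auto. Qed.

Lemma locally_slit_plane (f : R -> C) (t : R) (a : C) :
  Cderiv f t a -> slit_plane (f t) -> locally t (fun s => slit_plane (f s)).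
Proof.
  intros [H1 H2] Hs.
  destruct (Rle_lt_dec (Re (f t)) 0) as [Hr | Hr].
  - assert (Hi : Im (f t) <> 0) by (intros E; apply Hs; auto).
    assert (Hp : locally t (fun s => 0 < Im (f s) * Im (f s))).
    { eapply locally_is_derive_pos with (f := fun s => Im (f s) * Im (f s)).
      apply is_derive_Rmult; eassumption. nra. }
    revert Hp. apply filter_imp. intros s Hp [E _]. rewrite E in Hp. lra.
  - generalize (locally_is_derive_pos _ _ _ H1 Hr). apply filter_imp.
    intros s Hp [_ E]. lra.
Qed.

Lemma Cderiv_Clog (f : R -> C) (t : R) (a : C) :
  slit_plane (f t) -> Cderiv f t a -> Cderiv (fun s => Clog (f s)) t (a / f t)%C.
Proof.
  intros Hs H. generalize (locally_slit_plane f t a H Hs). intros Hloc.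
  destruct H as [H1 H2].
  generalize (slit_plane_Cmod_pos _ Hs) (slit_plane_Cmod_Re _ Hs) (Cmod_sqr (f t)).
  intros Hr HD E.
  assert (Hq : is_derive (fun s => Re (f s) * Re (f s) + Im (f s) * Im (f s)) t
    (2 * (Re (f t) * Re a + Im (f t) * Im a))).
  { eapply is_derive_eq.
    apply (is_derive_plus (fun s => Re (f s) * Re (f s)) (fun s => Im (f s) * Im (f s)));
      apply is_derive_Rmult; eassumption.
    unfold plus; simpl; ring. }
  assert (Hmod : is_derive (fun s => Cmod (f s)) t
    ((Re (f t) * Re a + Im (f t) * Im a) / Cmod (f t))).
  { apply is_derive_ext with (fun s => sqrt (Re (f s) * Re (f s) + Im (f s) * Im (f s))).
    - intros s. unfold Cmod, Re, Im. f_equal. simpl. ring.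
    - eapply is_derive_eq.
      apply (is_derive_comp sqrt (fun s => Re (f s) * Re (f s) + Im (f s) * Im (f s))).
      + apply is_derive_Reals. apply derivable_pt_lim_sqrt. nra.
      + exact Hq.
      + rewrite <- E, sqrt_square by lra. unfold scal; simpl; unfold mult; simpl. field. lra. }
  destruct (Re_Im_Cinv (f t)) as [E1 E2].
  rewrite <- E in E1, E2.
  split.
  - apply is_derive_ext with (fun s => ln (Cmod (f s))); [reflexivity|].
    eapply is_derive_eq.
    + apply (is_derive_comp ln (fun s => Cmod (f s))); [|exact Hmod].
      apply is_derive_ln; auto.
    + unfold Cdiv. rewrite re_mult, E1, E2.
      unfold scal; simpl; unfold mult; simpl. field. lra.
  - apply is_derive_ext_loc with (fun s => 2 * atan (Im (f s) / (Cmod (f s) + Re (f s)))).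
    { revert Hloc; apply filter_imp. intros s Hss. rewrite Clog_half_angle; auto. }
    set (r := Cmod (f t)) in *. set (x := Re (f t)) in *. set (y := Im (f t)) in *.
    set (r' := (x * Re a + y * Im a) / r) in *.
    assert (Hu : is_derive (fun s => Im (f s) / (Cmod (f s) + Re (f s))) t
      ((Im a * (r + x) - y * (r' + Re a)) / ((r + x) ^ 2))).
    { eapply is_derive_eq.
      apply (is_derive_div (fun s => Im (f s)) (fun s => Cmod (f s) + Re (f s))).
      - exact H2.
      - apply (is_derive_plus (fun s => Cmod (f s)) (fun s => Re (f s))); [exact Hmod | exact H1].
      - fold r x. lra.
      - reflexivity. }
    eapply is_derive_eq.
    + apply (is_derive_scal (fun s => atan (Im (f s) / (Cmod (f s) + Re (f s))))).
      apply (is_derive_comp atan (fun s => Im (f s) / (Cmod (f s) + Re (f s)))); [|exact Hu].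
      apply is_derive_atan.
    + fold r x y. unfold Cdiv. rewrite im_mult, E1, E2. fold x y.
      unfold scal; simpl; unfold mult; simpl. unfold Rsqr.
      assert (Hv : 1 + y / (r + x) * (y / (r + x)) = 2 * r / (r + x)).
      { apply Rmult_eq_reg_r with ((r + x) * (r + x)); [|nra].
        field_simplify; [|lra|lra]. nra. }
      rewrite Hv. unfold r'.
      transitivity ((r * (Im a * (r + x) - y * Re a) - x * y * Re a - y * y * Im a)
        / (r * r * (r + x))).
      * field. lra.
      * replace (y * y) with (r * r - x * x) by lra. field. lra.
Qed.

Lemma Cderiv_Clog_line (z : C) (t : R) :
  slit_plane (z + t)%C -> Cderiv (fun s => Clog (z + s)%C) t (/ (z + t))%C.
Proof.
  intros H. eapply Cderiv_eq.
  - apply (Cderiv_Clog (fun s => z + s)%C t 1); auto.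
    eapply Cderiv_eq.
    + apply Cderiv_plus; [apply Cderiv_const | apply Cderiv_id].
    + apply Cplus_0_l.
  - field. apply slit_plane_neq_0; auto.
Qed.

(* [|s z + t|^2 = (1 + cos arg z)/2 (s|z| + t)^2 + (1 - cos arg z)/2 (s|z| - t)^2]. *)
Lemma slit_plane_cone_cos (z : C) : slit_plane z ->
  0 < (1 + Re z / Cmod z) / 2 <= 1 /\ forall s t, 0 <= s -> 0 <= t ->
    (1 + Re z / Cmod z) / 2 * (s * Cmod z + t) <= Cmod (s * z + t).
Proof.
  intros H. generalize (slit_plane_Cmod_pos _ H) (slit_plane_Cmod_Re _ H) (Cmod_sqr z).
  intros Hr HD E. set (r := Cmod z) in *.
  assert (Hre : Re z <= r) by (apply Rle_trans with (1 := Rle_abs _); apply re_le_Cmod).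
  set (q := Re z / r).
  assert (Hq : q * r = Re z) by (unfold q; field; lra).
  assert (Hq1 : -1 < q) by (apply Rmult_lt_reg_r with r; lra).
  assert (Hq2 : q <= 1) by (apply Rmult_le_reg_r with r; lra).
  set (c := (1 + q) / 2). split; [unfold c; lra|].
  intros s t Hs Ht.
  assert (E2 : Cmod (s * z + t) * Cmod (s * z + t) =
    c * ((s * r + t) * (s * r + t)) + (1 - q) / 2 * ((s * r - t) * (s * r - t))).
  { rewrite Cmod_sqr, re_plus, im_plus, re_scal_l, im_scal_l. simpl. unfold c.
    transitivity (s * s * (r * r) + 2 * s * t * (q * r) + t * t); [|field].
    rewrite E, Hq. ring. }
  assert (Hc : 0 < c <= 1) by (unfold c; lra).
  assert (Hsr : 0 <= s * r + t) by nra.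
  generalize (Cmod_ge_0 (s * z + t)). intros Hm.
  apply Rnot_lt_le. intros Hlt.
  assert (H1 : Cmod (s * z + t) * Cmod (s * z + t) < (c * (s * r + t)) * (c * (s * r + t))) by nra.
  rewrite E2 in H1.
  assert (0 <= (1 - q) / 2 * ((s * r - t) * (s * r - t))).
  { apply Rmult_le_pos; [lra|]. apply Rle_0_sqr. }
  assert (c * c * ((s * r + t) * (s * r + t)) <= c * ((s * r + t) * (s * r + t))).
  { apply Rmult_le_compat_r; nra. }
  nra.
Qed.

Lemma slit_plane_cone (z : C) : slit_plane z ->
  exists c, 0 < c <= 1 /\ forall s t, 0 <= s -> 0 <= t ->
    c * (s * Cmod z + t) <= Cmod (s * z + t).
Proof. intros H. exists ((1 + Re z / Cmod z) / 2). apply slit_plane_cone_cos; auto. Qed.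

(** * The digamma function *)

(** The constant is kept explicit because it is invariant under positive scaling of [z], see
    [cone_bound_scal]: one [c] then serves all multiples [n^N x], or all multiples of one point
    [upoint]. *)
Definition cone_bound (c : R) (z : C) : Prop :=
  0 < c <= 1 /\ forall s t, 0 <= s -> 0 <= t -> c * (s * Cmod z + t) <= Cmod (s * z + t).

Lemma cone_bound_scal (c r : R) (z : C) : 0 < r -> cone_bound c z -> cone_bound c (r * z)%C.
Proof.
  intros Hr [Hc H]; split; auto. intros s t Hs Ht.
  rewrite Cmod_mult, Cmod_RtoC_pos by lra.
  replace (s * (r * z) + t)%C with ((s * r)%R * z + t)%C by (rewrite RtoC_mult; ring).
  rewrite <- Rmult_assoc. apply H; nra.
Qed.

Lemma cone_bound_shift (c : R) (z : C) (t : R) :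
  cone_bound c z -> 0 <= t -> c * (Cmod z + t) <= Cmod (z + t).
Proof.
  intros [Hc H] Ht. generalize (H 1 t Rle_0_1 Ht). rewrite Rmult_1_l, Cmult_1_l. auto.
Qed.

(** Here the constant depends only on a bound for the argument, so that it can be shared by all
    points of a path inside a sector. *)
Lemma cone_bound_Cexp (alpha : R) (w : C) : Rabs (Im w) <= alpha -> alpha < PI ->
  cone_bound ((1 + cos alpha) / 2) (Cexp w).
Proof.
  intros H Ha. assert (H0 := Rabs_pos (Im w)).
  assert (Hs : slit_plane (Cexp w)) by (apply slit_plane_Cexp; lra).
  destruct (slit_plane_cone_cos _ Hs) as [Hc Hb].
  assert (E : Re (Cexp w) / Cmod (Cexp w) = cos (Rabs (Im w))).
  { rewrite Cmod_Cexp. unfold Cexp; simpl.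
    replace (cos (Rabs (Im w))) with (cos (Im w))
      by (unfold Rabs; destruct (Rcase_abs (Im w)); rewrite ?cos_neg; auto).
    field. apply Rgt_not_eq, exp_pos. }
  rewrite E in *.
  assert (Hle : cos alpha <= cos (Rabs (Im w))) by (apply cos_decr_1; lra).
  assert (Hgt : -1 < cos alpha).
  { rewrite <- cos_PI. apply cos_decreasing_1; lra. }
  split; [lra|]. intros s t Hs0 Ht. eapply Rle_trans; [|apply Hb; auto].
  apply Rmult_le_compat_r; [|lra]. generalize (Cmod_ge_0 (Cexp w)). nra.
Qed.

(** The decreasing sequence [d] converges, so the increments are absolutely summable; summing them
    from [n] on gives the explicit remainder [d n], on which all uniform estimates rest. *)
Lemma Clim_telescoping (u : nat -> C) (d : nat -> R) :
  (forall n, 0 <= d n) -> (forall n, Cmod (u (S n) - u n) <= d n - d (S n)) ->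
  exists l, Clim u l /\ forall n, Cmod (l - u n) <= d n.
Proof.
  intros Hd H.
  assert (Hb : ex_series (fun n => d n - d (S n))).
  { assert (Hlim : ex_finite_lim_seq d).
    { apply ex_finite_lim_seq_decr with 0; auto.
      intros n. generalize (H n) (Cmod_ge_0 (u (S n) - u n)). lra. }
    destruct Hlim as [l Hl]. exists (d 0%nat - l). apply is_series_rsum.
    apply is_lim_seq_ext with (fun n => d 0%nat - d n).
    - intros n. induction n; simpl; [ring | rewrite <- IHn; ring].
    - apply is_lim_seq_minus'; auto. apply is_lim_seq_const. }
  destruct (Clim_csum_dominated (fun n => u (S n) - u n)%C _ H Hb) as [l Hl].
  assert (HL : Clim u (l + u 0%nat)%C).
  { apply Clim_ext with (fun n => csum (fun n => u (S n) - u n)%C n + u 0%nat)%C.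
    - intros n. induction n; simpl; [ring|].
      replace (u (S n)) with (u n + (u (S n) - u n))%C at 2 by ring.
      rewrite <- IHn at 2. ring.
    - apply Clim_plus; auto. apply Clim_const. }
  exists (l + u 0%nat)%C. split; auto. intros n.
  apply Clim_Cmod_le with (fun k => u (k + n)%nat).
  - apply (is_lim_seq_incr_n (fun k => Cmod (u k - (l + u 0%nat))) n). exact HL.
  - intros k. apply Rle_trans with (d n - d (k + n)%nat); [|generalize (Hd (k + n)%nat); lra].
    induction k; simpl.
    + replace (u n - u n)%C with (RtoC 0) by ring. rewrite Cmod_0. lra.
    + replace (u (S (k + n)) - u n)%C with
        ((u (S (k + n)) - u (k + n)%nat) + (u (k + n)%nat - u n))%C by ring.
      eapply Rle_trans; [apply Cmod_triangle|]. generalize (H (k + n)%nat). lra.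
Qed.

Lemma inv_shift_diff (r : R) (n : nat) :
  0 < r -> / (r + INR n) - / (r + INR (S n)) = / ((r + INR n) * (r + INR (S n))).
Proof. intros H. generalize (pos_INR n). intros. rewrite S_INR. field. lra. Qed.

(** The derivative of [log (y + n + t) - t / (y + n + 1)] is [(1 - t) / ((y + n + t) (y + n + 1))].
    The cone bound makes it at most a multiple of [1 / ((|y| + n) (|y| + n + 1))], which
    telescopes. *)
Lemma Clog_step (c : R) (y : C) (n : nat) : slit_plane y -> cone_bound c y ->
  Cmod (Clog (y + INR (S n)) - Clog (y + INR n) - / (y + INR (S n))) <=
  / (c * c) * (/ (Cmod y + INR n) - / (Cmod y + INR (S n))).
Proof.
  intros Hy Hc. generalize (slit_plane_Cmod_pos y Hy) (pos_INR n). intros Hr Hn.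
  assert (Hc0 := proj1 Hc).
  set (w := (y + INR (S n))%C).
  set (f := fun t : R => (Clog (y + (INR n + t)%R) - t / w)%C).
  set (df := fun t : R => (/ (y + (INR n + t)%R) - / w)%C).
  assert (Hw : w <> 0%C).
  { apply slit_plane_neq_0, slit_plane_plus; auto using pos_INR. }
  assert (Hd : forall t, Rmin 0 1 <= t <= Rmax 0 1 -> Cderiv f t (df t)).
  { intros t. rewrite Rmin_left, Rmax_right by lra. intros Ht. unfold f, df.
    apply Cderiv_minus.
    - eapply Cderiv_eq.
      + apply (Cderiv_comp (fun s => Clog (y + s)%C) (fun s => INR n + s) t).
        * apply Cderiv_Clog_line. apply slit_plane_plus; auto. lra.
        * instantiate (1 := 1). auto_derive; auto.
      + apply Cmult_1_l.
    - apply Cderiv_ext with (fun s : R => (/ w * s)%C).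
      + intros s. unfold Cdiv. apply Cmult_comm.
      + eapply Cderiv_eq. apply Cderiv_scal, Cderiv_id. ring. }
  replace (Clog w - Clog (y + INR n) - / w)%C with (f 1 - f 0)%C.
  2:{ unfold f, w. rewrite S_INR, Rplus_0_r. unfold Cdiv. ring. }
  eapply Rle_trans; [apply (Cmod_mean_value f df 0 1
    (/ (c * c) * (/ (Cmod y + INR n) - / (Cmod y + INR (S n)))) Hd)|].
  - intros t. rewrite Rmin_left, Rmax_right by lra. intros Ht. unfold df.
    assert (Hz : (y + (INR n + t)%R)%C <> 0%C).
    { apply slit_plane_neq_0, slit_plane_plus; auto. lra. }
    replace (/ (y + (INR n + t)%R) - / w)%C with ((1 - t)%R / ((y + (INR n + t)%R) * w))%C.
    2:{ unfold w in *. rewrite S_INR in *. rewrite !RtoC_plus in *. rewrite RtoC_minus. field. auto. }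
    rewrite Cmod_div, Cmod_mult, Cmod_RtoC_pos by (try apply Cmult_neq_0; auto; lra).
    assert (H1 : c * (Cmod y + INR n) <= Cmod (y + (INR n + t)%R)).
    { eapply Rle_trans; [|apply (cone_bound_shift c); auto; lra]. nra. }
    assert (H2 : c * (Cmod y + INR (S n)) <= Cmod w).
    { apply cone_bound_shift; auto using pos_INR. }
    rewrite inv_shift_diff by auto. rewrite <- Rinv_mult.
    assert (H3 : 0 < Cmod y + INR n) by lra.
    assert (H4 : 0 < Cmod y + INR (S n)) by (rewrite S_INR; lra).
    assert (H5 : 0 < c * (Cmod y + INR n)) by nra.
    assert (H6 : 0 < c * (Cmod y + INR (S n))) by nra.
    apply Rle_trans with (1 * / (Cmod (y + (INR n + t)%R) * Cmod w)).
    + apply Rmult_le_compat_r; [|lra].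
      apply Rlt_le, Rinv_0_lt_compat, Rmult_lt_0_compat; lra.
    + rewrite Rmult_1_l. apply Rinv_le_contravar.
      * replace (c * c * ((Cmod y + INR n) * (Cmod y + INR (S n))))
          with ((c * (Cmod y + INR n)) * (c * (Cmod y + INR (S n)))) by ring.
        apply Rmult_lt_0_compat; auto.
      * replace (c * c * ((Cmod y + INR n) * (Cmod y + INR (S n))))
          with ((c * (Cmod y + INR n)) * (c * (Cmod y + INR (S n)))) by ring.
        apply Rmult_le_compat; lra.
  - rewrite Rminus_0_r, Rabs_R1. lra.
Qed.

Definition harm (y : C) (n : nat) : C := csum (fun i => / (y + INR (S i)))%C n.

Lemma harm_S (y : C) (n : nat) : harm y (S n) = (harm y n + / (y + INR (S n)))%C.
Proof. reflexivity. Qed.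

(* [psi (y + 1)], see [Cdigamma_eq]. *)
Definition digamma1 (y : C) : C := CLim_seq (fun n => Clog (y + INR n) - harm y n)%C.

Lemma digamma1_lim_remainder (c : R) (y : C) : slit_plane y -> cone_bound c y ->
  Clim (fun n => Clog (y + INR n) - harm y n)%C (digamma1 y) /\
  forall n, Cmod (digamma1 y - (Clog (y + INR n) - harm y n)) <= / (c * c) * / (Cmod y + INR n).
Proof.
  intros Hy Hc. generalize (slit_plane_Cmod_pos y Hy). intros Hr.
  assert (Hc2 : 0 < / (c * c)) by (destruct Hc as [Hc _]; apply Rinv_0_lt_compat; nra).
  destruct (Clim_telescoping (fun n => Clog (y + INR n) - harm y n)%C
    (fun n => / (c * c) * / (Cmod y + INR n))) as [l [Hl Hb]].
  - intros n. apply Rmult_le_pos; [lra|].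
    apply Rlt_le, Rinv_0_lt_compat. generalize (pos_INR n). lra.
  - intros n. rewrite <- Rmult_minus_distr_l.
    eapply Rle_trans; [|apply Clog_step; auto]. right.
    rewrite harm_S. f_equal. ring.
  - unfold digamma1. rewrite (CLim_seq_unique _ _ Hl). auto.
Qed.

Lemma digamma1_lim (y : C) : slit_plane y ->
  Clim (fun n => Clog (y + INR n) - harm y n)%C (digamma1 y).
Proof.
  intros Hy. destruct (slit_plane_cone y Hy) as [c Hc].
  apply (digamma1_lim_remainder c y Hy Hc).
Qed.

Lemma is_lim_seq_inv_INR_S : is_lim_seq (fun n => / INR (S n)) 0.
Proof.
  apply (is_lim_seq_incr_1 (fun n => / INR n)).
  apply (is_lim_seq_inv INR p_infty); [apply is_lim_seq_INR | discriminate].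
Qed.

Lemma Clog_shift_bound (c : R) (z : C) (a : R) : slit_plane z -> cone_bound c z -> 0 < a ->
  Cmod (Clog (z + a) - ln a) <= Cmod z / (c * a).
Proof.
  intros Hz Hc Ha. assert (Hc0 := proj1 Hc).
  set (f := fun t : R => Clog (a + t * z)%C).
  set (df := fun t : R => (z / (a + t * z))%C).
  rewrite <- Clog_RtoC by auto.
  replace (Clog (z + a) - Clog a)%C with (f 1 - f 0)%C.
  2:{ unfold f. f_equal; [f_equal; ring | do 2 f_equal; ring]. }
  eapply Rle_trans; [apply (Cmod_mean_value f df 0 1 (Cmod z / (c * a)))|].
  - intros t. rewrite Rmin_left, Rmax_right by lra. intros Ht. unfold f, df.
    apply (Cderiv_Clog (fun t : R => a + t * z)%C).
    + apply slit_plane_affine; auto; lra.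
    + eapply Cderiv_eq.
      * apply Cderiv_plus; [apply Cderiv_const|].
        apply Cderiv_mult; [apply Cderiv_id | apply Cderiv_const].
      * cbv beta; ring.
  - intros t. rewrite Rmin_left, Rmax_right by lra. intros Ht. unfold df.
    rewrite Cmod_div by (apply slit_plane_neq_0, slit_plane_affine; auto; lra).
    apply Rmult_le_compat_l; [apply Cmod_ge_0|].
    apply Rinv_le_contravar; [nra|].
    rewrite Cplus_comm. eapply Rle_trans; [|apply (proj2 Hc); lra].
    generalize (Cmod_ge_0 z). intros.
    apply Rmult_le_compat_l; nra.
  - rewrite Rminus_0_r, Rabs_R1. lra.
Qed.

Lemma Clog_shift_lim (z : C) : slit_plane z ->
  Clim (fun n => Clog (z + INR (S n)) - ln (INR (S n)))%C 0.
Proof.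
  intros Hz. destruct (slit_plane_cone z Hz) as [c Hc].
  apply Clim_intro with (fun n => Cmod z / c * / INR (S n)).
  - intros n. generalize (lt_0_INR (S n) (Nat.lt_0_succ n)). intros Hn.
    replace (Clog (z + INR (S n)) - ln (INR (S n)) - 0)%C
      with (Clog (z + INR (S n)) - ln (INR (S n)))%C by ring.
    eapply Rle_trans; [apply (Clog_shift_bound c); auto|].
    right. field. destruct Hc; lra.
  - apply is_lim_seq_mult_0, is_lim_seq_inv_INR_S.
Qed.

(** Replacing [Clog (y + n)] by [ln n] gives up the rate of convergence, but the new term does not
    depend on [y] and therefore factors out of weighted sums over several points [y]. *)
Lemma digamma1_lim_ln (y : C) : slit_plane y ->
  Clim (fun n => ln (INR (S n)) - harm y (S n))%C (digamma1 y).
Proof.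
  intros Hy.
  apply Clim_ext with (fun n => (Clog (y + INR (S n)) - harm y (S n)) -
    (Clog (y + INR (S n)) - ln (INR (S n))))%C.
  - intros n. ring.
  - replace (digamma1 y) with (digamma1 y - 0)%C by ring.
    apply Clim_minus; [|apply Clog_shift_lim; auto].
    apply (Clim_incr_1 (fun n => Clog (y + INR n) - harm y n)%C). apply digamma1_lim; auto.
Qed.

(** * The logarithm of the Gamma function and its derivative *)

Definition ln_gauss (z : C) (n : nat) : C :=
  (z * ln (INR n) + ln (INR (fact n)) - csum (fun i => Clog (z + INR i)) (S n))%C.

Lemma ln_gauss_S (z : C) (n : nat) : (0 < n)%nat ->
  ln_gauss z (S n) = (ln_gauss z n + z * (ln (INR (S n)) - ln (INR n))
    + ln (INR (S n)) - Clog (z + INR (S n)))%C.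
Proof.
  intros Hn. unfold ln_gauss. change (fact (S n)) with (S n * fact n)%nat.
  rewrite mult_INR, ln_mult, RtoC_plus.
  - rewrite (csum_S _ (S n)). ring.
  - apply lt_0_INR; lia.
  - apply lt_0_INR, lt_O_fact.
Qed.

Lemma Crising_Cexp (z : C) (n : nat) : slit_plane z ->
  Crising z n = Cexp (csum (fun i => Clog (z + INR i)) (S n)).
Proof.
  intros Hz. induction n.
  - simpl. rewrite Cplus_0_l, Cplus_0_r, Cexp_Clog; auto.
  - change (Crising z (S n)) with (Crising z n * (z + INR (S n)))%C.
    change (csum (fun i => Clog (z + INR i)) (S (S n))) with
      (csum (fun i => Clog (z + INR i)) (S n) + Clog (z + INR (S n)))%C.
    rewrite IHn, Cexp_plus, (Cexp_Clog (z + INR (S n))); auto.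
    apply slit_plane_plus; auto using pos_INR.
Qed.

(** A sum of principal logarithms need not be the principal logarithm of the product. Only its
    exponential is ever used, so the branch is immaterial. *)
Lemma gauss_Cexp (z : C) (n : nat) : slit_plane z -> (0 < n)%nat ->
  (Cpower (INR n) z * INR (fact n) / Crising z n)%C = Cexp (ln_gauss z n).
Proof.
  intros Hz Hn. unfold ln_gauss, Cminus.
  rewrite !Cexp_plus, Cexp_opp, <- Crising_Cexp, Cexp_RtoC by auto.
  rewrite exp_ln by apply lt_0_INR, lt_O_fact.
  unfold Cpower. rewrite Clog_RtoC by (apply lt_0_INR; auto). reflexivity.
Qed.

Lemma Clog_shift_bound2 (c : R) (z : C) (a : R) : slit_plane z -> cone_bound c z -> 0 < a ->
  Cmod (Clog (z + a) - ln a - z / a) <= Cmod z * Cmod z / (c * (a * a)).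
Proof.
  intros Hz Hc Ha. assert (Hc0 := proj1 Hc).
  assert (HaC : RtoC a <> 0%C) by (apply RtoC_neq_0; lra).
  set (f := fun t : R => (Clog (a + t * z) - t * (z / a))%C).
  set (df := fun t : R => (z / (a + t * z) - z / a)%C).
  rewrite <- Clog_RtoC by auto.
  replace (Clog (z + a) - Clog a - z / a)%C with (f 1 - f 0)%C.
  2:{ unfold f. replace (a + 1 * z)%C with (z + a)%C by ring.
      replace (a + 0 * z)%C with (RtoC a) by ring. ring. }
  eapply Rle_trans; [apply (Cmod_mean_value f df 0 1 (Cmod z * Cmod z / (c * (a * a))))|].
  - intros t. rewrite Rmin_left, Rmax_right by lra. intros Ht. unfold f, df.
    apply Cderiv_minus.
    + apply (Cderiv_Clog (fun t : R => a + t * z)%C).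
      * apply slit_plane_affine; auto; lra.
      * eapply Cderiv_eq.
        -- apply Cderiv_plus; [apply Cderiv_const|].
           apply Cderiv_mult; [apply Cderiv_id | apply Cderiv_const].
        -- cbv beta; ring.
    + eapply Cderiv_eq. apply Cderiv_mult; [apply Cderiv_id | apply Cderiv_const]. cbv beta; ring.
  - intros t. rewrite Rmin_left, Rmax_right by lra. intros Ht. unfold df.
    assert (Hs : (a + t * z)%C <> 0%C) by (apply slit_plane_neq_0, slit_plane_affine; auto; lra).
    replace (z / (a + t * z) - z / a)%C with (- (t * (z * z)) / ((a + t * z) * a))%C
      by (field; auto).
    rewrite Cmod_div, Cmod_opp, !Cmod_mult, !Cmod_RtoC_pos by (try apply Cmult_neq_0; auto; lra).
    assert (H1 : c * a <= Cmod (a + t * z)).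
    { rewrite Cplus_comm. eapply Rle_trans; [|apply (proj2 Hc); lra].
      generalize (Cmod_ge_0 z). intros. apply Rmult_le_compat_l; nra. }
    generalize (Cmod_ge_0 z). intros Hm.
    assert (0 < c * a) by nra.
    apply Rmult_le_compat; try nra.
    + apply Rlt_le, Rinv_0_lt_compat. nra.
    + apply Rinv_le_contravar; nra.
  - rewrite Rminus_0_r, Rabs_R1. lra.
Qed.

Lemma cone_bound_1 : cone_bound 1 1.
Proof.
  split; [lra|]. intros s t Hs Ht. rewrite Cmod_1, Cmult_1_r, <- RtoC_plus, Cmod_RtoC_pos; lra.
Qed.

(** With [a = n + 2] and [b = n + 1], the increment is [z (ln a - ln b - 1/a) - (log (z + a) - ln a
    - z/a)]. [Clog_step] at [y = 1] bounds the first part and [Clog_shift_bound2] the second, each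
    by a multiple of [1/b - 1/a]; [K] adds the two factors. *)
Lemma ln_gauss_lim (z : C) : slit_plane z -> exists l, Clim (fun n => ln_gauss z (S n)) l.
Proof.
  intros Hz. destruct (slit_plane_cone z Hz) as [c Hc].
  change (cone_bound c z) in Hc.
  generalize (Cmod_ge_0 z). intros Hm. assert (Hc0 := proj1 Hc).
  set (K := Cmod z + Cmod z * Cmod z / c).
  assert (HK : 0 <= K).
  { unfold K, Rdiv. assert (0 < / c) by (apply Rinv_0_lt_compat; lra).
    assert (0 <= Cmod z * Cmod z * / c) by (apply Rmult_le_pos; nra). lra. }
  destruct (Clim_telescoping (fun n => ln_gauss z (S n)) (fun n => K * / INR (S n)))
    as [l [Hl _]]; [| |exists l; auto].
  - intros n. apply Rmult_le_pos; auto. apply Rlt_le, Rinv_0_lt_compat, lt_0_INR. lia.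
  - intros n. rewrite (ln_gauss_S z (S n)) by lia.
    assert (Hn := pos_INR n).
    assert (E1 : INR (S n) = 1 + INR n) by (rewrite S_INR; ring).
    assert (E2 : INR (S (S n)) = 1 + INR (S n)) by (rewrite (S_INR (S n)); ring).
    assert (H1 := Clog_step 1 1 n (slit_plane_RtoC 1 Rlt_0_1) cone_bound_1).
    rewrite <- !RtoC_plus, <- E1, <- E2, !Clog_RtoC, Cmod_1, <- E1, <- E2, !Rmult_1_l, Rinv_1,
      Rmult_1_l in H1 by (apply lt_0_INR; lia).
    assert (Ha : 0 < INR (S (S n))) by (apply lt_0_INR; lia).
    assert (H2 := Clog_shift_bound2 c z (INR (S (S n))) Hz Hc Ha).
    set (a := INR (S (S n))) in *. set (b := INR (S n)) in *.
    assert (HaC : RtoC a <> 0%C) by (apply RtoC_neq_0; lra).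
    replace (ln_gauss z (S n) + z * (ln a - ln b) + ln a - Clog (z + a) - ln_gauss z (S n))%C
      with (z * (ln a - ln b - / a) + - (Clog (z + a) - ln a - z / a))%C
      by (unfold Cdiv; ring).
    eapply Rle_trans; [apply Cmod_triangle|]. rewrite Cmod_opp, Cmod_mult.
    assert (H3 : / (a * a) <= / b - / a).
    { replace (/ b - / a) with (/ (b * a)) by (rewrite E2; field; lra).
      apply Rinv_le_contravar; nra. }
    assert (H4 : Cmod z * Cmod z / (c * (a * a)) <= Cmod z * Cmod z / c * (/ b - / a)).
    { replace (Cmod z * Cmod z / (c * (a * a))) with (Cmod z * Cmod z / c * / (a * a))
        by (field; lra).
      apply Rmult_le_compat_l; auto. apply Rmult_le_pos; [nra|].
      apply Rlt_le, Rinv_0_lt_compat; lra. }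
    apply (Rmult_le_compat_l (Cmod z)) in H1; auto.
    unfold K. lra.
Qed.

Lemma Clim_Cexp (u : nat -> C) (l : C) : Clim u l -> Clim (fun n => Cexp (u n)) (Cexp l).
Proof.
  intros H. assert (H1 := Clim_Re _ _ H). assert (H2 := Clim_Im _ _ H).
  apply (is_lim_seq_continuous exp) in H1 as He; [|apply derivable_continuous_pt, derivable_pt_exp].
  apply (is_lim_seq_continuous cos) in H2 as Hcc; [|apply continuity_cos].
  apply (is_lim_seq_continuous sin) in H2 as Hs; [|apply continuity_sin].
  apply Clim_Re_Im; unfold Cexp; simpl; apply is_lim_seq_mult'; auto.
Qed.

Definition lnGamma (z : C) : C := CLim_seq (fun n => ln_gauss z (S n)).

Lemma lnGamma_lim (z : C) : slit_plane z -> Clim (fun n => ln_gauss z (S n)) (lnGamma z).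
Proof.
  intros Hz. destruct (ln_gauss_lim z Hz) as [l Hl].
  unfold lnGamma. rewrite (CLim_seq_unique _ _ Hl); auto.
Qed.

Lemma CGamma_Cexp (z : C) : slit_plane z -> CGamma z = Cexp (lnGamma z).
Proof.
  intros Hz. apply CLim_seq_unique, Clim_incr_1.
  apply Clim_ext with (fun n => Cexp (ln_gauss z (S n))).
  - intros n. rewrite gauss_Cexp; auto. lia.
  - apply Clim_Cexp, lnGamma_lim; auto.
Qed.

Lemma rsum_inv_sqr_bound (r : R) (n : nat) : 0 < r ->
  rsum (fun i => / ((r + INR i) * (r + INR i))) n <= / (r * r) + / r.
Proof.
  intros Hr. destruct n as [|n].
  - simpl. assert (0 < / r) by (apply Rinv_0_lt_compat; lra).
    assert (0 < / (r * r)) by (apply Rinv_0_lt_compat; nra). lra.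
  - apply Rle_trans with (/ (r * r) + / r - / (r + INR n)).
    + induction n; cbn [rsum].
      * simpl INR. rewrite Rplus_0_r. lra.
      * apply Rle_trans with (/ (r * r) + / r - / (r + INR n) + (/ (r + INR n) - / (r + INR (S n)))).
        -- apply Rplus_le_compat; [exact IHn|].
           rewrite inv_shift_diff by auto. generalize (pos_INR n). rewrite S_INR. intros.
           apply Rinv_le_contravar; nra.
        -- lra.
    + assert (0 < / (r + INR n)) by (apply Rinv_0_lt_compat; generalize (pos_INR n); lra). lra.
Qed.

(** Differentiation needs increments of both signs. From the base point [z - d], every [z + h] with
    [|h| <= d] is reached by adding a non-negative real, to which [slit_plane_plus] and the cone
    bounds apply. *)
Lemma slit_plane_shift_left (z : C) : slit_plane z ->
  exists d, 0 < d /\ slit_plane (z - d)%C.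
Proof.
  intros Hz. destruct (Rle_lt_dec (Re z) 0) as [Hr | Hr].
  - exists 1. split; [lra|]. intros [H1 H2]. apply Hz. rewrite im_minus in H1. simpl in H1.
    split; lra.
  - exists (Re z / 2). split; [lra|]. intros [H1 H2]. rewrite re_minus in H2. simpl in H2. lra.
Qed.

(** A bound of this form, uniform in [n] for a convergent sequence of functions, passes to the
    limit. It thus replaces a theorem on differentiating limits, for [lnGamma] as well as for
    [Czeta]. *)
Lemma Cderiv_quadratic (f : R -> C) (t : R) (l : C) (d K : R) : 0 < d ->
  (forall h, Rabs h <= d -> Cmod (f (t + h) - f t - h * l) <= K * (h * h)) -> Cderiv f t l.
Proof.
  intros Hd H.
  assert (HK : 0 <= K).
  { generalize (H d) (Cmod_ge_0 (f (t + d) - f t - d * l)). rewrite Rabs_pos_eq by lra.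
    intros H1 H2. specialize (H1 (Rle_refl _)). apply Rnot_lt_le. intros Hn.
    assert (K * (d * d) < 0) by (apply Rmult_neg_pos; nra). lra. }
  assert (Haux : forall (g : R -> R) (m : R),
    (forall h, Rabs h <= d -> Rabs (g (t + h) - g t - h * m) <= K * (h * h)) -> is_derive g t m).
  { intros g m Hg. apply is_derive_Reals. intros eps Heps.
    assert (Hp : 0 < Rmin d (eps / (K + 1))).
    { apply Rmin_pos; auto. apply Rdiv_lt_0_compat; lra. }
    exists (mkposreal _ Hp). simpl. intros h Hh Hlt.
    assert (H1 : Rabs h < d) by (eapply Rlt_le_trans; [exact Hlt | apply Rmin_l]).
    assert (H2 : Rabs h < eps / (K + 1)) by (eapply Rlt_le_trans; [exact Hlt | apply Rmin_r]).
    replace ((g (t + h) - g t) / h - m) with ((g (t + h) - g t - h * m) / h) by (field; auto).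
    unfold Rdiv. rewrite Rabs_mult, Rabs_inv.
    assert (Hha : 0 < Rabs h) by (apply Rabs_pos_lt; auto).
    apply Rmult_lt_reg_r with (Rabs h); auto. rewrite Rmult_assoc, Rinv_l, Rmult_1_r by lra.
    eapply Rle_lt_trans; [apply Hg; lra|].
    replace (h * h) with (Rabs h * Rabs h) by (generalize (Rsqr_abs h); unfold Rsqr; lra).
    assert (H3 : Rabs h * (K + 1) < eps).
    { apply Rmult_lt_reg_r with (/ (K + 1)); [apply Rinv_0_lt_compat; lra|].
      rewrite Rmult_assoc, Rinv_r by lra. unfold Rdiv in H2. lra. }
    nra. }
  split; apply Haux; intros h Hh.
  - eapply Rle_trans; [|apply (H h Hh)]. eapply Rle_trans; [|apply re_le_Cmod].
    rewrite !re_minus, re_scal_l. lra.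
  - eapply Rle_trans; [|apply (H h Hh)]. eapply Rle_trans; [|apply Rabs_Im_le_Cmod].
    rewrite !im_minus, im_scal_l. lra.
Qed.

Lemma Clog_second_order (c0 d : R) (z : C) (a h : R) :
  slit_plane (z - d)%C -> cone_bound c0 (z - d)%C -> 0 < d -> 0 <= a -> Rabs h <= d ->
  Cmod (Clog (z + a + h) - Clog (z + a) - h / (z + a)) <=
  / (c0 * c0) * / ((Cmod (z - d) + a) * (Cmod (z - d) + a)) * (h * h).
Proof.
  intros Hz Hc Hd Ha Hh. assert (Hc0 := proj1 Hc).
  generalize (slit_plane_Cmod_pos _ Hz). set (z0 := (z - d)%C) in *. intros Hr.
  assert (Hb : forall t, Rabs t <= d -> (z + a + t)%C = (z0 + (a + d + t)%R)%C /\ 0 <= a + d + t).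
  { intros t Ht. split.
    - unfold z0. rewrite !RtoC_plus. ring.
    - generalize (Rabs_le_between t d). intros [H _]. specialize (H Ht). lra. }
  assert (Hsl : forall t, Rabs t <= d -> slit_plane (z + a + t)%C).
  { intros t Ht. destruct (Hb t Ht) as [-> H]. apply slit_plane_plus; auto. }
  assert (Hlow : forall t, Rabs t <= d -> c0 * (Cmod z0 + a) <= Cmod (z + a + t)).
  { intros t Ht. destruct (Hb t Ht) as [-> H].
    eapply Rle_trans; [|apply (cone_bound_shift c0); auto].
    generalize (Rabs_le_between t d). intros [H' _]. specialize (H' Ht).
    apply Rmult_le_compat_l; lra. }
  assert (Hza : slit_plane (z + a)%C).
  { replace (z + a)%C with (z + a + 0)%C by ring. apply Hsl. rewrite Rabs_R0; lra. }
  assert (Hlow0 : c0 * (Cmod z0 + a) <= Cmod (z + a)).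
  { replace (z + a)%C with (z + a + 0)%C by ring. apply Hlow. rewrite Rabs_R0; lra. }
  assert (Hn0 := slit_plane_neq_0 _ Hza).
  set (f := fun t : R => (Clog (z + a + t) - t * / (z + a))%C).
  set (df := fun t : R => (/ (z + a + t) - / (z + a))%C).
  replace (Clog (z + a + h) - Clog (z + a) - h / (z + a))%C with (f h - f 0)%C.
  2:{ unfold f. rewrite Cplus_0_r. unfold Cdiv. ring. }
  assert (Hin : forall t, Rmin 0 h <= t <= Rmax 0 h -> Rabs t <= Rabs h).
  { intros t. unfold Rmin, Rmax. destruct (Rle_dec 0 h); intros Ht.
    - rewrite !Rabs_pos_eq; lra.
    - rewrite !Rabs_left1; lra. }
  set (K := / (c0 * c0) * / ((Cmod z0 + a) * (Cmod z0 + a))).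
  eapply Rle_trans; [apply (Cmod_mean_value f df 0 h (K * Rabs h))|].
  - intros t Ht. specialize (Hin t Ht). unfold f, df. apply Cderiv_minus.
    + apply Cderiv_Clog_line. apply Hsl. lra.
    + eapply Cderiv_eq. apply Cderiv_mult; [apply Cderiv_id | apply Cderiv_const]. cbv beta; ring.
  - intros t Ht. specialize (Hin t Ht). unfold df.
    assert (Hn1 : (z + a + t)%C <> 0%C) by (apply slit_plane_neq_0, Hsl; lra).
    replace (/ (z + a + t) - / (z + a))%C with (- t / ((z + a + t) * (z + a)))%C by (field; auto).
    rewrite Cmod_div, Cmod_opp, Cmod_mult, Cmod_R by (apply Cmult_neq_0; auto).
    unfold Rdiv. rewrite Rmult_comm. apply Rmult_le_compat; auto using Rabs_pos.
    + apply Rlt_le, Rinv_0_lt_compat, Rmult_lt_0_compat; apply Cmod_gt_0; auto.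
    + unfold K. rewrite <- Rinv_mult. assert (0 < c0 * (Cmod z0 + a)) by nra.
      replace (c0 * c0 * ((Cmod z0 + a) * (Cmod z0 + a)))
        with ((c0 * (Cmod z0 + a)) * (c0 * (Cmod z0 + a))) by ring.
      apply Rinv_le_contravar; [nra|]. apply Rmult_le_compat; try lra.
      apply Hlow; lra.
  - rewrite Rminus_0_r. right. rewrite Rmult_assoc. f_equal.
    generalize (Rsqr_abs h). unfold Rsqr. lra.
Qed.

(** For each finite [n] the remainder is minus a sum of second-order remainders of [Clog (z + i)],
    at most a multiple of the sum of [1 / (r + i)^2]. This is bounded uniformly in [n]. *)
Lemma lnGamma_second_order (z : C) : slit_plane z ->
  exists d K, 0 < d /\ slit_plane (z - d)%C /\ forall h, Rabs h <= d ->
    Cmod (lnGamma (z + h) - lnGamma z - h * (digamma1 z - / z)) <= K * (h * h).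
Proof.
  intros Hz. destruct (slit_plane_shift_left z Hz) as [d [Hd Hz0]].
  destruct (slit_plane_cone _ Hz0) as [c Hc]. change (cone_bound c (z - d)%C) in Hc.
  generalize (slit_plane_Cmod_pos _ Hz0). intros Hr. set (r := Cmod (z - d)) in *.
  exists d, (/ (c * c) * (/ (r * r) + / r)). split; [|split]; auto.
  intros h Hh.
  assert (Hzh : slit_plane (z + h)%C).
  { replace (z + h)%C with (z - d + (d + h)%R)%C by (rewrite RtoC_plus; ring).
    apply slit_plane_plus; auto. generalize (Rabs_le_between h d). intros [H _]. specialize (H Hh). lra. }
  replace (lnGamma (z + h) - lnGamma z - h * (digamma1 z - / z))%C
    with (lnGamma (z + h) - lnGamma z - h * (digamma1 z - / z) - 0)%C by ring.
  apply Clim_Cmod_le with (fun n => ln_gauss (z + h) (S n) - ln_gauss z (S n)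
    - h * (ln (INR (S n)) - harm z (S n) - / z))%C.
  - apply Clim_minus.
    + apply Clim_minus; apply lnGamma_lim; auto.
    + apply Clim_scal, Clim_minus; [|apply Clim_const]. apply digamma1_lim_ln; auto.
  - intros n. generalize (S n); clear n; intros n.
    assert (E : (ln_gauss (z + h) n - ln_gauss z n - h * (ln (INR n) - harm z n - / z) - 0)%C =
      (- csum (fun i => Clog (z + INR i + h) - Clog (z + INR i) - h / (z + INR i)) (S n))%C).
    (* [harm] starts at [1 / (z + 1)], while the product for Gamma also contains the factor [z]; the
       missing term [1/z] is the passage from [psi (z + 1)] to [psi z]. *)
    { assert (E1 : (harm z n + / z)%C = csum (fun i => / (z + INR i))%C (S n)).
      { unfold harm. clear. induction n.
        - simpl. rewrite Cplus_0_r. ring.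
        - change (csum (fun i => / (z + INR i))%C (S (S n)))
            with (csum (fun i => / (z + INR i))%C (S n) + / (z + INR (S n)))%C.
          rewrite <- IHn, csum_S. ring. }
      unfold ln_gauss. rewrite !csum_minus.
      rewrite (csum_ext (fun i => h / (z + INR i))%C (fun i => h * / (z + INR i))%C) by reflexivity.
      rewrite csum_scal, <- E1.
      rewrite (csum_ext (fun i => Clog (z + INR i + h)) (fun i => Clog (z + h + INR i))).
      - ring.
      - intros; f_equal; ring. }
    rewrite E, Cmod_opp.
    eapply Rle_trans.
    + apply Cmod_csum_le with (g := fun i => (/ (c * c) * (h * h)) * / ((r + INR i) * (r + INR i))).
      intros i _. eapply Rle_trans; [apply (Clog_second_order c d); auto using pos_INR|].
      fold r. right. ring.
    + rewrite rsum_scal.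
      apply Rle_trans with (/ (c * c) * (h * h) * (/ (r * r) + / r)).
      * apply Rmult_le_compat_l; [|apply rsum_inv_sqr_bound; auto].
        destruct Hc as [Hc _]. assert (0 < / (c * c)) by (apply Rinv_0_lt_compat; nra). nra.
      * right. ring.
Qed.

Lemma is_lim_difference_quotient (f : R -> R) (t l : R) :
  is_derive f t l -> is_lim (fun s => (f s - f t) / (s - t)) t l.
Proof.
  intros H. apply is_derive_Reals in H. apply is_lim_spec. intros eps.
  destruct (H eps (cond_pos eps)) as [d Hd].
  exists d. intros s Hs Hne.
  replace s with (t + (s - t)) at 1 by ring. apply Hd.
  - lra.
  - exact Hs.
Qed.

(* [C_derive] only sees the horizontal line through [z]. *)
Lemma C_derive_horizontal (f : C -> C) (z l : C) :
  Cderiv (fun s => f (s, Im z)) (Re z) l -> C_derive f z = l.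
Proof.
  intros [H1 H2]. assert (Ez : z = (Re z, Im z)) by (destruct z; reflexivity).
  assert (E : forall s, s <> Re z -> ((f (s, Im z) - f z) / ((s, Im z) - z))%C =
    ((/ (s - Re z))%R * (f (s, Im z) - f z))%C).
  { intros s Hs.
    replace ((s, Im z) - z)%C with (RtoC (s - Re z)).
    - unfold Cdiv. rewrite RtoC_inv by lra. apply Cmult_comm.
    - apply Ceq; rewrite ?re_minus, ?im_minus; simpl; ring. }
  apply Ceq.
  - change (real (Lim (fun s => Re ((f (s, Im z) - f z) / ((s, Im z) - z))%C) (Re z)) = Re l).
    apply (f_equal real (y := Finite (Re l))), is_lim_unique.
    apply is_lim_ext_loc with (2 := is_lim_difference_quotient _ _ _ H1).
    exists posreal_one. intros s _ Hs. rewrite E by exact Hs.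
    rewrite re_scal_l, re_minus, <- Ez. unfold Rdiv. apply Rmult_comm.
  - change (real (Lim (fun s => Im ((f (s, Im z) - f z) / ((s, Im z) - z))%C) (Re z)) = Im l).
    apply (f_equal real (y := Finite (Im l))), is_lim_unique.
    apply is_lim_ext_loc with (2 := is_lim_difference_quotient _ _ _ H2).
    exists posreal_one. intros s _ Hs. rewrite E by exact Hs.
    rewrite im_scal_l, im_minus, <- Ez. unfold Rdiv. apply Rmult_comm.
Qed.

Lemma Cderiv_ext_loc (f g : R -> C) (t : R) (a : C) :
  locally t (fun s => f s = g s) -> Cderiv f t a -> Cderiv g t a.
Proof.
  intros E [H1 H2]; split.
  - apply is_derive_ext_loc with (2 := H1). revert E; apply filter_imp. intros s ->; auto.
  - apply is_derive_ext_loc with (2 := H2). revert E; apply filter_imp. intros s ->; auto.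
Qed.

(** On the horizontal line near [z], Gamma is the exponential of [lnGamma]. Hence it does not vanish
    there, and its logarithmic derivative is the derivative of [lnGamma]. *)
Lemma Cdigamma_eq (z : C) : slit_plane z -> Cdigamma z = (digamma1 z - / z)%C.
Proof.
  intros Hz. destruct (lnGamma_second_order z Hz) as [d [K [Hd [Hz0 H]]]].
  assert (Hpt : forall h : R, (Re z + h, Im z) = (z + h)%C).
  { intros h. apply Ceq; rewrite ?re_plus, ?im_plus, ?re_minus, ?im_minus; simpl; ring. }
  assert (Ez : (Re z, Im z) = z) by (destruct z; reflexivity).
  assert (HG : Cderiv (fun s => lnGamma (s, Im z)) (Re z) (digamma1 z - / z)%C).
  { apply Cderiv_quadratic with d K; auto. intros h Hh.
    rewrite Hpt, Ez. apply H; auto. }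
  assert (Hline : forall s : R, Rabs (s - Re z) < d -> slit_plane (s, Im z)).
  { intros s Hs. replace (s, Im z) with (z - d + (d + (s - Re z))%R)%C.
    - apply slit_plane_plus; auto. apply Rabs_def2 in Hs. lra.
    - apply Ceq; rewrite ?re_plus, ?im_plus, ?re_minus, ?im_minus; simpl; ring. }
  unfold Cdigamma. rewrite (C_derive_horizontal CGamma z ((digamma1 z - / z) * CGamma z)%C).
  - field. split.
    + apply slit_plane_neq_0; auto.
    + rewrite CGamma_Cexp by auto. apply Cexp_neq_0.
  - rewrite (CGamma_Cexp z Hz).
    apply Cderiv_ext_loc with (fun s => Cexp (lnGamma (s, Im z))).
    + exists (mkposreal d Hd). intros s Hs. symmetry. apply CGamma_Cexp.
      apply Hline. exact Hs.
    + eapply Cderiv_eq; [apply Cderiv_Cexp, HG|]. simpl. rewrite Ez. reflexivity.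
Qed.

(** * The zeta function and Herglotz series *)

Lemma ex_series_telescoping (a d : nat -> R) :
  (forall n, 0 <= d n) -> (forall n, 0 <= a n <= d n - d (S n)) -> ex_series a.
Proof.
  intros Hd H.
  apply (@ex_series_le R_AbsRing R_CompleteNormedModule _ (fun n => d n - d (S n))).
  - intros n. destruct (H n). change (Rabs (a n) <= d n - d (S n)). rewrite Rabs_pos_eq; auto.
  - assert (Hlim : ex_finite_lim_seq d).
    { apply ex_finite_lim_seq_decr with 0; auto. intros n. generalize (H n). lra. }
    destruct Hlim as [l Hl]. exists (d 0%nat - l). apply is_series_rsum.
    apply is_lim_seq_ext with (fun n => d 0%nat - d n).
    + intros n. induction n; simpl; [ring | rewrite <- IHn; ring].
    + apply is_lim_seq_minus'; auto. apply is_lim_seq_const.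
Qed.

Lemma Rpower_pos (a b : R) : 0 < Rpower a b.
Proof. apply exp_pos. Qed.

Lemma INR_S_pos (n : nat) : 0 < INR (S n).
Proof. apply lt_0_INR. lia. Qed.

Lemma INR_S_ge_1 (n : nat) : 1 <= INR (S n).
Proof. rewrite S_INR. generalize (pos_INR n). lra. Qed.

Lemma ln_INR_S_nonneg (n : nat) : 0 <= ln (INR (S n)).
Proof.
  rewrite <- ln_1. destruct (INR_S_ge_1 n) as [H | <-]; [|lra].
  apply Rlt_le, ln_increasing; lra.
Qed.

Lemma ln_le_pred (u : R) : 0 < u -> ln u <= u - 1.
Proof.
  intros H. generalize (exp_ineq1_le (ln u)). rewrite exp_ln by auto. lra.
Qed.

Lemma ln_INR_S_diff (n : nat) :
  / INR (S (S n)) <= ln (INR (S (S n))) - ln (INR (S n)) <= / INR (S n).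
Proof.
  assert (Ha := INR_S_pos n). assert (Hb := INR_S_pos (S n)). assert (E := S_INR (S n)).
  set (a := INR (S n)) in *. set (b := INR (S (S n))) in *.
  rewrite <- ln_div by auto. split.
  - assert (H : 0 < a / b) by (apply Rdiv_lt_0_compat; auto).
    generalize (ln_le_pred (a / b) H).
    rewrite !ln_div by auto. replace (a / b) with (1 - / b) by (rewrite E; field; lra). lra.
  - assert (H : 0 < b / a) by (apply Rdiv_lt_0_compat; auto).
    generalize (ln_le_pred (b / a) H). replace (b / a - 1) with (/ a) by (rewrite E; field; lra). lra.
Qed.

(** A discrete integral test: for [a = b - 1 >= 1], the inequality [1 + u <= exp u] gives
    [b^(-s) <= (a^(1-s) - b^(1-s)) / (s - 1)]. The first term of the series is split off since it
    has no such [a]. *)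
Lemma ex_series_Rpower (s : R) : 1 < s -> ex_series (fun n => Rpower (INR (S n)) (- s)).
Proof.
  intros Hs. apply ex_series_incr_1.
  apply ex_series_telescoping with (fun n => / (s - 1) * Rpower (INR (S n)) (1 - s)).
  - intros n. apply Rmult_le_pos; [|apply Rlt_le, Rpower_pos].
    apply Rlt_le, Rinv_0_lt_compat; lra.
  - intros n. split; [apply Rlt_le, Rpower_pos|].
    rewrite <- Rmult_minus_distr_l.
    generalize (INR_S_pos n) (INR_S_pos (S n)) (proj1 (ln_INR_S_diff n)).
    set (a := INR (S n)). set (b := INR (S (S n))). intros Ha Hb H3.
    assert (Hp := Rpower_pos b (1 - s)).
    assert (H1 : Rpower b (- s) = Rpower b (1 - s) * / b).
    { replace (- s) with (1 - s + - (1)) by ring.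
      rewrite Rpower_plus, (Rpower_Ropp b 1), Rpower_1; auto. }
    assert (H2 : Rpower a (1 - s) = Rpower b (1 - s) * exp ((s - 1) * (ln b - ln a))).
    { unfold Rpower. rewrite <- exp_plus. f_equal. ring. }
    generalize (exp_ineq1_le ((s - 1) * (ln b - ln a))). intros H4.
    rewrite H1, H2.
    apply Rmult_le_reg_l with (s - 1); [lra|].
    rewrite <- (Rmult_assoc (s - 1) (/ (s - 1))), Rinv_r, Rmult_1_l by lra.
    assert (H5 : (s - 1) * / b <= exp ((s - 1) * (ln b - ln a)) - 1).
    { apply Rle_trans with ((s - 1) * (ln b - ln a)); [|lra]. apply Rmult_le_compat_l; lra. }
    apply (Rmult_le_compat_l (Rpower b (1 - s))) in H5; lra.
Qed.

Lemma Cpower_RtoC (a s : R) : 0 < a -> Cpower a (RtoC s) = Rpower a s.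
Proof.
  intros Ha. unfold Cpower, Rpower. rewrite Clog_RtoC, <- RtoC_mult by auto. apply Cexp_RtoC.
Qed.

Lemma Czeta_lim (s : R) : 1 < s ->
  Clim (csum (fun n => RtoC (Rpower (INR (S n)) (- s)))) (Czeta s).
Proof.
  intros Hs. destruct (ex_series_Rpower s Hs) as [l Hl].
  assert (H : Clim (csum (fun n => RtoC (Rpower (INR (S n)) (- s)))) l).
  { apply Clim_ext with (fun n => RtoC (rsum (fun n => Rpower (INR (S n)) (- s)) n)).
    - intros n. symmetry. apply csum_RtoC.
    - apply Clim_RtoC, is_series_rsum, Hl. }
  replace (Czeta s) with (RtoC l); auto. symmetry.
  apply CSeries_unique. apply Clim_ext with (2 := H). intros n. apply csum_ext. intros i _.
  rewrite <- RtoC_opp, Cpower_RtoC; auto. apply INR_S_pos.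
Qed.

Lemma exp_second_order (u : R) : Rabs (exp u - 1 - u) <= u * u * exp (Rabs u).
Proof.
  assert (H0 := exp_ineq1_le u). rewrite Rabs_pos_eq by lra.
  assert (H1 := exp_ineq1_le (- u)). assert (Hp := exp_pos u).
  assert (H2 : exp u * exp (- u) = 1) by (rewrite <- exp_plus, Rplus_opp_r; apply exp_0).
  assert (H3 : exp u - 1 <= u * exp u) by nra.
  destruct (Rle_dec 0 u) as [Hu | Hu].
  - rewrite Rabs_pos_eq by auto. nra.
  - rewrite Rabs_left by lra.
    assert (1 <= exp (- u)) by lra.
    apply Rle_trans with (u * u); [|nra].
    nra.
Qed.

Lemma ln_INR_S_le (n : nat) : ln (INR (S n)) <= 4 * Rpower (INR (S n)) (1 / 4).
Proof.
  generalize (ln_le_pred (Rpower (INR (S n)) (1 / 4)) (Rpower_pos _ _)).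
  unfold Rpower at 1. rewrite ln_exp. lra.
Qed.

Lemma rsum_le_Series (a : nat -> R) (n : nat) :
  (forall n, 0 <= a n) -> ex_series a -> rsum a n <= Series a.
Proof.
  intros Ha He. apply Series_correct in He. apply is_series_rsum in He.
  apply (is_lim_seq_incr_compare (rsum a)); auto. intros m. simpl. generalize (Ha m). lra.
Qed.

(** In the second-order term of [exp (- h ln n)], two logarithms cost [n^(1/2)] and the factor
    [exp (|h| ln n)] costs [n^(1/4)]. The exponent [s - 3/4] still exceeds 1 when [s >= 2], which
    covers every integer [k > 1]. *)
Lemma Rpower_second_order (n : nat) (s h : R) : Rabs h <= 1 / 4 ->
  Rabs (Rpower (INR (S n)) (- (s + h)) - Rpower (INR (S n)) (- s)
    + h * (ln (INR (S n)) * Rpower (INR (S n)) (- s)))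
  <= h * h * (16 * Rpower (INR (S n)) (- (s - 3 / 4))).
Proof.
  intros Hh. assert (HL := ln_INR_S_nonneg n). assert (HL4 := ln_INR_S_le n).
  set (a := INR (S n)) in *. set (L := ln a) in *.
  replace (Rpower a (- (s + h))) with (Rpower a (- s) * exp (- h * L)).
  2:{ unfold Rpower. fold L. rewrite <- exp_plus. f_equal. ring. }
  replace (Rpower a (- s) * exp (- h * L) - Rpower a (- s) + h * (L * Rpower a (- s)))
    with (Rpower a (- s) * (exp (- h * L) - 1 - - h * L)) by ring.
  rewrite Rabs_mult, (Rabs_pos_eq (Rpower a (- s))) by apply Rlt_le, Rpower_pos.
  assert (H1 := exp_second_order (- h * L)).
  assert (H2 : exp (Rabs (- h * L)) <= Rpower a (1 / 4)).
  { unfold Rpower. fold L. rewrite Rabs_mult, Rabs_Ropp, (Rabs_pos_eq L) by auto.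
    assert (H : Rabs h * L <= 1 / 4 * L) by (apply Rmult_le_compat_r; auto).
    destruct H as [H | ->]; [apply Rlt_le, exp_increasing; auto | lra]. }
  assert (H3 : L * L <= 16 * Rpower a (1 / 2)).
  { replace (1 / 2) with (1 / 4 + 1 / 4) by lra. rewrite Rpower_plus.
    assert (Hq := Rpower_pos a (1 / 4)). nra. }
  assert (H4 : - h * L * (- h * L) * exp (Rabs (- h * L)) <=
    h * h * (16 * Rpower a (1 / 2)) * Rpower a (1 / 4)).
  { apply Rmult_le_compat; auto.
    - replace (- h * L * (- h * L)) with (h * h * (L * L)) by ring.
      apply Rmult_le_pos; apply Rle_0_sqr.
    - apply Rlt_le, exp_pos.
    - replace (- h * L * (- h * L)) with (h * h * (L * L)) by ring.
      apply Rmult_le_compat_l; [apply Rle_0_sqr | auto]. }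
  replace (Rpower a (- (s - 3 / 4))) with (Rpower a (- s) * Rpower a (1 / 2) * Rpower a (1 / 4)).
  2:{ rewrite <- !Rpower_plus. f_equal. lra. }
  apply Rle_trans with (Rpower a (- s) * (h * h * (16 * Rpower a (1 / 2)) * Rpower a (1 / 4))).
  - apply Rmult_le_compat_l; [apply Rlt_le, Rpower_pos | lra].
  - right. ring.
Qed.

Lemma Clim_ln_Rpower (s : R) : 2 <= s ->
  exists l, Clim (csum (fun n => RtoC (ln (INR (S n)) * Rpower (INR (S n)) (- s)))) l.
Proof.
  intros Hs. apply Clim_csum_dominated with (fun n => Rpower (INR (S n)) (- (s - 1 / 4)) * 4).
  - intros n. assert (HL := ln_INR_S_nonneg n). assert (HL4 := ln_INR_S_le n).
    assert (Hp := Rpower_pos (INR (S n)) (- s)).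
    rewrite Cmod_RtoC_pos by nra.
    replace (- (s - 1 / 4)) with (- s + 1 / 4) by ring. rewrite Rpower_plus. nra.
  - apply ex_series_scal_r, ex_series_Rpower. lra.
Qed.

Lemma C_derive_Czeta_lim (s : R) : 2 <= s ->
  Clim (csum (fun n => RtoC (ln (INR (S n)) * Rpower (INR (S n)) (- s)))) (- C_derive Czeta s)%C.
Proof.
  intros Hs. destruct (Clim_ln_Rpower s Hs) as [l Hl].
  replace (- C_derive Czeta s)%C with l; auto.
  rewrite (C_derive_horizontal Czeta s (- l)%C); [ring|].
  set (b := fun n => Rpower (INR (S n)) (- (s - 3 / 4))).
  apply Cderiv_quadratic with (1 / 4) (16 * Series b); [lra|].
  intros h Hh. cbn [Re Im RtoC fst snd].
  change (s + h, 0) with (RtoC (s + h)). change (s, 0) with (RtoC s).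
  assert (Hh' : - (1 / 4) <= h <= 1 / 4) by (apply Rabs_le_between; auto).
  replace (Czeta (s + h)%R - Czeta s - h * - l)%C with (Czeta (s + h)%R - Czeta s + h * l - 0)%C by ring.
  apply Clim_Cmod_le with (fun n =>
    csum (fun n => RtoC (Rpower (INR (S n)) (- (s + h)))) n
    - csum (fun n => RtoC (Rpower (INR (S n)) (- s))) n
    + h * csum (fun n => RtoC (ln (INR (S n)) * Rpower (INR (S n)) (- s))) n)%C.
  - apply Clim_plus; [|apply Clim_scal; auto].
    apply Clim_minus; apply Czeta_lim; lra.
  - intros n. rewrite <- csum_minus, <- csum_scal, <- csum_plus.
    assert (E0 : forall z : C, (z - 0)%C = z) by (intros; ring). rewrite E0.
    rewrite (csum_ext _ (fun i => RtoC (Rpower (INR (S i)) (- (s + h))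
      - Rpower (INR (S i)) (- s) + h * (ln (INR (S i)) * Rpower (INR (S i)) (- s))))).
    + eapply Rle_trans.
      * apply Cmod_csum_le with (g := fun i => h * h * 16 * b i).
        intros i _. rewrite Cmod_R. eapply Rle_trans; [apply Rpower_second_order; auto|].
        right. unfold b. ring.
      * rewrite rsum_scal. replace (16 * Series b * (h * h)) with (h * h * 16 * Series b) by ring.
        apply Rmult_le_compat_l; [nra|]. apply rsum_le_Series.
        -- intros i. apply Rlt_le, Rpower_pos.
        -- apply ex_series_Rpower. lra.
    + intros i _.
      rewrite RtoC_plus, RtoC_minus, !RtoC_mult. reflexivity.
Qed.

(** This is [psi (y + 1) - log y], the Herglotz summand after the shift by [1/y]. *)
Definition phi (y : C) : C := (digamma1 y - Clog y)%C.

Lemma phi_bound (c : R) (y : C) : slit_plane y -> cone_bound c y ->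
  Cmod (phi y) <= / (c * c) * / Cmod y.
Proof.
  intros Hy Hc. destruct (digamma1_lim_remainder c y Hy Hc) as [_ H].
  specialize (H 0%nat). simpl INR in H. rewrite Rplus_0_r, Cplus_0_r in H.
  unfold phi. eapply Rle_trans; [|exact H]. right. f_equal. unfold harm; simpl. ring.
Qed.

(** The shift contributes [n^(-k) / (n^a x)] to the summand of index [n], hence [zeta (k + a) / x]
    in total. Taken at [x] this is the source of the term in [zeta (k + N)], and at the points
    [upoint] the source of [Bterm]. *)
Lemma Herglotz_lim (k a : R) (x : C) : slit_plane x -> 1 < k + a ->
  Clim (csum (fun n => phi (Rpower (INR (S n)) a * x) / Rpower (INR (S n)) k)%C)
    (Herglotz k a x + Czeta (k + a)%R / x)%C.
Proof.
  intros Hx Hk. destruct (slit_plane_cone x Hx) as [c Hc]. change (cone_bound c x) in Hc.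
  assert (Hm := slit_plane_Cmod_pos x Hx). assert (Hc0 := proj1 Hc).
  set (t := fun n => (phi (Rpower (INR (S n)) a * x) / Rpower (INR (S n)) k)%C).
  destruct (Clim_csum_dominated t
    (fun n => Rpower (INR (S n)) (- (k + a)) * (/ (c * c) * / Cmod x))) as [l Hl].
  - intros n. unfold t.
    assert (Hp := Rpower_pos (INR (S n)) a). assert (Hq := Rpower_pos (INR (S n)) k).
    rewrite Cmod_div, (Cmod_RtoC_pos (Rpower _ k)) by (try apply RtoC_neq_0; lra).
    apply Rmult_le_reg_r with (Rpower (INR (S n)) k); auto.
    unfold Rdiv. rewrite Rmult_assoc, Rinv_l, Rmult_1_r by lra.
    eapply Rle_trans; [apply (phi_bound c)|].
    + apply slit_plane_scal; auto.
    + apply cone_bound_scal; auto.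
    + rewrite Cmod_mult, Cmod_RtoC_pos by lra.
      replace (Rpower (INR (S n)) (- (k + a)))
        with (/ Rpower (INR (S n)) k * / Rpower (INR (S n)) a)
        by (rewrite <- !Rpower_Ropp, <- Rpower_plus; f_equal; ring).
      right. field. repeat split; lra.
  - apply ex_series_scal_r, ex_series_Rpower. lra.
  - fold t. replace (Herglotz k a x + Czeta (k + a)%R / x)%C with l; auto.
    assert (E : Herglotz k a x = (l - Czeta (k + a)%R / x)%C); [|rewrite E; ring].
    apply CSeries_unique.
    apply Clim_ext with (fun n => csum t n - / x *
      csum (fun n => RtoC (Rpower (INR (S n)) (- (k + a)))) n)%C.
    + intros n. rewrite <- csum_scal, <- csum_minus. apply csum_ext. intros i _.
      assert (Hp := Rpower_pos (INR (S i)) a). assert (Hq := Rpower_pos (INR (S i)) k).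
      cbv zeta. rewrite Cdigamma_eq by (apply slit_plane_scal; auto).
      unfold t, phi.
      replace (Rpower (INR (S i)) (- (k + a)))
        with (/ (Rpower (INR (S i)) k * Rpower (INR (S i)) a))
        by (rewrite <- Rpower_plus, <- Rpower_Ropp; f_equal; ring).
      rewrite RtoC_inv, RtoC_mult by nra.
      field. repeat split; try apply RtoC_neq_0; try lra. apply slit_plane_neq_0; auto.
    + apply Clim_minus; auto. unfold Cdiv. rewrite Cmult_comm.
      apply Clim_scal, Czeta_lim; auto.
Qed.

(** * Roots of unity and partial fractions *)

Definition cis (a : R) : C := (cos a, sin a).

Lemma cis_Cexp (a : R) : cis a = Cexp (Ci * a).
Proof.
  unfold cis, Cexp. replace (Re (Ci * a)) with 0 by (simpl; ring).
  replace (Im (Ci * a)) with a by (simpl; ring). rewrite exp_0, !Rmult_1_l. reflexivity.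
Qed.

Lemma cis_plus (a b : R) : cis (a + b) = (cis a * cis b)%C.
Proof. rewrite !cis_Cexp, <- Cexp_plus, RtoC_plus. f_equal. ring. Qed.

Lemma cis_0 : cis 0 = 1.
Proof. unfold cis. rewrite cos_0, sin_0. reflexivity. Qed.

Lemma cis_neq_0 (a : R) : cis a <> 0%C.
Proof. rewrite cis_Cexp. apply Cexp_neq_0. Qed.

Lemma cis_opp (a : R) : cis (- a) = (/ cis a)%C.
Proof. rewrite !cis_Cexp, <- Cexp_opp, RtoC_opp. f_equal. ring. Qed.

Lemma cis_INR (n : nat) (a : R) : cis (INR n * a) = (cis a ^ n)%C.
Proof. rewrite !cis_Cexp, <- Cexp_INR_mult, RtoC_mult. f_equal. ring. Qed.

Lemma cis_PI_INR (n : nat) : cis (INR n * PI) = ((-1) ^ n)%C.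
Proof. rewrite cis_INR. f_equal. unfold cis. rewrite cos_PI, sin_PI. apply Ceq; simpl; ring. Qed.

Lemma Cpow_m1_sqr (n : nat) : ((-1) ^ n * (-1) ^ n)%C = 1.
Proof. rewrite <- Cpow_mult_l. replace (-1 * -1)%C with (RtoC 1) by ring. apply Cpow_1_l. Qed.

Lemma cis_minus_1 (a : R) : (cis (2 * a) - 1)%C = (2 * Ci * sin a * cis a)%C.
Proof.
  apply Ceq; unfold cis; rewrite ?re_minus, ?im_minus; simpl.
  - rewrite cos_2a_sin. ring.
  - rewrite sin_2a. ring.
Qed.

Lemma csum_geometric (r : C) (n : nat) : ((r - 1) * csum (fun l => r ^ l) n)%C = (r ^ n - 1)%C.
Proof.
  induction n; [simpl; ring|]. rewrite csum_S, Cmult_plus_distr_l, IHn, Cpow_S. ring.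
Qed.

Lemma csum_arith_geometric (r : C) (n : nat) :
  ((r - 1) * csum (fun l => INR l * r ^ l) n)%C = (INR n * r ^ n - r * csum (fun l => r ^ l) n)%C.
Proof.
  induction n; [simpl; ring|].
  rewrite !csum_S, Cmult_plus_distr_l, IHn, Cpow_S, S_INR, RtoC_plus. ring.
Qed.

Lemma csum_delta (n k : nat) (v : C) : (k < n)%nat ->
  csum (fun i => if Nat.eq_dec i k then v else RtoC 0) n = v.
Proof.
  induction n; intros H; [lia|]. rewrite csum_S.
  destruct (Nat.eq_dec n k) as [E | E].
  - rewrite (csum_ext _ (fun _ => RtoC 0)).
    + rewrite csum_const. ring.
    + intros i Hi. destruct (Nat.eq_dec i k); auto; lia.
  - rewrite IHn by lia. ring.
Qed.

(* The index [j = 2 l - (N - 1)] of the symmetric sum. *)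
Definition jl (N l : nat) : R := 2 * INR l - (INR N - 1).

Lemma sum_step2_csum (N : nat) (f : Z -> C) : (1 <= N)%nat ->
  sum_step2 N f = csum (fun l => f (2 * Z.of_nat l - (Z.of_nat N - 1))%Z) N.
Proof.
  intros H. unfold sum_step2. rewrite <- csum_sum_n. f_equal. lia.
Qed.

Lemma IZR_jl (N l : nat) : IZR (2 * Z.of_nat l - (Z.of_nat N - 1)) = jl N l.
Proof. unfold jl. rewrite !minus_IZR, mult_IZR, <- !INR_IZR_INZ. reflexivity. Qed.

Lemma cis_jl (N l : nat) (a : R) :
  cis (jl N l * a) = (cis (- (INR N - 1) * a) * cis (2 * a) ^ l)%C.
Proof. unfold jl. rewrite <- cis_INR, <- cis_plus. f_equal. ring. Qed.

Lemma csum_cis_jl_0 (N : nat) (a : R) : sin a <> 0 -> cis (2 * INR N * a) = 1 ->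
  csum (fun l => cis (2 * a) ^ l)%C N = 0 /\ csum (fun l => cis (jl N l * a)) N = 0.
Proof.
  intros Hs H1.
  assert (Hr : (cis (2 * a) - 1)%C <> 0%C).
  { rewrite cis_minus_1. repeat apply Cmult_neq_0; auto using cis_neq_0, Ci_nz.
    - apply RtoC_neq_0; lra.
    - apply RtoC_neq_0; auto. }
  assert (E : csum (fun l => cis (2 * a) ^ l)%C N = 0).
  { assert (E := csum_geometric (cis (2 * a)) N).
    rewrite <- cis_INR in E. replace (INR N * (2 * a)) with (2 * INR N * a) in E by ring.
    rewrite H1 in E.
    replace (csum (fun l => cis (2 * a) ^ l)%C N)
      with ((cis (2 * a) - 1) * csum (fun l => cis (2 * a) ^ l)%C N / (cis (2 * a) - 1))%C
      by (field; auto).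
    rewrite E. field. auto. }
  split; auto.
  rewrite (csum_ext _ (fun l => cis (- (INR N - 1) * a) * cis (2 * a) ^ l)%C)
    by (intros; apply cis_jl).
  rewrite (csum_scal _ (fun l => cis (2 * a) ^ l)%C), E. ring.
Qed.

Lemma cis_2_PI_IZR (p : Z) : cis (2 * (IZR p * PI)) = 1.
Proof.
  assert (H : sin (IZR p * PI) = 0) by (apply sin_eq_0_1; exists p; auto).
  generalize (cis_minus_1 (IZR p * PI)). rewrite H. intros E.
  replace (cis (2 * (IZR p * PI))) with (cis (2 * (IZR p * PI)) - 1 + 1)%C by ring.
  rewrite E. ring.
Qed.

Lemma sin_PI_frac_neq_0 (N : nat) (p : Z) : p <> 0%Z -> (- Z.of_nat N < p < Z.of_nat N)%Z ->
  sin (PI * IZR p / INR N) <> 0.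
Proof.
  intros Hp Hb. assert (HPI := PI_RGT_0).
  assert (HN : 0 < INR N) by (apply lt_0_INR; lia).
  assert (Hlt : forall q, (0 < q < Z.of_nat N)%Z -> 0 < sin (PI * IZR q / INR N)).
  { intros q [H1 H2]. apply IZR_lt in H1, H2. rewrite <- INR_IZR_INZ in H2. apply sin_gt_0.
    - apply Rdiv_lt_0_compat; auto. nra.
    - apply Rmult_lt_reg_r with (INR N); auto. unfold Rdiv. rewrite Rmult_assoc, Rinv_l by lra. nra. }
  destruct (Z_lt_le_dec 0 p) as [H | H].
  - apply Rgt_not_eq, Hlt; lia.
  - intros E. assert (Hq : (0 < - p < Z.of_nat N)%Z) by lia. apply Hlt in Hq.
    rewrite opp_IZR in Hq. replace (PI * - IZR p / INR N) with (- (PI * IZR p / INR N)) in Hq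
      by (unfold Rdiv; ring).
    rewrite sin_neg in Hq. lra.
Qed.

Lemma csum_cis_jl (N : nat) (p : Z) : (- Z.of_nat N < p < Z.of_nat N)%Z ->
  csum (fun l => cis (jl N l * (PI * IZR p / INR N))) N =
  if Z.eq_dec p 0 then RtoC (INR N) else RtoC 0.
Proof.
  intros Hb. assert (HN : 0 < INR N) by (apply lt_0_INR; lia).
  destruct (Z.eq_dec p 0) as [-> | Hp].
  - rewrite (csum_ext _ (fun _ => RtoC 1)).
    + rewrite csum_const. ring.
    + intros l _. replace (jl N l * (PI * 0 / INR N)) with 0 by (unfold Rdiv; ring). apply cis_0.
  - apply csum_cis_jl_0; [apply sin_PI_frac_neq_0; auto|].
    replace (2 * INR N * (PI * IZR p / INR N)) with (2 * (IZR p * PI)) by (field; lra).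
    apply cis_2_PI_IZR.
Qed.

(* Differentiates the vanishing geometric sum of [csum_cis_jl]. *)
Lemma csum_jl_cis_jl (N p : nat) : (0 < p < N)%nat ->
  csum (fun l => jl N l * cis (jl N l * (PI * INR p / INR N)))%C N =
  (INR N * (-1) ^ p / (Ci * sin (PI * INR p / INR N)))%C.
Proof.
  intros Hp. assert (HN : 0 < INR N) by (apply lt_0_INR; lia).
  set (a := PI * INR p / INR N).
  assert (Hs : sin a <> 0).
  { unfold a. rewrite INR_IZR_INZ. apply sin_PI_frac_neq_0; lia. }
  assert (H1 : cis (2 * INR N * a) = 1).
  { unfold a. replace (2 * INR N * (PI * INR p / INR N)) with (2 * (IZR (Z.of_nat p) * PI))
      by (rewrite <- INR_IZR_INZ; field; lra).
    apply cis_2_PI_IZR. }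
  destruct (csum_cis_jl_0 N a Hs H1) as [E0 _].
  assert (E1 := csum_arith_geometric (cis (2 * a)) N).
  rewrite E0, <- cis_INR in E1. replace (INR N * (2 * a)) with (2 * INR N * a) in E1 by ring.
  rewrite H1, cis_minus_1 in E1.
  assert (Hsc : RtoC (sin a) <> 0%C) by (apply RtoC_neq_0; auto).
  assert (Hcis := cis_neq_0 a).
  assert (H2 : RtoC 2 <> 0%C) by (apply RtoC_neq_0; lra).
  assert (E2 : csum (fun l => INR l * cis (2 * a) ^ l)%C N =
    (INR N / (2 * Ci * sin a * cis a))%C).
  { replace (csum (fun l => INR l * cis (2 * a) ^ l)%C N) with
      (2 * Ci * sin a * cis a * csum (fun l => INR l * cis (2 * a) ^ l) N / (2 * Ci * sin a * cis a))%C.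
    - rewrite E1. f_equal. ring.
    - field. repeat split; auto using Ci_nz. }
  rewrite (csum_ext _ (fun l => cis (- (INR N - 1) * a) *
    (2 * (INR l * cis (2 * a) ^ l) - (INR N - 1) * cis (2 * a) ^ l))%C).
  2:{ intros l _. rewrite cis_jl. unfold jl. rewrite !RtoC_minus, !RtoC_mult. ring. }
  rewrite csum_scal, csum_minus, (csum_scal _ (fun l => INR l * cis (2 * a) ^ l)%C),
    (csum_scal _ (fun l => cis (2 * a) ^ l)%C), E0, E2.
  (* Since [N a = p PI], the leading phase is [(-1)^p] times [cis a], and [cis a] cancels the one in
     the denominator of [E2]. *)
  replace (- (INR N - 1) * a) with (- (INR p * PI) + a) by (unfold a; field; lra).
  rewrite cis_plus, cis_opp, cis_PI_INR.
  replace (/ (-1) ^ p)%C with ((-1) ^ p)%C.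
  - field. repeat split; auto using Ci_nz.
  - assert (Hm : ((-1) ^ p)%C <> 0%C) by (apply Cpow_nz, RtoC_neq_0; lra).
    replace ((-1) ^ p)%C with ((-1) ^ p * (-1) ^ p / (-1) ^ p)%C at 1 by (field; auto).
    rewrite Cpow_m1_sqr. field. auto.
Qed.

Lemma csum_pow_diff (t w : C) (n : nat) :
  ((t - w) * csum (fun i => t ^ (n - 1 - i) * w ^ i) n)%C = (t ^ n - w ^ n)%C.
Proof.
  induction n; [simpl; ring|]. rewrite csum_S.
  rewrite (csum_ext _ (fun i => t * (t ^ (n - 1 - i) * w ^ i))%C).
  - rewrite csum_scal. replace (S n - 1 - n)%nat with 0%nat by lia.
    rewrite !Cpow_S.
    replace ((t - w) * (t * csum (fun i => t ^ (n - 1 - i) * w ^ i) n + t ^ 0 * w ^ n))%C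
      with (t * ((t - w) * csum (fun i => t ^ (n - 1 - i) * w ^ i) n) + (t - w) * w ^ n)%C
      by (simpl; ring).
    rewrite IHn. ring.
  - intros i Hi. replace (S n - 1 - i)%nat with (S (n - 1 - i)) by lia. rewrite Cpow_S. ring.
Qed.

(** Write the denominator as [t - w], with [w = - rho cis (- j PI / N)]. The geometric sum gives
    [1 / (t - w)] as the sum over [i < N] of [t^(N-1-i) w^i / (t^N - w^N)], and [w^N = - rho^N] for
    every [j]. Orthogonality of the weights ([csum_cis_jl]) then keeps only [i = k - 1]. *)
Lemma partial_fractions (N k : nat) (rho : C) (t : R) : (1 <= k <= N)%nat ->
  (forall l, (l < N)%nat -> (t + rho * cis (- (jl N l * (PI / INR N))))%C <> 0%C) ->
  (t ^ N + rho ^ N)%C <> 0%C ->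
  csum (fun l => cis (jl N l * (PI * (INR k - 1) / INR N)) /
    (t + rho * cis (- (jl N l * (PI / INR N)))))%C N =
  (INR N * (-1) ^ (k - 1) * rho ^ (k - 1) * t ^ (N - k) / (t ^ N + rho ^ N))%C.
Proof.
  intros Hk Hn0 Hn. assert (HN : 0 < INR N) by (apply lt_0_INR; lia).
  rewrite (csum_ext _ (fun l => / (t ^ N + rho ^ N) * csum (fun i =>
    t ^ (N - 1 - i) * (- rho) ^ i *
      cis (jl N l * (PI * IZR (Z.of_nat (k - 1) - Z.of_nat i) / INR N))) N)%C).
  - rewrite csum_scal, csum_switch.
    rewrite (csum_ext _ (fun i => if Nat.eq_dec i (k - 1)
      then (INR N * (-1) ^ (k - 1) * rho ^ (k - 1) * t ^ (N - k))%C else RtoC 0)).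
    + rewrite csum_delta by lia. field. auto.
    + intros i Hi. rewrite csum_scal, csum_cis_jl by lia.
      destruct (Nat.eq_dec i (k - 1)) as [E | E];
        destruct (Z.eq_dec (Z.of_nat (k - 1) - Z.of_nat i) 0) as [E' | E']; try lia.
      * subst i. replace (N - 1 - (k - 1))%nat with (N - k)%nat by lia.
        replace (- rho)%C with (-1 * rho)%C by ring. rewrite Cpow_mult_l. ring.
      * ring.
  - intros l Hl. set (w := (- rho * cis (- (jl N l * (PI / INR N))))%C).
    assert (Hd := Hn0 l Hl).
    assert (Ed : (t + rho * cis (- (jl N l * (PI / INR N))))%C = (t - w)%C) by (unfold w; ring).
    rewrite Ed in *.
    assert (Ew : (w ^ N)%C = (- rho ^ N)%C).
    { unfold w. rewrite Cpow_mult_l, <- cis_INR.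
      (* As [- j = - 2 l + (N - 1)], the phase of [w^N] is [(-1)^(N-1)] whatever [l] is: this is
         where the step 2 of the sum over [j] is used. *)
      replace (INR N * - (jl N l * (PI / INR N))) with (- (2 * (INR l * PI)) + INR (N - 1) * PI).
      - rewrite cis_plus, cis_opp, (INR_IZR_INZ l), cis_2_PI_IZR, cis_PI_INR.
        replace (- rho)%C with (-1 * rho)%C by ring. rewrite Cpow_mult_l.
        replace ((-1) ^ N)%C with (-1 * (-1) ^ (N - 1))%C.
        + replace (-1 * (-1) ^ (N - 1) * rho ^ N * (/ 1 * (-1) ^ (N - 1)))%C
            with (- rho ^ N * ((-1) ^ (N - 1) * (-1) ^ (N - 1)))%C by (field; apply C1_nz).
          rewrite Cpow_m1_sqr. ring.
        + rewrite <- Cpow_S. f_equal. lia.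
      - rewrite minus_INR by lia. unfold jl. simpl (INR 1). field. lra. }
    assert (Eg := csum_pow_diff t w N). rewrite Ew in Eg.
    replace (t ^ N - - rho ^ N)%C with (t ^ N + rho ^ N)%C in Eg by ring.
    rewrite (csum_ext _ (fun i => cis (jl N l * (PI * (INR k - 1) / INR N)) *
      (t ^ (N - 1 - i) * w ^ i))%C).
    + rewrite csum_scal, <- Eg. field. split; auto.
      intros E0. apply Hn. rewrite <- Eg, E0. ring.
    + intros i _. unfold w. rewrite Cpow_mult_l, <- cis_INR.
      replace (jl N l * (PI * IZR (Z.of_nat (k - 1) - Z.of_nat i) / INR N)) with
        (jl N l * (PI * (INR k - 1) / INR N) + INR i * - (jl N l * (PI / INR N))).
      * rewrite cis_plus. ring.
      * rewrite minus_IZR, <- !INR_IZR_INZ, minus_INR by lia. simpl (INR 1). field. lra.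
Qed.

(** * The points [exp (- i pi j / N) / x^(1/N)] *)

Definition xroot (N : nat) (x : C) : C := Cpower x (1 / INR N)%R.

Definition upoint (N : nat) (x : C) (l : nat) : C :=
  (cis (- (jl N l * (PI / INR N))) / xroot N x)%C.

Lemma xroot_neq_0 (N : nat) (x : C) : xroot N x <> 0%C.
Proof. apply Cexp_neq_0. Qed.

Lemma xroot_pow (N : nat) (x : C) : (1 <= N)%nat -> slit_plane x -> (xroot N x ^ N)%C = x.
Proof.
  intros HN Hx. assert (HN0 : 0 < INR N) by (apply lt_0_INR; lia).
  unfold xroot, Cpower. rewrite <- Cexp_INR_mult.
  rewrite <- (Cexp_Clog x Hx) at 2. f_equal.
  rewrite Cmult_assoc, <- RtoC_mult. replace (INR N * (1 / INR N)) with 1 by (field; lra). ring.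
Qed.

Lemma Cpower_div_INR (N p : nat) (x : C) : (1 <= N)%nat ->
  Cpower x (INR p / INR N)%R = (xroot N x ^ p)%C.
Proof.
  intros HN. assert (HN0 : 0 < INR N) by (apply lt_0_INR; lia).
  unfold xroot, Cpower. rewrite <- Cexp_INR_mult. f_equal.
  rewrite Cmult_assoc, <- RtoC_mult. do 2 f_equal. field. lra.
Qed.

Lemma Cpower_opp (x : C) (s : R) : Cpower x (- s)%R = (/ Cpower x s)%C.
Proof. unfold Cpower. rewrite <- Cexp_opp, RtoC_opp. f_equal. ring. Qed.

Definition ulog (N : nat) (x : C) (l : nat) : C :=
  (- ((1 / INR N)%R * Clog x) - Ci * (jl N l * (PI / INR N))%R)%C.

Lemma upoint_Cexp (N : nat) (x : C) (l : nat) : upoint N x l = Cexp (ulog N x l).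
Proof.
  unfold upoint, ulog, xroot, Cpower, Cdiv, Cminus.
  rewrite Cexp_plus, Cexp_opp, cis_Cexp, RtoC_opp, Cmult_comm. f_equal. f_equal. ring.
Qed.

(** From [|j| <= N - 1] and [|arg x| < PI], the argument is at most [(|arg x| + |j| PI) / N < PI] in
    absolute value. Hence [ulog] is the principal logarithm of the point, which avoids the cut. *)
Lemma Im_ulog_bound (N : nat) (x : C) (l : nat) : (l < N)%nat -> slit_plane x ->
  Rabs (Im (ulog N x l)) < PI.
Proof.
  intros Hl Hx. assert (HN0 : 0 < INR N) by (apply lt_0_INR; lia).
  assert (HI := Im_Clog_bound x Hx). assert (HPI := PI_RGT_0).
  unfold ulog. rewrite im_minus.
  replace (Im (- ((1 / INR N)%R * Clog x))) with (- (1 / INR N * Im (Clog x)))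
    by (unfold Copp; simpl; unfold Re, Im; ring).
  replace (Im (Ci * (jl N l * (PI / INR N))%R)) with (jl N l * (PI / INR N)) by (simpl; ring).
  assert (Hj : - (INR N - 1) <= jl N l <= INR N - 1).
  { unfold jl. assert (H0 := pos_INR l). assert (H1 : INR (S l) <= INR N) by (apply le_INR; lia).
    rewrite S_INR in H1. lra. }
  replace (- (1 / INR N * Im (Clog x)) - jl N l * (PI / INR N))
    with ((- Im (Clog x) - jl N l * PI) / INR N) by (field; lra).
  apply Rabs_def2 in HI.
  apply Rabs_def1; apply Rmult_lt_reg_r with (INR N); auto;
    unfold Rdiv; rewrite Rmult_assoc, Rinv_l by lra; nra.
Qed.

Lemma upoint_slit (N : nat) (x : C) (l : nat) : (l < N)%nat -> slit_plane x ->
  slit_plane (upoint N x l).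
Proof. intros. rewrite upoint_Cexp. apply slit_plane_Cexp, Im_ulog_bound; auto. Qed.

Lemma Clog_upoint (N : nat) (x : C) (l : nat) : (l < N)%nat -> slit_plane x ->
  Clog (upoint N x l) = ulog N x l.
Proof. intros. rewrite upoint_Cexp. apply Clog_Cexp, Im_ulog_bound; auto. Qed.

Definition ypoint (N : nat) (x : C) (l m : nat) : C :=
  (Rpower (INR (S m)) (1 / INR N) * upoint N x l)%C.

Lemma ypoint_slit (N : nat) (x : C) (l m : nat) : (l < N)%nat -> slit_plane x ->
  slit_plane (ypoint N x l m).
Proof. intros. apply slit_plane_scal; [apply Rpower_pos | apply upoint_slit; auto]. Qed.

Lemma Clog_ypoint (N : nat) (x : C) (l m : nat) : (l < N)%nat -> slit_plane x ->
  Clog (ypoint N x l m) = ((1 / INR N * ln (INR (S m)))%R + ulog N x l)%C.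
Proof.
  intros. unfold ypoint. rewrite Clog_scal, Clog_upoint; auto using Rpower_pos, upoint_slit.
  unfold Rpower. rewrite ln_exp. reflexivity.
Qed.

Definition rho (N : nat) (x : C) (m : nat) : C :=
  (Rpower (INR (S m)) (1 / INR N) / xroot N x)%C.

Lemma ypoint_rho (N : nat) (x : C) (l m : nat) :
  ypoint N x l m = (rho N x m * cis (- (jl N l * (PI / INR N))))%C.
Proof. unfold ypoint, upoint, rho, Cdiv. ring. Qed.

Lemma Rpower_inv_pow (N : nat) (a : R) : (1 <= N)%nat -> 0 < a ->
  Rpower a (1 / INR N) ^ N = a.
Proof.
  intros HN Ha. assert (HN0 : 0 < INR N) by (apply lt_0_INR; lia).
  rewrite <- Rpower_pow, Rpower_mult by apply Rpower_pos.
  replace (1 / INR N * INR N) with 1 by (field; lra). apply Rpower_1; auto.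
Qed.

Lemma rho_pow (N : nat) (x : C) (m : nat) : (1 <= N)%nat -> slit_plane x ->
  (rho N x m ^ N)%C = (INR (S m) / x)%C.
Proof.
  intros HN Hx. unfold rho, Cdiv. rewrite Cpow_mult_l, Cpow_inv by apply xroot_neq_0.
  rewrite xroot_pow, <- RtoC_pow, Rpower_inv_pow; auto using INR_S_pos.
Qed.

(* The kernel [n^(N-k) / (m (n^N + m/x))], with [m] and [n] starting at 1; the [m]- and
   [n]-sums of the two sides of the theorem are its two iterated sums. *)
Definition bker (k N : nat) (x : C) (m n : nat) : C :=
  (INR (S n) ^ (N - k) / (INR (S m) * (INR (S n) ^ N + INR (S m) / x)))%C.

Lemma bker_denom_neq_0 (N : nat) (x : C) (m : nat) (t : R) : 0 <= t -> slit_plane x ->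
  (t ^ N + INR (S m) / x)%C <> 0%C.
Proof.
  intros Ht Hx. rewrite <- RtoC_pow. apply slit_plane_neq_0.
  apply (slit_plane_affine (/ x)%C (INR (S m)) (t ^ N)).
  - apply pos_INR.
  - apply pow_le; auto.
  - generalize (INR_S_pos m) (pow_le t N Ht). lra.
  - apply slit_plane_inv; auto.
Qed.

Lemma csum_cis_inv_ypoint (k N : nat) (x : C) (m : nat) (t : R) :
  (1 <= k <= N)%nat -> slit_plane x -> 0 <= t ->
  csum (fun l => cis (jl N l * (PI * (INR k - 1) / INR N)) / (t + ypoint N x l m))%C N =
  (INR N * (-1) ^ (k - 1) * rho N x m ^ (k - 1) * t ^ (N - k) / (t ^ N + INR (S m) / x))%C.
Proof.
  intros Hk Hx Ht.
  rewrite <- (rho_pow N x m) by (auto; lia).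
  rewrite <- partial_fractions; auto.
  - apply csum_ext. intros l _. rewrite ypoint_rho. reflexivity.
  - intros l Hl. rewrite <- ypoint_rho, Cplus_comm.
    apply slit_plane_neq_0, slit_plane_plus; auto. apply ypoint_slit; auto.
  - rewrite rho_pow by (auto; lia). apply bker_denom_neq_0; auto.
Qed.

Lemma csum_cis_harm_ypoint (k N : nat) (x : C) (m M : nat) :
  (1 <= k <= N)%nat -> slit_plane x ->
  csum (fun l => cis (jl N l * (PI * (INR k - 1) / INR N)) * harm (ypoint N x l m) M)%C N =
  (INR N * (-1) ^ (k - 1) * rho N x m ^ (k - 1) * INR (S m) * csum (bker k N x m) M)%C.
Proof.
  intros Hk Hx. unfold harm.
  rewrite (csum_ext _ (fun l => csum (fun i => cis (jl N l * (PI * (INR k - 1) / INR N)) *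
    / (ypoint N x l m + INR (S i))) M)%C)
    by (intros; symmetry; apply csum_scal).
  rewrite csum_switch, <- csum_scal. apply csum_ext. intros n _.
  rewrite (csum_ext _ (fun l => cis (jl N l * (PI * (INR k - 1) / INR N)) /
    (INR (S n) + ypoint N x l m))%C)
    by (intros; unfold Cdiv; do 2 f_equal; apply Cplus_comm).
  rewrite csum_cis_inv_ypoint; auto using pos_INR.
  unfold bker. field. split.
  - apply slit_plane_neq_0; auto.
  - assert (H := bker_denom_neq_0 N x m (INR (S n)) (pos_INR _) Hx).
    split; [|apply RtoC_neq_0; generalize (INR_S_pos m); lra].
    intros E. apply H. unfold Cdiv.
    replace (INR (S n) ^ N + INR (S m) * / x)%C with ((INR (S n) ^ N * x + INR (S m)) / x)%C
      by (field; apply slit_plane_neq_0; auto).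
    rewrite E. unfold Cdiv. ring.
Qed.

Lemma bker_row (k N : nat) (x : C) (m n : nat) : (k <= N)%nat -> slit_plane x ->
  ((/ INR (S m) - / (INR (S n) ^ N * x + INR (S m))) / INR (S n) ^ k)%C = bker k N x m n.
Proof.
  intros Hk Hx. unfold bker.
  assert (Hx0 := slit_plane_neq_0 x Hx).
  assert (H := bker_denom_neq_0 N x m (INR (S n)) (pos_INR _) Hx).
  assert (Hm : RtoC (INR (S m)) <> 0%C) by (apply RtoC_neq_0; generalize (INR_S_pos m); lra).
  assert (Hn : RtoC (INR (S n)) <> 0%C) by (apply RtoC_neq_0; generalize (INR_S_pos n); lra).
  assert (Hd : (INR (S n) ^ N * x + INR (S m))%C <> 0%C).
  { intros E. apply H.
    replace (INR (S n) ^ N + INR (S m) / x)%C with ((INR (S n) ^ N * x + INR (S m)) / x)%C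
      by (field; auto). rewrite E. unfold Cdiv. ring. }
  replace (INR (S n) ^ N)%C with (INR (S n) ^ k * INR (S n) ^ (N - k))%C in *
    by (rewrite <- Cpow_add_r; f_equal; lia).
  field. repeat split; auto using Cpow_nz.
Qed.

(** * Interchange of summations *)

Lemma Clim_csum (u : nat -> nat -> C) (l : nat -> C) (N : nat) :
  (forall i, (i < N)%nat -> Clim (u i) (l i)) ->
  Clim (fun n => csum (fun i => u i n) N) (csum l N).
Proof.
  induction N; intros H; simpl.
  - apply Clim_const.
  - apply Clim_plus; auto.
Qed.

Lemma csum_tail_bound (a : nat -> C) (v : nat -> R) (l : C) (P : nat) :
  (forall n, Cmod (a n) <= v n) -> ex_series v -> Clim (csum a) l ->
  Cmod (l - csum a P) <= Series v - rsum v P.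
Proof.
  intros H Hv Hl.
  assert (Hv0 : forall n, 0 <= v n) by (intros n; eapply Rle_trans; [apply Cmod_ge_0 | apply H]).
  apply Clim_Cmod_le with (fun k => csum a (k + P)%nat).
  - apply (is_lim_seq_incr_n (fun k => Cmod (csum a k - l)) P). exact Hl.
  - intros k. apply Rle_trans with (rsum v (k + P) - rsum v P).
    + induction k; cbn [Nat.add].
      * replace (csum a P - csum a P)%C with (RtoC 0) by ring. rewrite Cmod_0. lra.
      * rewrite csum_S.
        replace (csum a (k + P) + a (k + P)%nat - csum a P)%C
          with (csum a (k + P) - csum a P + a (k + P)%nat)%C by ring.
        eapply Rle_trans; [apply Cmod_triangle|]. simpl. generalize (H (k + P)%nat). lra.
    + generalize (rsum_le_Series v (k + P) Hv0 Hv). lra.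
Qed.

Lemma is_lim_seq_tail (v : nat -> R) : ex_series v ->
  is_lim_seq (fun P => Series v - rsum v P) 0.
Proof.
  intros Hv. replace (Finite 0) with (Finite (Series v - Series v)) by (f_equal; ring).
  apply is_lim_seq_minus'; [apply is_lim_seq_const|].
  apply is_series_rsum, Series_correct, Hv.
Qed.

Lemma Clim_Cmod_diff_unique (u v : nat -> C) (a b : C) (e : nat -> R) :
  Clim u a -> Clim v b -> (forall n, Cmod (u n - v n) <= e n) -> is_lim_seq e 0 -> a = b.
Proof.
  intros Hu Hv He H0. apply Clim_unique with u; auto.
  apply Clim_intro with (fun n => e n + Cmod (v n - b)).
  - intros n. replace (u n - b)%C with ((u n - v n) + (v n - b))%C by ring.
    eapply Rle_trans; [apply Cmod_triangle|]. generalize (He n). lra.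
  - apply is_lim_seq_plus_0; auto.
Qed.

Lemma ex_series_Rscal_l (c : R) (a : nat -> R) : ex_series a -> ex_series (fun n => c * a n).
Proof. intros H. apply (ex_series_scal_l c a H). Qed.

Lemma csum_partial_bound (b : nat -> nat -> C) (B : nat -> C) (u v : nat -> R) :
  (forall m, 0 <= u m) -> ex_series u -> ex_series v -> (forall n, 0 <= v n) ->
  (forall m n, Cmod (b m n) <= u m * v n) ->
  (forall m, Clim (csum (b m)) (B m)) ->
  forall P Q, Cmod (csum B Q - csum (fun m => csum (b m) P) Q)
    <= Series u * (Series v - rsum v P).
Proof.
  intros Hu Hus Hvs Hv Hb HB P Q.
  assert (Ht : 0 <= Series v - rsum v P) by (generalize (rsum_le_Series v P Hv Hvs); lra).
  rewrite <- csum_minus. eapply Rle_trans.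
  - apply Cmod_csum_le with (g := fun m => (Series v - rsum v P) * u m). intros m _.
    eapply Rle_trans.
    + apply csum_tail_bound with (v := fun n => u m * v n); auto.
      apply ex_series_Rscal_l; auto.
    + rewrite Series_scal_l, rsum_scal. right. ring.
  - rewrite rsum_scal, Rmult_comm. apply Rmult_le_compat_r; auto. apply rsum_le_Series; auto.
Qed.

(** Both iterated sums are compared with the sum over the square [M] by [M]. By [csum_partial_bound]
    the two differences are controlled by the tails of [u] and of [v]. *)
Lemma csum_dominated_interchange (b : nat -> nat -> C) (u v : nat -> R) :
  (forall m, 0 <= u m) -> (forall n, 0 <= v n) -> ex_series u -> ex_series v ->
  (forall m n, Cmod (b m n) <= u m * v n) ->
  exists B1 B2 S, (forall m, Clim (csum (b m)) (B1 m)) /\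
    (forall n, Clim (csum (fun m => b m n)) (B2 n)) /\ Clim (csum B1) S /\ Clim (csum B2) S.
Proof.
  intros Hu Hv Hus Hvs Hb.
  assert (H1 : forall m, exists l, Clim (csum (b m)) l).
  { intros m. apply Clim_csum_dominated with (fun n => u m * v n); auto.
    apply ex_series_Rscal_l; auto. }
  assert (H2 : forall n, exists l, Clim (csum (fun m => b m n)) l).
  { intros n. apply Clim_csum_dominated with (fun m => v n * u m).
    - intros m. rewrite Rmult_comm; auto.
    - apply ex_series_Rscal_l; auto. }
  assert (HB1 : forall m, Clim (csum (b m)) (CLim_seq (csum (b m)))).
  { intros m. destruct (H1 m) as [l Hl]. rewrite (CLim_seq_unique _ _ Hl); auto. }
  assert (HB2 : forall n, Clim (csum (fun m => b m n)) (CLim_seq (csum (fun m => b m n)))).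
  { intros n. destruct (H2 n) as [l Hl]. rewrite (CLim_seq_unique _ _ Hl); auto. }
  set (B1 := fun m => CLim_seq (csum (b m))) in *.
  set (B2 := fun n => CLim_seq (csum (fun m => b m n))) in *.
  assert (E1 : exists S, Clim (csum B1) S).
  { apply Clim_csum_dominated with (fun m => u m * Series v); [|apply ex_series_scal_r; auto].
    intros m. replace (B1 m) with (B1 m - csum (b m) 0)%C by (simpl; ring).
    eapply Rle_trans.
    - apply csum_tail_bound with (v := fun n => u m * v n); auto.
      apply ex_series_Rscal_l; auto.
    - rewrite Series_scal_l. simpl. lra. }
  assert (E2 : exists S, Clim (csum B2) S).
  { apply Clim_csum_dominated with (fun n => v n * Series u); [|apply ex_series_scal_r; auto].
    intros n. replace (B2 n) with (B2 n - csum (fun m => b m n) 0)%C by (simpl; ring).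
    eapply Rle_trans.
    - apply csum_tail_bound with (v := fun m => v n * u m).
      + intros m. rewrite Rmult_comm; auto.
      + apply ex_series_Rscal_l; auto.
      + apply HB2.
    - rewrite Series_scal_l. simpl. lra. }
  destruct E1 as [S1 E1], E2 as [S2 E2].
  exists B1, B2, S1. repeat split; auto.
  replace S1 with S2; auto.
  apply Clim_Cmod_diff_unique with (csum B2) (csum B1)
    (fun M => Series v * (Series u - rsum u M) + Series u * (Series v - rsum v M)); auto.
  - intros M.
    replace (csum B2 M - csum B1 M)%C with
      ((csum B2 M - csum (fun n => csum (fun m => b m n) M) M) -
       (csum B1 M - csum (fun m => csum (b m) M) M))%C
      by (rewrite (csum_switch b); ring).
    eapply Rle_trans; [apply Cmod_triangle|]. rewrite Cmod_opp. apply Rplus_le_compat.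
    + apply csum_partial_bound with (b := fun n m => b m n); auto.
      intros n m. rewrite Rmult_comm; auto.
    + apply csum_partial_bound; auto.
  - apply is_lim_seq_plus_0; apply is_lim_seq_mult_0, is_lim_seq_tail; auto.
Qed.

(** A weak form of the weighted inequality between means: the left side is at most the larger of [a]
    and [b]. *)
Lemma Rpower_weighted_le (a b s : R) : 0 < a -> 0 < b -> 0 <= s <= 1 ->
  Rpower a s * Rpower b (1 - s) <= a + b.
Proof.
  intros Ha Hb Hs. unfold Rpower. rewrite <- exp_plus.
  assert (Hmono : forall u v, u <= v -> exp u <= exp v).
  { intros u v [H | ->]; [apply Rlt_le, exp_increasing; auto | lra]. }
  destruct (Rle_dec (ln a) (ln b)) as [H | H].
  - apply Rle_trans with (exp (ln b)); [|rewrite exp_ln; lra].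
    apply Hmono. nra.
  - apply Rle_trans with (exp (ln a)); [|rewrite exp_ln; lra].
    apply Hmono. nra.
Qed.

Lemma Rpower_INR_S (n N : nat) : Rpower (INR (S n)) (INR N) = INR (S n) ^ N.
Proof. apply Rpower_pow, INR_S_pos. Qed.

(** The denominator [n^N + m] is at least [n^(N s) m^(1-s)]. The choice [s = (N - k + 3/2) / N]
    leaves the power [n^(-3/2)] and an exponent of [1/m] exceeding 1 by [(k - 3/2) / N], which is
    positive as [k >= 2]. For [k = 1] no [s] in [[0, 1]] makes both powers summable. *)
Lemma bker_bound (k N : nat) (x : C) : (1 < k <= N)%nat -> slit_plane x ->
  exists K, 0 <= K /\ forall m n, Cmod (bker k N x m n) <=
    (K * Rpower (INR (S m)) (- (1 + (INR k - 3 / 2) / INR N))) * Rpower (INR (S n)) (- (3 / 2)).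
Proof.
  intros Hk Hx. assert (HN : 0 < INR N) by (apply lt_0_INR; lia).
  assert (Hk2 : 2 <= INR k) by (apply (le_INR 2); lia).
  assert (HkN : INR k <= INR N) by (apply le_INR; lia).
  destruct (slit_plane_cone _ (slit_plane_inv x Hx)) as [c Hc]. change (cone_bound c (/ x)%C) in Hc.
  assert (Hc0 := proj1 Hc).
  assert (Hix := slit_plane_Cmod_pos _ (slit_plane_inv x Hx)).
  (* The cone bound at [1/x] yields [n^N + m |1/x|]; the factor [d] gives the two terms a common
     weight. *)
  set (d := Rmin 1 (Cmod (/ x))).
  assert (Hd : 0 < d) by (apply Rmin_pos; lra).
  exists (/ (c * d)). split; [apply Rlt_le, Rinv_0_lt_compat; nra|].
  intros m n. assert (Hm := INR_S_pos m). assert (Hn := INR_S_pos n).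
  set (a := INR (S m)) in *. set (b := INR (S n)) in *.
  set (s := (INR N - INR k + 3 / 2) / INR N).
  assert (Hs : 0 <= s <= 1).
  { unfold s. split.
    - apply Rlt_le, Rdiv_lt_0_compat; lra.
    - apply Rmult_le_reg_r with (INR N); auto. unfold Rdiv. rewrite Rmult_assoc, Rinv_l; lra. }
  assert (HbN : 0 < b ^ N) by (apply pow_lt; auto).
  assert (Hlow : c * d * (Rpower (b ^ N) s * Rpower a (1 - s)) <= Cmod (b ^ N + a / x)).
  { rewrite <- RtoC_pow, Cplus_comm. unfold Cdiv.
    eapply Rle_trans; [|apply (proj2 Hc); lra].
    rewrite Rmult_assoc. apply Rmult_le_compat_l; [lra|].
    apply Rle_trans with (d * (b ^ N + a)).
    - apply Rmult_le_compat_l; [lra|]. apply Rpower_weighted_le; auto.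
    - assert (d <= 1) by apply Rmin_l. assert (d <= Cmod (/ x)) by apply Rmin_r. nra. }
  assert (Hdn : (b ^ N + a / x)%C <> 0%C) by (apply bker_denom_neq_0; auto; unfold b; apply pos_INR).
  unfold bker. fold a b.
  assert (HaC : RtoC a <> 0%C) by (apply RtoC_neq_0; lra).
  rewrite Cmod_div, Cmod_mult, <- RtoC_pow, !Cmod_RtoC_pos
    by (try apply Cmult_neq_0; auto; try apply pow_le; lra).
  rewrite <- (Rpower_pow (N - k) b Hn), <- (Rpower_pow N b Hn), Rpower_mult in *.
  rewrite minus_INR by lia.
  assert (Hp1 := Rpower_pos b (INR N * s)). assert (Hp2 := Rpower_pos a (1 - s)).
  replace (Rpower a (- (1 + (INR k - 3 / 2) / INR N))) with (/ a * / Rpower a (1 - s)).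
  2:{ replace (/ a) with (Rpower a (- (1))) by (rewrite Rpower_Ropp, Rpower_1; auto).
      rewrite <- Rpower_Ropp, <- Rpower_plus. f_equal. unfold s. field. lra. }
  replace (Rpower b (- (3 / 2))) with (Rpower b (INR N - INR k) * / Rpower b (INR N * s)).
  2:{ rewrite <- !Rpower_Ropp, <- Rpower_plus. f_equal. unfold s. field. lra. }
  assert (Hp3 := Rpower_pos b (INR N - INR k)).
  apply Rle_trans with (Rpower b (INR N - INR k) *
    / (a * (c * d * (Rpower b (INR N * s) * Rpower a (1 - s))))).
  - apply Rmult_le_compat_l; [lra|]. apply Rinv_le_contravar.
    + repeat apply Rmult_lt_0_compat; lra.
    + apply Rmult_le_compat_l; [lra|].
      exact Hlow.
  - right. field. repeat split; lra.
Qed.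

(** * Harmonic numbers and Euler's constant *)

Definition harmonic (n : nat) : R := rsum (fun i => / INR (S i)) n.

Lemma csum_inv_INR (n : nat) : csum (fun i => / INR (S i))%C n = RtoC (harmonic n).
Proof.
  unfold harmonic. rewrite <- csum_RtoC. apply csum_ext. intros i _.
  rewrite RtoC_inv; auto. generalize (INR_S_pos i). lra.
Qed.

Lemma harm_1 (n : nat) : harm 1 n = RtoC (harmonic (S n) - 1).
Proof.
  induction n.
  - unfold harm, harmonic; simpl. rewrite Rinv_1. f_equal. ring.
  - rewrite harm_S, IHn. unfold harmonic at 2. cbn [rsum]. fold (harmonic (S n)).
    rewrite !RtoC_minus. unfold harmonic. cbn [rsum]. rewrite !RtoC_plus.
    rewrite (RtoC_inv (INR (S (S n)))) by (generalize (INR_S_pos (S n)); lra).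
    replace (1 + INR (S n))%C with (RtoC (INR (S (S n)))) by (rewrite <- RtoC_plus, (S_INR (S n)); f_equal; ring).
    ring.
Qed.

Lemma rsum_sum_n_m (f : nat -> R) (n : nat) : rsum (fun i => f (S i)) n = sum_n_m f 1 n.
Proof.
  induction n.
  - rewrite sum_n_m_zero; auto.
  - simpl rsum. rewrite IHn, sum_n_Sm by lia. reflexivity.
Qed.

(** Convergence is read off from the limit defining [digamma1] at [1], because [harm 1 n] is the
    harmonic number of index [n + 1] minus 1; hence the value [1 - psi (2)]. *)
Lemma euler_gamma_lim :
  is_lim_seq (fun n => harmonic (S n) - ln (INR (S n))) euler_gamma.
Proof.
  assert (H := Clim_Re _ _ (digamma1_lim_ln 1 (slit_plane_RtoC 1 Rlt_0_1))).
  set (L := Re (digamma1 1)) in *.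
  assert (H1 : is_lim_seq (fun n => harmonic (S n) - ln (INR (S n))) (1 - L)).
  { apply is_lim_seq_ext with (fun n => 1 - Re (ln (INR (S n)) - harm 1 (S n)) - / INR (S (S n))).
    - intros n. rewrite harm_1, <- RtoC_minus. rewrite re_RtoC.
      unfold harmonic at 1. cbn [rsum]. fold (harmonic (S n)).
      unfold harmonic. cbn [rsum]. ring.
    - replace (Finite (1 - L)) with (Finite (1 - L - 0)) by (f_equal; ring).
      apply is_lim_seq_minus'.
      + apply is_lim_seq_minus'; auto. apply is_lim_seq_const.
      + apply (is_lim_seq_incr_1 (fun n => / INR (S n))). apply is_lim_seq_inv_INR_S. }
  replace euler_gamma with (1 - L); auto. symmetry. unfold euler_gamma.
  rewrite (is_lim_seq_unique _ (1 - L)); [reflexivity|].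
  apply is_lim_seq_incr_1. apply is_lim_seq_ext with (2 := H1).
  intros n. f_equal. unfold harmonic. apply (rsum_sum_n_m (fun m => / INR m)).
Qed.

Lemma phi_series (y : C) : slit_plane y ->
  Clim (fun n => csum (fun m => / INR (S m) - / (y + INR (S m)))%C n)
    (phi y + euler_gamma + Clog y)%C.
Proof.
  intros Hy. apply Clim_incr_1.
  apply Clim_ext with (fun n => ln (INR (S n)) - harm y (S n) +
    RtoC (harmonic (S n) - ln (INR (S n))))%C.
  - intros n. rewrite csum_minus, csum_inv_INR, RtoC_minus. unfold harm. ring.
  - replace (phi y + euler_gamma + Clog y)%C with (digamma1 y + euler_gamma)%C
      by (unfold phi; ring).
    apply Clim_plus; [apply digamma1_lim_ln; auto | apply Clim_RtoC, euler_gamma_lim].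
Qed.

(** * The case [k > 1] *)

Lemma Clim_eq (u : nat -> C) (a b : C) : Clim u a -> a = b -> Clim u b.
Proof. intros H <-; auto. Qed.

(** By [phi_series], the sum of the kernel over [m] is [n^(-k) (psi (y + 1) + gamma)] with
    [y = n^N x]. Since [log y = N ln n + log x], subtracting [gamma + log y] produces after
    summation over [n] the terms in [zeta (k)] and in [zeta' (k)]. *)
Lemma phi_left_row (k N : nat) (x : C) (n : nat) (B : C) :
  (1 <= k <= N)%nat -> slit_plane x -> Clim (csum (fun m => bker k N x m n)) B ->
  (phi (INR (S n) ^ N * x) / INR (S n) ^ k)%C =
  (B - (euler_gamma + Clog x) * / INR (S n) ^ k - INR N * (ln (INR (S n)) * / INR (S n) ^ k))%C.
Proof.
  intros Hk Hx HB. assert (Hn := INR_S_pos n).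
  assert (HnC : (INR (S n) ^ k)%C <> 0%C) by (apply Cpow_nz, RtoC_neq_0; lra).
  assert (Hp : 0 < INR (S n) ^ N) by (apply pow_lt; auto).
  assert (Hy : slit_plane (INR (S n) ^ N * x)%C)
    by (rewrite <- RtoC_pow; apply slit_plane_scal; auto).
  assert (Elog : Clog (INR (S n) ^ N * x) = (INR N * ln (INR (S n)) + Clog x)%C).
  { rewrite <- RtoC_pow, Clog_scal by auto. rewrite ln_pow, RtoC_mult by auto. reflexivity. }
  assert (H := Clim_scal (/ INR (S n) ^ k)%C _ _ (phi_series _ Hy)).
  assert (E : B = (/ INR (S n) ^ k * (phi (INR (S n) ^ N * x) + euler_gamma + Clog (INR (S n) ^ N * x)))%C).
  { apply Clim_unique with (csum (fun m => bker k N x m n)); auto.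
    apply Clim_ext with (2 := H). intros M. rewrite <- csum_scal. apply csum_ext. intros m _.
    rewrite <- bker_row by (auto; lia). unfold Cdiv. apply Cmult_comm. }
  rewrite E, Elog. field. auto.
Qed.

(** For [1 < k <= N] the weights sum to zero, which removes [ln M] and the part of [log y_j] that
    does not depend on [j]. What survives is [- i PI j / N], and its weighted sum is the one of
    [csum_jl_cis_jl]: the origin of the sine in the theorem. *)
Lemma csum_cis_phi_ypoint (k N : nat) (x : C) (m : nat) (B : C) :
  (1 < k <= N)%nat -> slit_plane x -> Clim (csum (bker k N x m)) B ->
  csum (fun l => cis (jl N l * (PI * (INR k - 1) / INR N)) * phi (ypoint N x l m))%C N =
  ((-1) ^ (k - 1) * (PI / sin (PI / INR N * (INR k - 1)))%R
   - INR N * (-1) ^ (k - 1) * rho N x m ^ (k - 1) * INR (S m) * B)%C.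
Proof.
  intros Hk Hx HB. assert (HN : 0 < INR N) by (apply lt_0_INR; lia).
  set (e := fun l => cis (jl N l * (PI * (INR k - 1) / INR N))).
  assert (Ep : INR k - 1 = INR (k - 1)) by (rewrite minus_INR by lia; reflexivity).
  assert (E0 : csum e N = 0).
  { unfold e. rewrite Ep, (INR_IZR_INZ (k - 1)), csum_cis_jl by lia.
    destruct (Z.eq_dec (Z.of_nat (k - 1)) 0); auto. lia. }
  assert (Hs : sin (PI / INR N * (INR k - 1)) <> 0).
  { rewrite Ep, (INR_IZR_INZ (k - 1)).
    replace (PI / INR N * IZR (Z.of_nat (k - 1))) with (PI * IZR (Z.of_nat (k - 1)) / INR N)
      by (unfold Rdiv; ring).
    apply sin_PI_frac_neq_0; lia. }
  assert (Elog : csum (fun l => e l * Clog (ypoint N x l m))%C N =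
    (- ((-1) ^ (k - 1) * (PI / sin (PI / INR N * (INR k - 1)))%R))%C).
  { rewrite (csum_ext _ (fun l => ((1 / INR N * ln (INR (S m)))%R - (1 / INR N)%R * Clog x) * e l
      - Ci * (PI / INR N)%R * (jl N l * e l))%C).
    2:{ intros l Hl. rewrite Clog_ypoint by auto. unfold ulog. rewrite (RtoC_mult (jl N l)). ring. }
    rewrite csum_minus, !csum_scal, E0.
    unfold e. rewrite (csum_ext _ (fun l => jl N l * cis (jl N l * (PI * INR (k - 1) / INR N)))%C)
      by (intros; rewrite Ep; auto).
    rewrite csum_jl_cis_jl by lia.
    replace (PI / INR N * (INR k - 1)) with (PI * INR (k - 1) / INR N) in *
      by (rewrite <- Ep; unfold Rdiv; ring).
    rewrite !RtoC_div by (auto; lra). field. repeat split; try apply RtoC_neq_0; auto using Ci_nz. lra. }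
  apply Clim_unique with (fun M => csum (fun l => e l *
    (ln (INR (S M)) - harm (ypoint N x l m) (S M) - Clog (ypoint N x l m)))%C N).
  - apply (Clim_csum (fun l M => e l *
      (ln (INR (S M)) - harm (ypoint N x l m) (S M) - Clog (ypoint N x l m)))%C).
    intros l Hl. apply Clim_scal. unfold phi. apply Clim_minus; [|apply Clim_const].
    apply digamma1_lim_ln, ypoint_slit; auto.
  - apply Clim_ext with (fun M => (-1) ^ (k - 1) * (PI / sin (PI / INR N * (INR k - 1)))%R
      - INR N * (-1) ^ (k - 1) * rho N x m ^ (k - 1) * INR (S m) * csum (bker k N x m) (S M))%C.
    + intros M. rewrite <- csum_cis_harm_ypoint by (auto; lia).
      rewrite (csum_ext (fun l => e l *
        (ln (INR (S M)) - harm (ypoint N x l m) (S M) - Clog (ypoint N x l m)))%C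
        (fun l => ln (INR (S M)) * e l - e l * harm (ypoint N x l m) (S M)
        - e l * Clog (ypoint N x l m))%C) by (intros; ring).
      rewrite !csum_minus, csum_scal, E0, Elog. unfold e. ring.
    + apply Clim_minus; [apply Clim_const|]. apply Clim_scal.
      apply (Clim_incr_1 (csum (bker k N x m))). auto.
Qed.

(** Division by [upoint] turns the weight of index [k - 1] into the one of index [k], whose sum
    vanishes for [k < N]. At [k = N] the weight is the constant [(-1)^(N-1)]. This dichotomy is the
    one of [Bterm]. *)
Lemma csum_cis_inv_upoint (k N : nat) (x : C) : (1 <= k <= N)%nat ->
  csum (fun l => cis (jl N l * (PI * (INR k - 1) / INR N)) / upoint N x l)%C N =
  (xroot N x * if Nat.eq_dec k N then INR N * (-1) ^ (N - 1) else 0)%C.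
Proof.
  intros Hk. assert (HN : 0 < INR N) by (apply lt_0_INR; lia).
  rewrite (csum_ext _ (fun l => xroot N x * cis (jl N l * (PI * IZR (Z.of_nat k) / INR N)))%C).
  - rewrite csum_scal. f_equal. destruct (Nat.eq_dec k N) as [-> | E].
    + rewrite (csum_ext _ (fun _ => ((-1) ^ (N - 1))%C)).
      * apply csum_const.
      * intros l Hl. rewrite <- INR_IZR_INZ.
        replace (jl N l * (PI * INR N / INR N)) with (2 * (IZR (Z.of_nat l) * PI) + - (INR (N - 1) * PI))
          by (rewrite <- INR_IZR_INZ, minus_INR by lia; unfold jl; simpl (INR 1); field; lra).
        rewrite cis_plus, cis_2_PI_IZR, cis_opp, cis_PI_INR.
        assert (Hm : ((-1) ^ (N - 1))%C <> 0%C) by (apply Cpow_nz, RtoC_neq_0; lra).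
        replace ((-1) ^ (N - 1))%C with ((-1) ^ (N - 1) * (-1) ^ (N - 1) / (-1) ^ (N - 1))%C at 2
          by (field; auto).
        rewrite Cpow_m1_sqr. field. auto.
    + rewrite csum_cis_jl by lia. destruct (Z.eq_dec (Z.of_nat k) 0); auto. lia.
  - intros l _. unfold upoint. rewrite cis_opp.
    replace (jl N l * (PI * IZR (Z.of_nat k) / INR N)) with
      (jl N l * (PI * (INR k - 1) / INR N) + jl N l * (PI / INR N))
      by (rewrite <- INR_IZR_INZ; field; lra).
    rewrite cis_plus. field. split; [apply cis_neq_0 | apply xroot_neq_0].
Qed.

Lemma csum_cis_Herglotz_lim (k N : nat) (x : C) : (1 <= k <= N)%nat -> slit_plane x ->
  Clim (fun M => csum (fun m => csum (fun l => cis (jl N l * (PI * (INR k - 1) / INR N)) *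
      phi (ypoint N x l m)) N / Rpower (INR (S m)) ((INR N + INR k - 1) / INR N))%C M)
    (csum (fun l => cis (jl N l * (PI * (INR k - 1) / INR N)) *
      Herglotz ((INR N + INR k - 1) / INR N) (1 / INR N) (upoint N x l)) N
     + Czeta (1 + INR k / INR N)%R *
       (xroot N x * if Nat.eq_dec k N then INR N * (-1) ^ (N - 1) else 0))%C.
Proof.
  intros Hk Hx. assert (HN : 0 < INR N) by (apply lt_0_INR; lia).
  assert (Hk1 : 1 <= INR k) by (apply (le_INR 1); lia).
  assert (Es : (INR N + INR k - 1) / INR N + 1 / INR N = 1 + INR k / INR N) by (field; lra).
  assert (Hs : 1 < 1 + INR k / INR N).
  { assert (0 < INR k / INR N) by (apply Rdiv_lt_0_compat; lra). lra. }
  set (s := (INR N + INR k - 1) / INR N) in *.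
  set (e := fun l => cis (jl N l * (PI * (INR k - 1) / INR N))).
  rewrite <- csum_cis_inv_upoint, <- csum_scal, <- csum_plus by auto.
  apply Clim_ext with (fun M => csum (fun l =>
    e l * csum (fun m => phi (ypoint N x l m) / Rpower (INR (S m)) s) M)%C N).
  - intros M. rewrite (csum_ext (fun m => (csum _ N / _)%C) (fun m =>
      csum (fun l => e l * (phi (ypoint N x l m) / Rpower (INR (S m)) s)) N)%C).
    + rewrite csum_switch. apply csum_ext. intros l _. symmetry. apply csum_scal.
    + intros m _. unfold Cdiv. rewrite Cmult_comm, <- csum_scal. apply csum_ext. intros l _.
      unfold e. ring.
  - apply (Clim_csum (fun l M => e l * csum (fun m => phi (ypoint N x l m) / Rpower (INR (S m)) s) M)%C).
    intros l Hl.
    replace (cis (jl N l * (PI * (INR k - 1) / INR N)) * Herglotz s (1 / INR N) (upoint N x l) +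
      Czeta (1 + INR k / INR N)%R * (cis (jl N l * (PI * (INR k - 1) / INR N)) / upoint N x l))%C
      with (e l * (Herglotz s (1 / INR N) (upoint N x l) + Czeta (s + 1 / INR N)%R / upoint N x l))%C.
    + apply Clim_scal. apply Herglotz_lim; [apply upoint_slit; auto | lra].
    + rewrite Es. unfold e, Cdiv. ring.
Qed.

Lemma Herglotz_nat_lim (k N : nat) (x : C) : (1 <= k)%nat -> (1 <= N)%nat -> slit_plane x ->
  Clim (csum (fun n => phi (INR (S n) ^ N * x) / INR (S n) ^ k)%C)
    (Herglotz (INR k) (INR N) x + Czeta (INR k + INR N)%R / x)%C.
Proof.
  intros Hk HN Hx. apply (le_INR 1) in Hk, HN. simpl in Hk, HN.
  apply Clim_ext with (2 := Herglotz_lim (INR k) (INR N) x Hx ltac:(lra)).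
  intros M. apply csum_ext. intros n _. rewrite !Rpower_INR_S, !RtoC_pow. reflexivity.
Qed.

(** Both series contain the same double sum [S0]: the first one, multiplied by [X], contributes
    [X S0], the second one [- N (-1)^(k-1) X S0]. The prefactor [- (-1)^k / N] makes them cancel. *)
Lemma herglotz_transform (k N : nat) (x : C) : (1 < k <= N)%nat -> slit_plane x ->
  (/ xroot N x ^ (k - 1) * (Herglotz (INR k) (INR N) x + Czeta (INR k + INR N)%R / x)
   - (-1) ^ k / INR N *
     (csum (fun l => cis (jl N l * (PI * (INR k - 1) / INR N)) *
        Herglotz ((INR N + INR k - 1) / INR N) (1 / INR N) (upoint N x l)) N
      + Czeta (1 + INR k / INR N)%R *
        (xroot N x * if Nat.eq_dec k N then INR N * (-1) ^ (N - 1) else 0))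
   = PI / INR N * (Czeta (1 + (INR k - 1) / INR N)%R / sin (PI / INR N * (INR k - 1))%R)
     + / xroot N x ^ (k - 1) *
       (- ((euler_gamma + Clog x) * Czeta (INR k)) + INR N * C_derive Czeta (INR k)))%C.
Proof.
  intros Hk Hx. assert (HN : 0 < INR N) by (apply lt_0_INR; lia).
  assert (Hk2 : 2 <= INR k) by (apply (le_INR 2); lia).
  assert (Ep : INR k - 1 = INR (k - 1)) by (rewrite minus_INR by lia; reflexivity).
  set (X := (/ xroot N x ^ (k - 1))%C).
  destruct (bker_bound k N x Hk Hx) as [K [HK Hb]].
  destruct (csum_dominated_interchange (bker k N x) _ _
    (fun m => Rmult_le_pos _ _ HK (Rlt_le _ _ (Rpower_pos (INR (S m)) (- (1 + (INR k - 3 / 2) / INR N)))))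
    (fun n => Rlt_le _ _ (Rpower_pos (INR (S n)) (- (3 / 2))))) as [B1 [B2 [S0 [H1 [H2 [H3 H4]]]]]].
  - apply ex_series_Rscal_l, ex_series_Rpower.
    assert (0 < (INR k - 3 / 2) / INR N) by (apply Rdiv_lt_0_compat; lra). lra.
  - apply ex_series_Rpower. lra.
  - exact Hb.
  - assert (EA : (Herglotz (INR k) (INR N) x + Czeta (INR k + INR N)%R / x)%C =
      (S0 - (euler_gamma + Clog x) * Czeta (INR k) - INR N * - C_derive Czeta (INR k))%C).
    { apply Clim_unique with (csum (fun n => phi (INR (S n) ^ N * x) / INR (S n) ^ k)%C).
      - apply Herglotz_nat_lim; auto; lia.
      - apply Clim_ext with (fun M => csum B2 M
          - (euler_gamma + Clog x) * csum (fun n => RtoC (Rpower (INR (S n)) (- INR k))) M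
          - INR N * csum (fun n => RtoC (ln (INR (S n)) * Rpower (INR (S n)) (- INR k))) M)%C.
        + intros M. rewrite <- !csum_scal, <- !csum_minus. apply csum_ext. intros n _.
          rewrite (phi_left_row k N x n (B2 n)) by (auto; lia).
          rewrite RtoC_mult, Rpower_Ropp, Rpower_INR_S, RtoC_inv, RtoC_pow; auto.
          apply pow_nonzero. generalize (INR_S_pos n). lra.
        + apply Clim_minus; [apply Clim_minus|]; auto; apply Clim_scal.
          * apply Czeta_lim. lra.
          * apply C_derive_Czeta_lim. auto. }
    set (W := (csum (fun l => cis (jl N l * (PI * (INR k - 1) / INR N)) *
        Herglotz ((INR N + INR k - 1) / INR N) (1 / INR N) (upoint N x l)) N
      + Czeta (1 + INR k / INR N)%R *
        (xroot N x * if Nat.eq_dec k N then INR N * (-1) ^ (N - 1) else 0))%C).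
    set (q := PI / sin (PI / INR N * (INR k - 1))).
    assert (EW : W = ((-1) ^ (k - 1) * q * Czeta (1 + (INR k - 1) / INR N)%R
      - INR N * (-1) ^ (k - 1) * X * S0)%C).
    { apply Clim_unique with (1 := csum_cis_Herglotz_lim k N x ltac:(lia) Hx).
      apply Clim_ext with (fun M => (-1) ^ (k - 1) * q *
          csum (fun m => RtoC (Rpower (INR (S m)) (- (1 + (INR k - 1) / INR N)))) M
        - INR N * (-1) ^ (k - 1) * X * csum B1 M)%C.
      - intros M. rewrite <- !csum_scal, <- csum_minus. apply csum_ext. intros m _.
        rewrite (csum_cis_phi_ypoint k N x m (B1 m)) by auto. fold q.
        assert (Hm := INR_S_pos m).
        replace ((INR N + INR k - 1) / INR N) with (1 + (INR k - 1) / INR N) by (field; lra).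
        assert (Hpp := Rpower_pos (INR (S m)) (1 + (INR k - 1) / INR N)).
        rewrite Rpower_Ropp, RtoC_inv by lra.
        (* The power [m^(1 + (k-1)/N)] produced by [rho] and by the factor [m] is exactly the
           denominator of the Herglotz series of order [(N + k - 1) / N]. *)
        assert (Er : (rho N x m ^ (k - 1) * INR (S m))%C =
          (X * Rpower (INR (S m)) (1 + (INR k - 1) / INR N))%C).
        { unfold rho, X, Cdiv. rewrite Cpow_mult_l, Cpow_inv by apply xroot_neq_0.
          rewrite <- RtoC_pow, <- Rpower_pow, Rpower_mult by apply Rpower_pos.
          rewrite Rpower_plus, Rpower_1, RtoC_mult by auto. rewrite <- Ep.
          replace (1 / INR N * (INR k - 1)) with ((INR k - 1) / INR N) by (field; lra). ring. }
        replace (INR N * (-1) ^ (k - 1) * rho N x m ^ (k - 1) * INR (S m) * B1 m)%C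
          with (INR N * (-1) ^ (k - 1) * (rho N x m ^ (k - 1) * INR (S m)) * B1 m)%C by ring.
        rewrite Er. field. apply RtoC_neq_0; lra.
      - apply Clim_minus; apply Clim_scal; auto. apply Czeta_lim.
        assert (0 < (INR k - 1) / INR N) by (apply Rdiv_lt_0_compat; lra). lra. }
    rewrite EA, EW.
    assert (Em : ((-1) ^ k)%C = (- (-1) ^ (k - 1))%C).
    { replace k with (S (k - 1)) at 1 by lia. rewrite Cpow_S. ring. }
    assert (Hs : sin (PI / INR N * (INR k - 1)) <> 0).
    { rewrite Ep, (INR_IZR_INZ (k - 1)).
      replace (PI / INR N * IZR (Z.of_nat (k - 1))) with (PI * IZR (Z.of_nat (k - 1)) / INR N)
        by (unfold Rdiv; ring).
      apply sin_PI_frac_neq_0; lia. }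
    rewrite Em. unfold q. rewrite RtoC_div by auto.
    set (e := ((-1) ^ (k - 1))%C). assert (Ee : (e * e)%C = 1) by apply Cpow_m1_sqr.
    set (sn := RtoC (sin (PI / INR N * (INR k - 1)))).
    assert (Hsn : sn <> 0%C) by (apply RtoC_neq_0; auto).
    set (Z1 := Czeta (1 + (INR k - 1) / INR N)%R).
    assert (HNC : RtoC (INR N) <> 0%C) by (apply RtoC_neq_0; lra).
    replace (- e / INR N * (e * (PI / sn) * Z1 - INR N * e * X * S0))%C
      with ((e * e) * (- (PI / sn * Z1 / INR N) + X * S0))%C by (field; auto).
    rewrite Ee. field. auto.
Qed.

(** * A dilogarithm identity through Riemann sums *)

(** The difference [log (z + t) - log (1 + t/z)] has derivative zero on [[0, 1]] and equals [log z]
    at [t = 0], so no arguments have to be compared. *)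
Lemma Clog_1_plus_inv (z : C) : slit_plane z ->
  (Clog (1 + z) - Clog (1 + / z))%C = Clog z.
Proof.
  intros Hz. assert (Hi := slit_plane_inv z Hz). assert (Hz0 := slit_plane_neq_0 z Hz).
  set (f := fun t : R => (Clog (z + t) - Clog (1 + t * / z))%C).
  assert (E : f 1 = f 0).
  { apply Cderiv_0_const. intros t. rewrite Rmin_left, Rmax_right by lra. intros Ht.
    assert (H1 : slit_plane (z + t)%C) by (apply slit_plane_plus; auto; lra).
    assert (H2 : slit_plane (1 + t * / z)%C) by (apply slit_plane_affine; auto; lra).
    eapply Cderiv_eq.
    - apply Cderiv_minus; [apply Cderiv_Clog_line; auto|].
      apply (Cderiv_Clog (fun t : R => 1 + t * / z)%C t (/ z)%C); auto.
      eapply Cderiv_eq.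
      + apply Cderiv_plus; [apply Cderiv_const|].
        apply Cderiv_mult; [apply Cderiv_id | apply Cderiv_const].
      + cbv beta; ring.
    - apply slit_plane_neq_0 in H1, H2. field. repeat split; auto. }
  unfold f in E. rewrite Cmult_1_l, Cmult_0_l, !Cplus_0_r, (Cplus_comm z 1) in E.
  rewrite E, Clog_RtoC, ln_1 by lra. ring.
Qed.

Lemma csum_jl_0 (N : nat) : csum (fun l => RtoC (jl N l)) N = 0.
Proof.
  rewrite csum_RtoC. f_equal.
  assert (H : forall M, rsum (jl N) M = INR M * (INR M - INR N)).
  { intros M. induction M; simpl rsum; [simpl; ring|]. rewrite IHM. unfold jl. rewrite S_INR. ring. }
  rewrite H. ring.
Qed.

Lemma cis_jl_k1 (N l : nat) : cis (jl N l * (PI * (INR 1 - 1) / INR N)) = 1.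
Proof.
  replace (jl N l * (PI * (INR 1 - 1) / INR N)) with 0 by (simpl; unfold Rdiv; ring). apply cis_0.
Qed.

Lemma Clog_INR_div (x : C) (m : nat) : slit_plane x ->
  Clog (INR (S m) / x) = (ln (INR (S m)) - Clog x)%C.
Proof.
  intros Hx. unfold Cdiv. rewrite Clog_scal, Clog_inv; auto using INR_S_pos, slit_plane_inv.
Qed.

(** The additive form of the factorisation of [t^N + m/x], with principal logarithms on both sides.
    The derivatives in [t] agree by the partial fractions with [k = 1], so only the value at [t = 0]
    has to be compared. *)
Lemma csum_Clog_ypoint (N : nat) (x : C) (m : nat) (t : R) :
  (1 <= N)%nat -> slit_plane x -> 0 <= t ->
  csum (fun l => Clog (ypoint N x l m + t)) N = Clog (INR (S m) / x + (t ^ N)%R).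
Proof.
  intros HN Hx Ht. assert (HN0 : 0 < INR N) by (apply lt_0_INR; lia).
  set (f := fun t : R => (csum (fun l => Clog (ypoint N x l m + t)) N
    - Clog (INR (S m) / x + (t ^ N)%R))%C).
  assert (Hslit : forall s, 0 <= s -> slit_plane (INR (S m) / x + (s ^ N)%R)%C).
  { intros s Hs. apply slit_plane_plus; [apply pow_le; auto|].
    apply slit_plane_scal; auto using INR_S_pos, slit_plane_inv. }
  assert (E : f t = f 0).
  { apply Cderiv_0_const. intros s. rewrite Rmin_left, Rmax_right by lra. intros Hs.
    eapply Cderiv_eq.
    - apply Cderiv_minus.
      + apply (Cderiv_csum (fun l s => Clog (ypoint N x l m + s))
          (fun l => / (ypoint N x l m + s))%C).
        intros l Hl. apply Cderiv_Clog_line, slit_plane_plus; [lra|]. apply ypoint_slit; auto.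
      + apply (Cderiv_comp (fun s => Clog (INR (S m) / x + s)%C) (fun s => s ^ N) s).
        * apply Cderiv_Clog_line, Hslit. lra.
        * instantiate (1 := INR N * s ^ (N - 1)). auto_derive; auto.
          rewrite Rmult_1_l. do 2 f_equal. lia.
    - rewrite (csum_ext _ (fun l => cis (jl N l * (PI * (INR 1 - 1) / INR N)) /
        (s + ypoint N x l m))%C).
      + rewrite csum_cis_inv_ypoint by (auto; try lia; lra).
        assert (H := slit_plane_neq_0 _ (Hslit s (proj1 Hs))).
        rewrite Cplus_comm, !RtoC_pow in H. rewrite (Cplus_comm (INR (S m) / x)).
        rewrite RtoC_mult, !RtoC_pow. unfold Nat.sub at 1 2. fold Nat.sub. simpl (Cpow _ 0).
        unfold Cdiv. ring.
      + intros l _. rewrite cis_jl_k1. unfold Cdiv. rewrite Cmult_1_l. f_equal. ring. }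
  (* At [t = 0] both sides equal [ln m - log x]: the phases [- PI j / N] cancel because the [j] sum
     to zero. *)
  apply Ceq_minus. fold (f t). rewrite E. unfold f.
  rewrite pow_i by lia. rewrite Cplus_0_r, Clog_INR_div by auto.
  rewrite (csum_ext _ (fun l => ((1 / INR N * ln (INR (S m)))%R - (1 / INR N)%R * Clog x)
    - Ci * (PI / INR N)%R * jl N l)%C).
  - rewrite csum_minus, csum_const, (csum_scal _ (fun l => RtoC (jl N l))), csum_jl_0.
    rewrite RtoC_mult, RtoC_div by lra. field. apply RtoC_neq_0; lra.
  - intros l Hl. rewrite Cplus_0_r, Clog_ypoint by auto. unfold ulog. rewrite (RtoC_mult (jl N l)). ring.
Qed.

(** Riemann sums for the integrals over [[0, 1]] of [log (1 + u^N x) / u] and of [1/N] times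
    [log (1 + u/x) / u], that is for [- (Li2 (- x) + Li2 (- 1/x)) / N]. The limit in [Tsum_lim] is
    thus the inversion formula of the dilogarithm. *)
Definition Tsum (N P : nat) (x : C) : C :=
  (csum (fun i => / INR (S i) * Clog (1 + ((INR (S i) / INR P) ^ N)%R * x)) P
   + / INR N * csum (fun i => / INR (S i) * Clog (1 + (INR (S i) / INR (P ^ N))%R * / x)) (P ^ N))%C.

(** The remainder bound for [digamma1] is applied at [n] and at [0]; the limit itself drops out, and
    each use contributes half of the factor 2. *)
Lemma harm_remainder (c : R) (y : C) (n : nat) : slit_plane y -> cone_bound c y ->
  Cmod (harm y n - (Clog (y + INR n) - Clog y)) <= 2 * (/ (c * c) * / Cmod y).
Proof.
  intros Hy Hc. assert (Hm := slit_plane_Cmod_pos y Hy). assert (Hc0 := proj1 Hc).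
  destruct (digamma1_lim_remainder c y Hy Hc) as [_ H].
  assert (H0 := H 0%nat). assert (Hn := H n).
  simpl (INR 0) in H0. rewrite Rplus_0_r, Cplus_0_r in H0. unfold harm at 1 in H0. simpl csum in H0.
  replace (harm y n - (Clog (y + INR n) - Clog y))%C with
    ((digamma1 y - (Clog (y + INR n) - harm y n)) - (digamma1 y - (Clog y - 0)))%C by ring.
  eapply Rle_trans; [apply Cmod_triangle|]. rewrite Cmod_opp.
  assert (Hinv : / (Cmod y + INR n) <= / Cmod y).
  { apply Rinv_le_contravar; auto. generalize (pos_INR n). lra. }
  assert (Hcc : 0 < / (c * c)) by (apply Rinv_0_lt_compat; nra).
  apply (Rmult_le_compat_l (/ (c * c))) in Hinv; lra.
Qed.

Lemma INR_pow (P N : nat) : INR (P ^ N) = INR P ^ N.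
Proof. apply pow_INR. Qed.

Lemma pow_pos_nat (p N : nat) : (0 < S p ^ N)%nat.
Proof. apply Nat.neq_0_lt_0, Nat.pow_nonzero. lia. Qed.

Lemma le_pow_nat (p N : nat) : (1 <= N)%nat -> (S p <= S p ^ N)%nat.
Proof. intros H. rewrite <- (Nat.pow_1_r (S p)) at 1. apply Nat.pow_le_mono_r; lia. Qed.

(* The partial fraction expansion turns the first sum into harmonic sums at the [N] points
   [ypoint]; the second one is a harmonic sum already. *)
Lemma Tsum_derivative_sums (N p : nat) (z : C) : (1 <= N)%nat -> slit_plane z ->
  csum (fun i => / INR (S i) * (((INR (S i) / INR (S p)) ^ N)%R * z /
    (1 + ((INR (S i) / INR (S p)) ^ N)%R * z)))%C (S p)
  = (/ INR N * csum (fun l => harm (ypoint N z l (S p ^ N - 1)) (S p)) N)%C /\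
  csum (fun i => / INR (S i) * ((INR (S i) / INR (S p ^ N))%R * / z /
    (1 + (INR (S i) / INR (S p ^ N))%R * / z)))%C (S p ^ N)
  = harm (INR (S p ^ N) * z) (S p ^ N).
Proof.
  intros HN Hz. assert (HN0 : 0 < INR N) by (apply lt_0_INR; lia).
  assert (Hz0 := slit_plane_neq_0 z Hz).
  assert (HQ := pow_pos_nat p N). assert (HQR : 0 < INR (S p ^ N)) by (apply lt_0_INR; auto).
  assert (HQC : RtoC (INR (S p ^ N)) <> 0%C) by (apply RtoC_neq_0; lra).
  (* Row indices of [ypoint] and [bker] are shifted by one, so [S p ^ N - 1] stands for
     [m = P^N]. *)
  assert (EQ : S (S p ^ N - 1) = (S p ^ N)%nat) by lia.
  split.
  - rewrite (csum_ext (fun l => harm (ypoint N z l (S p ^ N - 1)) (S p))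
      (fun l => cis (jl N l * (PI * (INR 1 - 1) / INR N)) * harm (ypoint N z l (S p ^ N - 1)) (S p))%C)
      by (intros; rewrite cis_jl_k1; ring).
    rewrite csum_cis_harm_ypoint by (auto; lia). rewrite EQ.
    replace (/ INR N * (INR N * (-1) ^ (1 - 1) * rho N z (S p ^ N - 1) ^ (1 - 1) * INR (S p ^ N) *
      csum (bker 1 N z (S p ^ N - 1)) (S p)))%C with
      (INR (S p ^ N) * csum (bker 1 N z (S p ^ N - 1)) (S p))%C
      by (simpl (1 - 1)%nat; simpl (Cpow _ 0); field; apply RtoC_neq_0; lra).
    rewrite <- csum_scal. apply csum_ext. intros i _.
    assert (Hi := INR_S_pos i).
    assert (HiC : RtoC (INR (S i)) <> 0%C) by (apply RtoC_neq_0; lra).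
    replace ((INR (S i) / INR (S p)) ^ N) with (INR (S i) ^ N / INR (S p ^ N))
      by (unfold Rdiv; rewrite Rpow_mult_distr, pow_inv, INR_pow; reflexivity).
    unfold bker. rewrite EQ.
    assert (Hd : (1 + (INR (S i) ^ N / INR (S p ^ N))%R * z)%C <> 0%C).
    { apply slit_plane_neq_0, slit_plane_affine; auto; try lra.
      - apply Rlt_le, Rdiv_lt_0_compat; auto. apply pow_lt; auto.
      - assert (0 < INR (S i) ^ N / INR (S p ^ N)); [|lra].
        apply Rdiv_lt_0_compat; auto. apply pow_lt; auto. }
    rewrite RtoC_div, RtoC_pow in * by lra.
    assert (Hd2 : (INR (S p ^ N) + INR (S i) ^ N * z)%C <> 0%C).
    { intros E. apply Hd.
      replace (1 + INR (S i) ^ N / INR (S p ^ N) * z)%C with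
        ((INR (S p ^ N) + INR (S i) ^ N * z) / INR (S p ^ N))%C by (field; auto).
      rewrite E. unfold Cdiv; ring. }
    replace (INR (S i) ^ N)%C with (INR (S i) * INR (S i) ^ (N - 1))%C in *
      by (rewrite <- Cpow_S; f_equal; lia).
    field. repeat split; auto. rewrite Cplus_comm. auto.
  - unfold harm. apply csum_ext. intros i _.
    assert (Hi := INR_S_pos i).
    assert (HiC : RtoC (INR (S i)) <> 0%C) by (apply RtoC_neq_0; lra).
    assert (Hd : (INR (S p ^ N) * z + INR (S i))%C <> 0%C).
    { apply slit_plane_neq_0, slit_plane_plus; [lra|]. apply slit_plane_scal; auto. }
    rewrite RtoC_div by lra. field. repeat split; auto.
Qed.

(** Every harmonic sum is a difference of logarithms up to [2 B]. By [csum_Clog_ypoint] and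
    [Clog_1_plus_inv] these logarithms cancel against [log z], and [N + 1] errors of [2 B] divided
    by [N] are at most [4 B]. *)
Lemma Cmod_csum_harm_bound (N p : nat) (z : C) (c e0 : R) : (1 <= N)%nat -> slit_plane z ->
  0 < e0 -> e0 <= Cmod z ->
  (forall l, (l < N)%nat -> cone_bound c (upoint N z l) /\ e0 <= Cmod (upoint N z l)) ->
  cone_bound c z ->
  Cmod (/ INR N * csum (fun l => harm (ypoint N z l (S p ^ N - 1)) (S p)) N
    - / INR N * harm (INR (S p ^ N) * z) (S p ^ N) - / INR N * Clog z)
  <= 4 * / (c * c * e0) * / INR (S p).
Proof.
  intros HN Hz He Hez Hu Hcz.
  assert (HN0 : 1 <= INR N) by (apply (le_INR 1); lia).
  assert (HP := INR_S_pos p). assert (Hc0 := proj1 Hcz).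
  assert (HQ : INR (S p) <= INR (S p ^ N)) by (apply le_INR, le_pow_nat; auto).
  assert (EQ : S (S p ^ N - 1) = (S p ^ N)%nat) by (generalize (pow_pos_nat p N); lia).
  (* The points [ypoint] with [m = P^N] have modulus of order [P], the length of their harmonic
     sums: the two truncation bounds are matched for this purpose. *)
  assert (Hroot : Rpower (INR (S p ^ N)) (1 / INR N) = INR (S p)).
  { rewrite INR_pow, <- Rpower_pow, Rpower_mult by auto.
    replace (INR N * (1 / INR N)) with 1 by (field; lra). apply Rpower_1; auto. }
  set (Q := INR (S p ^ N)) in *. set (P := INR (S p)) in *.
  assert (HQ0 : 0 < Q) by lra.
  set (B := / (c * c * e0) * / P).
  assert (HB : forall y : C, e0 * P <= Cmod y -> 2 * (/ (c * c) * / Cmod y) <= 2 * B).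
  { intros y Hy. unfold B. apply Rmult_le_compat_l; [lra|].
    replace (/ (c * c * e0) * / P) with (/ (c * c) * / (e0 * P)).
    - apply Rmult_le_compat_l; [apply Rlt_le, Rinv_0_lt_compat; nra|].
      apply Rinv_le_contravar; auto. nra.
    - rewrite !Rinv_mult. ring. }
  assert (Hlogs : csum (fun l => Clog (ypoint N z l (S p ^ N - 1) + INR (S p))
      - Clog (ypoint N z l (S p ^ N - 1)))%C N = (Clog (1 + / z) + Clog z)%C).
  { rewrite csum_minus, csum_Clog_ypoint by (auto; fold P; lra).
    rewrite (csum_ext (fun l => Clog (ypoint N z l (S p ^ N - 1)))
      (fun l => Clog (ypoint N z l (S p ^ N - 1) + 0))) by (intros; rewrite Cplus_0_r; auto).
    rewrite csum_Clog_ypoint by (auto; lra).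
    rewrite pow_i, Cplus_0_r, EQ by lia. fold P Q. unfold P. rewrite <- INR_pow. fold Q.
    replace (Q / z + Q)%C with (Q * (1 + 1 * / z))%C
      by (field; apply slit_plane_neq_0; auto).
    unfold Cdiv. rewrite !Clog_scal, Clog_inv, Cmult_1_l; auto using slit_plane_inv.
    - ring.
    - apply (slit_plane_affine (/ z)%C 1 1); auto using slit_plane_inv; lra. }
  assert (Hlogz : (Clog (Q * z + Q) - Clog (Q * z))%C = (Clog (1 + z) - Clog z)%C).
  { replace (Q * z + Q)%C with (Q * (1 + 1 * z))%C by ring.
    rewrite !Clog_scal, Cmult_1_l; auto.
    - ring.
    - apply (slit_plane_affine z 1 1); auto; lra. }
  assert (Hh1 : Cmod (csum (fun l => harm (ypoint N z l (S p ^ N - 1)) (S p)) N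
    - (Clog (1 + / z) + Clog z)) <= INR N * (2 * B)).
  { rewrite <- Hlogs, <- csum_minus, <- rsum_const. apply Cmod_csum_le. intros l Hl.
    destruct (Hu l Hl) as [Hcu Heu].
    eapply Rle_trans; [apply (harm_remainder c)|].
    - apply ypoint_slit; auto.
    - apply cone_bound_scal; auto using Rpower_pos.
    - apply HB. unfold ypoint. rewrite EQ. fold Q. rewrite Hroot, Cmod_mult, Cmod_RtoC_pos by lra. nra. }
  assert (Hh2 : Cmod (harm (Q * z) (S p ^ N) - (Clog (1 + z) - Clog z)) <= 2 * B).
  { rewrite <- Hlogz. eapply Rle_trans; [apply (harm_remainder c)|].
    - apply slit_plane_scal; auto.
    - apply cone_bound_scal; auto.
    - apply HB. rewrite Cmod_mult, Cmod_RtoC_pos by lra. nra. }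
  assert (HNC : RtoC (INR N) <> 0%C) by (apply RtoC_neq_0; lra).
  replace (/ INR N * csum (fun l => harm (ypoint N z l (S p ^ N - 1)) (S p)) N
    - / INR N * harm (Q * z) (S p ^ N) - / INR N * Clog z)%C with
    (/ INR N * ((csum (fun l => harm (ypoint N z l (S p ^ N - 1)) (S p)) N - (Clog (1 + / z) + Clog z))
      - (harm (Q * z) (S p ^ N) - (Clog (1 + z) - Clog z))))%C.
  2:{ rewrite <- (Clog_1_plus_inv z Hz). ring. }
  rewrite Cmod_mult, Cmod_inv, Cmod_RtoC_pos by (auto; lra).
  assert (HB0 : 0 <= B).
  { unfold B. apply Rmult_le_pos; apply Rlt_le, Rinv_0_lt_compat; auto.
    repeat apply Rmult_lt_0_compat; lra. }
  apply Rmult_le_reg_l with (INR N); [lra|].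
  rewrite <- Rmult_assoc, Rinv_r, Rmult_1_l by lra.
  eapply Rle_trans; [apply Cmod_triangle|]. rewrite Cmod_opp.
  rewrite (Rmult_assoc 4). fold B. nra.
Qed.

(* Along [s -> exp (s log x)] the derivative of [Tsum] tends to [s (log x)^2 / N]. *)
Lemma Tsum_path (N : nat) (x : C) : (1 <= N)%nat -> slit_plane x ->
  exists K, forall p, Cmod (Tsum N (S p) x - Tsum N (S p) 1 - Clog x * Clog x / (2 * INR N))
    <= K * / INR (S p).
Proof.
  intros HN Hx. assert (HN0 : 1 <= INR N) by (apply (le_INR 1); lia).
  assert (HNC : RtoC (INR N) <> 0%C) by (apply RtoC_neq_0; lra).
  assert (H2C : RtoC 2 <> 0%C) by (apply RtoC_neq_0; lra).
  assert (HPI := PI_RGT_0).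
  set (L := Clog x). assert (HL : Rabs (Im L) < PI) by (apply Im_Clog_bound; auto).
  (* [alpha] bounds the argument of [z s] and of all its points [upoint] along the whole path, and
     stays below [PI]; likewise [e0] below bounds their moduli from below. Together they make the
     error uniform in [s]. *)
  set (alpha := (Rabs (Im L) + (INR N - 1) * PI) / INR N).
  assert (Halpha : alpha < PI).
  { unfold alpha. apply Rmult_lt_reg_r with (INR N); [lra|].
    unfold Rdiv. rewrite Rmult_assoc, Rinv_l by lra. nra. }
  assert (Halpha2 : Rabs (Im L) <= alpha).
  { unfold alpha. apply Rmult_le_reg_r with (INR N); [lra|].
    unfold Rdiv. rewrite Rmult_assoc, Rinv_l by lra. nra. }
  set (c := (1 + cos alpha) / 2). set (e0 := exp (- Rabs (Re L))).
  assert (He0 : 0 < e0) by apply exp_pos.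
  set (z := fun s : R => Cexp (s * L)).
  assert (Hbd : forall s, 0 <= s <= 1 -> Rabs (Im (s * L)) <= Rabs (Im L) /\
    Rabs (Re (s * L)) <= Rabs (Re L)).
  { intros s Hs. rewrite im_scal_l, re_scal_l, !Rabs_mult, (Rabs_pos_eq s) by lra.
    assert (H1 := Rabs_pos (Im L)). assert (H2 := Rabs_pos (Re L)). split; nra. }
  assert (Hzs : forall s, 0 <= s <= 1 -> slit_plane (z s)).
  { intros s Hs. apply slit_plane_Cexp. generalize (proj1 (Hbd s Hs)). lra. }
  assert (Hlz : forall s, 0 <= s <= 1 -> Clog (z s) = (s * L)%C).
  { intros s Hs. apply Clog_Cexp. generalize (proj1 (Hbd s Hs)). lra. }
  assert (Hexp : forall a, Rabs a <= Rabs (Re L) -> e0 <= exp a).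
  { intros a Ha. assert (Hle : - Rabs (Re L) <= a).
    { generalize (Rle_abs (- a)). rewrite Rabs_Ropp. lra. }
    unfold e0. destruct Hle as [Hlt | ->]; [apply Rlt_le, exp_increasing; auto | lra]. }
  assert (Hzc : forall s, 0 <= s <= 1 -> cone_bound c (z s) /\ e0 <= Cmod (z s)).
  { intros s Hs. destruct (Hbd s Hs) as [H1 H2]. split.
    - apply cone_bound_Cexp; auto. lra.
    - unfold z. rewrite Cmod_Cexp. apply Hexp; auto. }
  assert (Hzu : forall s l, 0 <= s <= 1 -> (l < N)%nat ->
    cone_bound c (upoint N (z s) l) /\ e0 <= Cmod (upoint N (z s) l)).
  { intros s l Hs Hl. destruct (Hbd s Hs) as [H1 H2].
    rewrite upoint_Cexp. unfold ulog. rewrite Hlz by auto.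
    set (w := (s * L)%C) in *.
    assert (Hj : - (INR N - 1) <= jl N l <= INR N - 1).
    { unfold jl. assert (Hl0 := pos_INR l). assert (Hl1 : INR (S l) <= INR N) by (apply le_INR; lia).
      rewrite S_INR in Hl1. lra. }
    split.
    - apply cone_bound_Cexp; auto.
      rewrite im_minus.
      replace (Im (- ((1 / INR N)%R * w))) with (- (1 / INR N * Im w))
        by (unfold Copp; simpl; unfold Re, Im; ring).
      replace (Im (Ci * (jl N l * (PI / INR N))%R)) with (jl N l * (PI / INR N)) by (simpl; ring).
      replace (- (1 / INR N * Im w) - jl N l * (PI / INR N))
        with ((- Im w - jl N l * PI) / INR N) by (field; lra).
      unfold alpha, Rdiv. rewrite Rabs_mult, (Rabs_pos_eq (/ INR N))
        by (apply Rlt_le, Rinv_0_lt_compat; lra).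
      apply Rmult_le_compat_r; [apply Rlt_le, Rinv_0_lt_compat; lra|].
      assert (H3 : Rabs (Im w) <= Rabs (Im L)) by auto.
      apply Rabs_le_between in H3.
      apply Rabs_le. nra.
    - rewrite Cmod_Cexp. apply Hexp.
      rewrite re_minus.
      replace (Re (- ((1 / INR N)%R * w))) with (- (1 / INR N * Re w))
        by (unfold Copp; simpl; unfold Re, Im; ring).
      replace (Re (Ci * (jl N l * (PI / INR N))%R)) with 0 by (simpl; ring).
      rewrite Rminus_0_r, Rabs_Ropp, Rabs_mult.
      assert (H4 : 0 < 1 / INR N <= 1).
      { split; [apply Rdiv_lt_0_compat; lra|]. unfold Rdiv. rewrite Rmult_1_l.
        rewrite <- Rinv_1. apply Rinv_le_contravar; lra. }
      rewrite (Rabs_pos_eq (1 / INR N)) by lra. generalize (Rabs_pos (Re w)). nra. }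
  exists (Cmod L * (4 * / (c * c * e0))). intros p.
  assert (HP := INR_S_pos p).
  assert (HQ : 0 < INR (S p ^ N)) by (apply lt_0_INR, pow_pos_nat).
  (* The inverse of [z s] is written [Cexp (s * (- L))], so that both sums are differentiated by the
     same rule [Hd2]. The last term removes the expected limit [s L^2 / N] from the derivative. *)
  set (f := fun s : R => (csum (fun i => / INR (S i) *
        Clog (1 + ((INR (S i) / INR (S p)) ^ N)%R * z s)) (S p)
      + / INR N * csum (fun i => / INR (S i) *
        Clog (1 + (INR (S i) / INR (S p ^ N))%R * Cexp (s * (- L)))) (S p ^ N)
      - s * s * (L * L / (2 * INR N)))%C).
  assert (Hinvz : forall s : R, Cexp (s * (- L)) = (/ z s)%C).
  { intros s. unfold z. rewrite <- Cexp_opp. f_equal. ring. }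
  set (df := fun s : R => (L * (
      csum (fun i => / INR (S i) * (((INR (S i) / INR (S p)) ^ N)%R * z s /
        (1 + ((INR (S i) / INR (S p)) ^ N)%R * z s))) (S p)
      - / INR N * csum (fun i => / INR (S i) * ((INR (S i) / INR (S p ^ N))%R * / z s /
        (1 + (INR (S i) / INR (S p ^ N))%R * / z s))) (S p ^ N) - / INR N * Clog (z s)))%C).
  replace (Tsum N (S p) x - Tsum N (S p) 1 - L * L / (2 * INR N))%C with (f 1 - f 0)%C.
  2:{ unfold f, Tsum. rewrite !Hinvz.
      assert (E1 : z 1 = x) by (unfold z; rewrite Cmult_1_l; apply Cexp_Clog; auto).
      assert (E0 : z 0 = 1) by (unfold z; rewrite Cmult_0_l; apply Cexp_0).
      rewrite E1, E0. ring. }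
  set (K := Cmod L * (4 * / (c * c * e0)) * / INR (S p)).
  replace K with (K * Rabs (1 - 0)) by (rewrite Rminus_0_r, Rabs_R1; ring).
  apply Cmod_mean_value with df; intros s; rewrite Rmin_left, Rmax_right by lra; intros Hs.
  - assert (Hd1 : forall w : C, Cderiv (fun s : R => Cexp (s * w)) s (w * Cexp (s * w))%C).
    { intros w. apply (Cderiv_Cexp (fun s : R => s * w)%C). eapply Cderiv_eq.
      - apply Cderiv_mult; [apply Cderiv_id | apply Cderiv_const].
      - cbv beta; ring. }
    assert (Hd2 : forall (a : R) (w : C), 0 <= a -> slit_plane (Cexp (s * w)) ->
      Cderiv (fun s : R => Clog (1 + a * Cexp (s * w))) s
        (w * (a * Cexp (s * w) / (1 + a * Cexp (s * w))))%C).
    { intros a w Ha Hsl. assert (Hsl2 : slit_plane (1 + a * Cexp (s * w))%C)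
        by (apply slit_plane_affine; auto; lra).
      eapply Cderiv_eq.
      - apply (Cderiv_Clog (fun s : R => 1 + a * Cexp (s * w))%C); auto.
        apply Cderiv_plus; [apply Cderiv_const|]. apply Cderiv_scal, Hd1.
      - apply slit_plane_neq_0 in Hsl2. field. auto. }
    eapply Cderiv_eq.
    + unfold f. apply Cderiv_minus; [apply Cderiv_plus|].
      * apply (Cderiv_csum (fun i s => / INR (S i) *
          Clog (1 + ((INR (S i) / INR (S p)) ^ N)%R * z s))%C
          (fun i => / INR (S i) * (L * (((INR (S i) / INR (S p)) ^ N)%R * z s /
            (1 + ((INR (S i) / INR (S p)) ^ N)%R * z s))))%C).
        intros i _. apply Cderiv_scal, Hd2; [|apply Hzs; auto].
        apply pow_le, Rlt_le, Rdiv_lt_0_compat; auto using INR_S_pos.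
      * apply Cderiv_scal, (Cderiv_csum (fun i s => / INR (S i) *
          Clog (1 + (INR (S i) / INR (S p ^ N))%R * Cexp (s * (- L))))%C
          (fun i => / INR (S i) * (- L * ((INR (S i) / INR (S p ^ N))%R * Cexp (s * (- L)) /
            (1 + (INR (S i) / INR (S p ^ N))%R * Cexp (s * (- L))))))%C).
        intros i _. apply Cderiv_scal, Hd2.
        -- apply Rlt_le, Rdiv_lt_0_compat; auto using INR_S_pos.
        -- rewrite Hinvz. apply slit_plane_inv; auto.
      * apply Cderiv_mult; [apply Cderiv_mult; apply Cderiv_id | apply Cderiv_const].
    + unfold df. rewrite Hlz, Hinvz by auto. cbv beta.
      rewrite (csum_ext (fun i => (/ INR (S i) * (L * _))%C)
        (fun i => L * (/ INR (S i) * (((INR (S i) / INR (S p)) ^ N)%R * z s /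
            (1 + ((INR (S i) / INR (S p)) ^ N)%R * z s))))%C) by (intros; ring).
      rewrite (csum_ext (fun i => (/ INR (S i) * (- L * _))%C)
        (fun i => - L * (/ INR (S i) * ((INR (S i) / INR (S p ^ N))%R * / z s /
            (1 + (INR (S i) / INR (S p ^ N))%R * / z s))))%C) by (intros; ring).
      rewrite !csum_scal. field. auto.
  - unfold df. destruct (Tsum_derivative_sums N p (z s) HN (Hzs s Hs)) as [-> ->].
    unfold K. rewrite Cmod_mult, Rmult_assoc. apply Rmult_le_compat_l; [apply Cmod_ge_0|].
    destruct (Hzc s Hs) as [H1 H2].
    apply Cmod_csum_harm_bound; auto.
Qed.

(** * The Riemann sums at x = 1 *)

Definition Rsum (a P : nat) : R :=
  rsum (fun i => / INR (S i) * ln (1 + (INR (S i) / INR P) ^ a)) P.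

Lemma ratio_nonneg (i P : nat) : (0 < P)%nat -> 0 <= INR (S i) / INR P.
Proof.
  intros HP. apply Rlt_le, Rdiv_lt_0_compat; [apply INR_S_pos | apply lt_0_INR; auto].
Qed.

Lemma Tsum_1 (N p : nat) :
  Tsum N (S p) 1 = RtoC (Rsum N (S p) + / INR N * Rsum 1 (S p ^ N)).
Proof.
  assert (HQ := pow_pos_nat p N).
  assert (E1 : (/ 1)%C = 1) by (field; apply C1_nz).
  assert (Hinv : (/ INR N)%C = RtoC (/ INR N)).
  (* For [N = 0] both the real and the complex inverse of zero have the default value zero. *)
  { destruct N; [|rewrite RtoC_inv; auto; generalize (INR_S_pos N); lra].
    simpl. rewrite Rinv_0. apply Ceq; unfold Cinv; simpl; unfold Rdiv; ring. }
  unfold Tsum, Rsum. rewrite E1, RtoC_plus, RtoC_mult, Hinv, <- !csum_RtoC.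
  f_equal; [|f_equal]; apply csum_ext; intros i _; rewrite Cmult_1_r, <- RtoC_plus, Clog_RtoC,
    RtoC_mult, RtoC_inv; try reflexivity; try (generalize (INR_S_pos i); lra).
  - apply Rplus_lt_le_0_compat; [lra|]. apply pow_le, ratio_nonneg; lia.
  - rewrite pow_1. reflexivity.
  - apply Rplus_lt_le_0_compat; [lra|]. apply ratio_nonneg; lia.
Qed.

Lemma Clog_Cconj (z : C) : slit_plane z -> (Clog z + Clog (Cconj z))%C = RtoC (2 * ln (Cmod z)).
Proof.
  intros Hz. assert (Hz' : slit_plane (Cconj z)).
  { intros [H1 H2]. apply Hz. unfold Cconj in *; simpl in *. split; unfold Re, Im; lra. }
  rewrite !Clog_half_angle by auto. unfold half_angle_log.
  rewrite Cmod_conj, re_conj. unfold Cconj at 1. simpl (Im (_, _)).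
  apply Ceq; simpl; [ring|].
  replace (- snd z / (Cmod z + Re z)) with (- (Im z / (Cmod z + Re z)))
    by (unfold Im, Rdiv; ring).
  rewrite atan_opp. unfold Im. ring.
Qed.

Lemma Clog_1_Ci (r : R) :
  (Clog (1 + r * Ci) + Clog (1 + r * - Ci))%C = RtoC (ln (1 + r ^ 2)).
Proof.
  replace (1 + r * - Ci)%C with (Cconj (1 + r * Ci)) by (apply Ceq; simpl; ring).
  assert (Hs : slit_plane (1 + r * Ci)%C).
  { intros [_ H]. rewrite re_plus, re_scal_l in H. simpl in H. lra. }
  rewrite Clog_Cconj by auto. f_equal.
  assert (Hm := slit_plane_Cmod_pos _ Hs).
  replace (1 + r ^ 2) with (Cmod (1 + r * Ci) * Cmod (1 + r * Ci)).
  - rewrite ln_mult by auto. ring.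
  - rewrite Cmod_sqr, re_plus, im_plus, re_scal_l, im_scal_l. simpl. ring.
Qed.

Lemma Cinv_Ci : (/ Ci)%C = (- Ci)%C.
Proof. apply Ceq; simpl; field. Qed.

Lemma Cinv_opp_Ci : (/ - Ci)%C = Ci.
Proof. apply Ceq; simpl; field. Qed.

(** Conjugate logarithms add up to [ln (1 + r^2)], which doubles the exponents [N] and [1] of the
    two Riemann sums; in the second one, inversion merely exchanges [i] and [- i]. *)
Lemma Tsum_Ci (N p : nat) :
  (Tsum N (S p) Ci + Tsum N (S p) (- Ci))%C =
  RtoC (Rsum (2 * N) (S p) + / INR N * Rsum 2 (S p ^ N)).
Proof.
  assert (Hinv : (/ INR N)%C = RtoC (/ INR N)).
  { destruct N; [|rewrite RtoC_inv; auto; generalize (INR_S_pos N); lra].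
    simpl. rewrite Rinv_0. apply Ceq; unfold Cinv; simpl; unfold Rdiv; ring. }
  unfold Tsum, Rsum. rewrite Cinv_Ci, Cinv_opp_Ci, RtoC_plus, RtoC_mult, Hinv, <- !csum_RtoC.
  set (A := csum _ _). set (B := csum _ _). set (A' := csum _ _). set (B' := csum _ _).
  replace (A + (/ INR N)%R * B + (A' + (/ INR N)%R * B'))%C with
    ((A + A') + (/ INR N)%R * (B' + B))%C by ring.
  unfold A, A', B, B'. rewrite <- !csum_plus.
  f_equal; [|f_equal]; apply csum_ext; intros i _; rewrite <- Cmult_plus_distr_l, Clog_1_Ci,
    RtoC_mult, RtoC_inv; try reflexivity; try (generalize (INR_S_pos i); lra).
  rewrite <- pow_mult, (Nat.mul_comm N 2). reflexivity.
Qed.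

Lemma slit_plane_Ci : slit_plane Ci.
Proof. intros [H _]. simpl in H. lra. Qed.

Lemma Clog_Ci : Clog Ci = (Ci * (PI / 2)%R)%C.
Proof.
  assert (HPI := PI_RGT_0).
  replace Ci with (Cexp (Ci * (PI / 2)%R)) at 1.
  - apply Clog_Cexp. replace (Im (Ci * (PI / 2)%R)) with (PI / 2) by (simpl; ring).
    rewrite Rabs_pos_eq; lra.
  - rewrite <- cis_Cexp. unfold cis. rewrite cos_PI2, sin_PI2. reflexivity.
Qed.

(** [Tsum_path] is used at [i] and at [- i]. The square of either logarithm is [- PI^2 / 4], so the
    two quadratic terms add up to [- PI^2 / (4 N)]. *)
Lemma Rsum_double_aux (N : nat) : (1 <= N)%nat -> exists K, forall p,
  Rabs (Rsum (2 * N) (S p) + / INR N * Rsum 2 (S p ^ N)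
    - 2 * (Rsum N (S p) + / INR N * Rsum 1 (S p ^ N)) + PI ^ 2 / (4 * INR N)) <= K * / INR (S p).
Proof.
  intros HN. assert (HN0 : 0 < INR N) by (apply lt_0_INR; lia).
  destruct (Tsum_path N Ci HN slit_plane_Ci) as [K1 H1].
  assert (Hs : slit_plane (- Ci)%C) by (rewrite <- Cinv_Ci; apply slit_plane_inv, slit_plane_Ci).
  destruct (Tsum_path N (- Ci)%C HN Hs) as [K2 H2].
  exists (K1 + K2). intros p. specialize (H1 p). specialize (H2 p).
  rewrite <- (Cinv_Ci), Clog_inv, Cinv_Ci, Clog_Ci in H2 by apply slit_plane_Ci.
  rewrite Clog_Ci in H1.
  rewrite <- Cmod_R.
  replace (RtoC _) with ((Tsum N (S p) Ci - Tsum N (S p) 1 -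
      Ci * (PI / 2)%R * (Ci * (PI / 2)%R) / (2 * INR N)) +
    (Tsum N (S p) (- Ci) - Tsum N (S p) 1 -
      - (Ci * (PI / 2)%R) * - (Ci * (PI / 2)%R) / (2 * INR N)))%C.
  - eapply Rle_trans; [apply Cmod_triangle|]. lra.
  - rewrite RtoC_plus, RtoC_minus, RtoC_mult, <- Tsum_1, <- Tsum_Ci.
    assert (HNC : RtoC (INR N) <> 0%C) by (apply RtoC_neq_0; lra).
    assert (H2C : RtoC 2 <> 0%C) by (apply RtoC_neq_0; lra).
    assert (H4C : RtoC 4 <> 0%C) by (apply RtoC_neq_0; lra).
    rewrite !RtoC_div, RtoC_mult, RtoC_pow by lra.
    assert (Ei : (Ci * Ci)%C = (- (1))%C) by (apply Ceq; simpl; ring).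
    replace (Tsum N (S p) Ci - Tsum N (S p) 1 - Ci * (PI / 2) * (Ci * (PI / 2)) / (2 * INR N) +
      (Tsum N (S p) (- Ci) - Tsum N (S p) 1 - - (Ci * (PI / 2)) * - (Ci * (PI / 2)) / (2 * INR N)))%C
      with (Tsum N (S p) Ci + Tsum N (S p) (- Ci) - 2 * Tsum N (S p) 1
        - (Ci * Ci) * (PI * PI / (4 * INR N)))%C by (field; auto).
    rewrite Ei. field. auto.
Qed.

(** The case [N = 1] of [Rsum_double_aux] gives the relation between the exponents 1 and 2. Applied
    at [P^N] and divided by [N], it eliminates the second Riemann sum and changes [PI^2 / (4 N)]
    into [PI^2 / (8 N)]. *)
Lemma Rsum_double (N : nat) : (1 <= N)%nat -> exists K, 0 <= K /\ forall p,
  Rabs (Rsum (2 * N) (S p) - 2 * Rsum N (S p) + PI ^ 2 / (8 * INR N)) <= K * / INR (S p).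
Proof.
  intros HN. assert (HN0 : 1 <= INR N) by (apply (le_INR 1); lia).
  destruct (Rsum_double_aux 1 (le_n 1)) as [K1 H1].
  destruct (Rsum_double_aux N HN) as [K2 H2].
  assert (H1' : forall p, Rabs (Rsum 2 (S p) - 2 * Rsum 1 (S p) + PI ^ 2 / 8) <= K1 * / INR (S p)).
  { intros p. specialize (H1 p). rewrite Nat.pow_1_r in H1. simpl (2 * 1)%nat in H1.
    simpl (INR 1) in H1. rewrite Rinv_1 in H1.
    replace (Rsum 2 (S p) + 1 * Rsum 2 (S p) - 2 * (Rsum 1 (S p) + 1 * Rsum 1 (S p)) + PI ^ 2 / (4 * 1))
      with (2 * (Rsum 2 (S p) - 2 * Rsum 1 (S p) + PI ^ 2 / 8)) in H1 by field.
    rewrite Rabs_mult, (Rabs_pos_eq 2) in H1 by lra.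
    generalize (Rabs_pos (Rsum 2 (S p) - 2 * Rsum 1 (S p) + PI ^ 2 / 8)). lra. }
  assert (HK1 : 0 <= K1).
  { specialize (H1' 0%nat). simpl (INR 1) in H1'. rewrite Rinv_1, Rmult_1_r in H1'.
    eapply Rle_trans; [apply Rabs_pos | exact H1']. }
  assert (HK2 : 0 <= K2).
  { specialize (H2 0%nat). simpl (INR 1) in H2. rewrite Rinv_1, Rmult_1_r in H2.
    eapply Rle_trans; [apply Rabs_pos | exact H2]. }
  exists (K2 + K1). split; [lra|]. intros p. specialize (H2 p).
  assert (HP := INR_S_pos p).
  assert (HQ := pow_pos_nat p N). assert (HPQ := le_pow_nat p N HN).
  specialize (H1' (S p ^ N - 1)%nat).
  replace (S (S p ^ N - 1)) with (S p ^ N)%nat in H1' by lia.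
  set (Q := (S p ^ N)%nat) in *. apply le_INR in HPQ.
  assert (H3 : K1 * / INR Q <= K1 * / INR (S p)).
  { apply Rmult_le_compat_l; auto. apply Rinv_le_contravar; auto. }
  replace (Rsum (2 * N) (S p) - 2 * Rsum N (S p) + PI ^ 2 / (8 * INR N)) with
    ((Rsum (2 * N) (S p) + / INR N * Rsum 2 Q - 2 * (Rsum N (S p) + / INR N * Rsum 1 Q)
      + PI ^ 2 / (4 * INR N)) - / INR N * (Rsum 2 Q - 2 * Rsum 1 Q + PI ^ 2 / 8)) by (field; lra).
  eapply Rle_trans; [apply Rabs_triang|]. rewrite Rabs_Ropp, Rabs_mult.
  assert (Hinv : 0 < / INR N <= 1).
  { split; [apply Rinv_0_lt_compat; lra|]. rewrite <- Rinv_1. apply Rinv_le_contravar; lra. }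
  rewrite (Rabs_pos_eq (/ INR N)) by lra.
  generalize (Rabs_pos (Rsum 2 Q - 2 * Rsum 1 Q + PI ^ 2 / 8)). nra.
Qed.

(** For a ratio [r] in [[0, 1]], [ln (1 + r^a) <= r^a <= r], so that each of the [P] summands is at
    most [1/P]. *)
Lemma Rsum_bounds (a p : nat) : (1 <= a)%nat -> 0 <= Rsum a (S p) <= 1.
Proof.
  intros Ha. unfold Rsum. assert (HP := INR_S_pos p). split.
  - replace 0 with (rsum (fun _ => 0) (S p)) by (rewrite rsum_const; ring).
    apply rsum_le. intros i _. apply Rmult_le_pos; [apply Rlt_le, Rinv_0_lt_compat, INR_S_pos|].
    rewrite <- ln_1. assert (H : 0 <= (INR (S i) / INR (S p)) ^ a) by (apply pow_le, ratio_nonneg; lia).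
    destruct H as [H | <-]; [apply Rlt_le, ln_increasing; lra | rewrite Rplus_0_r; lra].
  - apply Rle_trans with (rsum (fun _ => / INR (S p)) (S p)).
    + apply rsum_le. intros i Hi. assert (Hi0 := INR_S_pos i).
      assert (Hr0 := ratio_nonneg i (S p) (Nat.lt_0_succ p)).
      assert (Hr1 : INR (S i) / INR (S p) <= 1).
      { apply Rmult_le_reg_r with (INR (S p)); auto. unfold Rdiv. rewrite Rmult_assoc, Rinv_l by lra.
        rewrite Rmult_1_l, Rmult_1_r. apply le_INR; lia. }
      set (r := INR (S i) / INR (S p)) in *.
      assert (Hra : 0 <= r ^ a) by (apply pow_le; auto).
      assert (Hra1 : r ^ a <= r).
      { replace a with (S (a - 1)) by lia. simpl.
        assert (r ^ (a - 1) <= 1); [|assert (0 <= r ^ (a - 1)) by (apply pow_le; auto); nra].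
        rewrite <- (pow1 (a - 1)). apply pow_incr; lra. }
      assert (Hln := ln_le_pred (1 + r ^ a)).
      apply Rle_trans with (/ INR (S i) * r).
      * apply Rmult_le_compat_l; [apply Rlt_le, Rinv_0_lt_compat; auto | lra].
      * right. unfold r. field. lra.
    + rewrite rsum_const, Rinv_r; lra.
Qed.

(* The relation [e_(2a) = 2 e_a + O(1/P)] for the error [e_a] of the bounded sequence
   [Rsum a] forces [e_a -> 0]. *)
Lemma Rsum_error (j a : nat) : (1 <= a)%nat -> exists K, 0 <= K /\ forall p,
  Rabs (Rsum a (S p) - PI ^ 2 / (12 * INR a)) <= 3 * (/ 2) ^ j + K * / INR (S p).
Proof.
  revert a. induction j as [|j IH]; intros a Ha; assert (Ha1 : 1 <= INR a) by (apply (le_INR 1); lia).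
  - exists 0. split; [lra|]. intros p. destruct (Rsum_bounds a p Ha) as [H1 H2].
    (* The initial constant 3 only has to exceed the distance from a number in [[0, 1]] to one in
       [[0, 2]], so the crude bound [PI <= 4] is enough. *)
    assert (H3 : 0 <= PI ^ 2 / (12 * INR a) <= 2).
    { assert (HPI := PI_RGT_0). assert (HPI4 := PI_4).
      assert (H16 : PI ^ 2 <= 16) by (simpl; nra). split.
      - apply Rlt_le, Rdiv_lt_0_compat; [apply pow_lt; lra | lra].
      - apply Rmult_le_reg_r with (12 * INR a); [lra|].
        unfold Rdiv. rewrite Rmult_assoc, Rinv_l by lra. lra. }
    simpl pow. apply Rabs_le. lra.
  - destruct (IH (2 * a)%nat ltac:(lia)) as [K1 [HK1 H1]].
    destruct (Rsum_double a Ha) as [K2 [HK2 H2]].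
    exists (K1 / 2 + K2 / 2). split; [lra|]. intros p. specialize (H1 p). specialize (H2 p).
    rewrite mult_INR in H1. simpl (INR 2) in H1.
    (* The values [L_a = PI^2 / (12 a)] solve [L_(2a) = 2 L_a - PI^2 / (8 a)]. Read from [2 a] back
       to [a], the relation halves the error. *)
    replace (Rsum a (S p) - PI ^ 2 / (12 * INR a)) with
      (/ 2 * ((Rsum (2 * a) (S p) - PI ^ 2 / (12 * ((1 + 1) * INR a)))
        - (Rsum (2 * a) (S p) - 2 * Rsum a (S p) + PI ^ 2 / (8 * INR a)))) by (field; lra).
    rewrite Rabs_mult, (Rabs_pos_eq (/ 2)) by lra.
    apply Rle_trans with (/ 2 * (3 * (/ 2) ^ j + K1 * / INR (S p) + K2 * / INR (S p))).
    + apply Rmult_le_compat_l; [lra|]. eapply Rle_trans; [apply Rabs_triang|].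
      rewrite Rabs_Ropp. lra.
    + right. cbn [pow]. field. generalize (INR_S_pos p). lra.
Qed.

Lemma Rsum_lim (a : nat) : (1 <= a)%nat ->
  is_lim_seq (fun p => Rsum a (S p)) (PI ^ 2 / (12 * INR a)).
Proof.
  intros Ha. apply is_lim_seq_spec. intros eps.
  assert (Hg := is_lim_seq_geom (/ 2)). rewrite Rabs_pos_eq in Hg by lra.
  specialize (Hg ltac:(lra)). apply is_lim_seq_spec in Hg.
  assert (He : 0 < eps / 6) by (generalize (cond_pos eps); lra).
  (* [K] depends on [j]: first [j] is fixed so that [3 (1/2)^j < eps / 2], and only then [n] is
     taken large. *)
  destruct (Hg (mkposreal _ He)) as [j Hj]. specialize (Hj j (le_n j)). simpl in Hj.
  rewrite Rminus_0_r, Rabs_pos_eq in Hj by (apply pow_le; lra).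
  destruct (Rsum_error j a Ha) as [K [HK H]].
  assert (Hl := is_lim_seq_mult_0 K _ is_lim_seq_inv_INR_S). apply is_lim_seq_spec in Hl.
  assert (He2 : 0 < eps / 2) by (generalize (cond_pos eps); lra).
  destruct (Hl (mkposreal _ He2)) as [n0 Hn0]. exists n0. intros n Hn.
  specialize (Hn0 n Hn). cbv beta in Hn0. simpl pos in Hn0.
  rewrite Rminus_0_r in Hn0. generalize (Rle_abs (K * / INR (S n))) (H n). lra.
Qed.

Lemma filterlim_pow_nat (N : nat) : (1 <= N)%nat ->
  filterlim (fun p => S p ^ N)%nat eventually eventually.
Proof.
  intros HN P [n0 H]. exists n0. intros p Hp. apply H. generalize (le_pow_nat p N HN). lia.
Qed.

Lemma Tsum_lim (N : nat) (x : C) : (1 <= N)%nat -> slit_plane x ->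
  Clim (fun p => Tsum N (S p) x) (/ INR N * (PI ^ 2 / 6 + Clog x ^ 2 / 2))%C.
Proof.
  intros HN Hx. assert (HN0 : 0 < INR N) by (apply lt_0_INR; lia).
  assert (HNC : RtoC (INR N) <> 0%C) by (apply RtoC_neq_0; lra).
  assert (H2C : RtoC 2 <> 0%C) by (apply RtoC_neq_0; lra).
  destruct (Tsum_path N x HN Hx) as [K HK].
  apply Clim_ext with (fun p =>
    (Tsum N (S p) x - Tsum N (S p) 1 - Clog x * Clog x / (2 * INR N)) +
    (Tsum N (S p) 1 + Clog x * Clog x / (2 * INR N)))%C; [intros; ring|].
  (* At [x = 1] each of the two Riemann sums contributes [PI^2 / (12 N)]. *)
  apply Clim_eq with (0 + (RtoC (PI ^ 2 / (12 * INR N) + / INR N * (PI ^ 2 / (12 * INR 1)))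
    + Clog x * Clog x / (2 * INR N)))%C.
  - apply Clim_plus; [|apply Clim_plus; [|apply Clim_const]].
    + apply Clim_intro with (fun p => K * / INR (S p)).
      * intros p. unfold Cminus at 1. rewrite Copp_0, Cplus_0_r. apply HK.
      * apply is_lim_seq_mult_0, is_lim_seq_inv_INR_S.
    + apply Clim_ext with (fun p => RtoC (Rsum N (S p) + / INR N * Rsum 1 (S p ^ N)));
        [intros; symmetry; apply Tsum_1|].
      apply Clim_RtoC, is_lim_seq_plus'; [apply Rsum_lim; auto|].
      apply is_lim_seq_mult'; [apply is_lim_seq_const|].
      apply (is_lim_seq_subseq (fun P => Rsum 1 P) _ (fun p => S p ^ N)%nat).
      * apply filterlim_pow_nat; auto.
      * apply is_lim_seq_incr_1, Rsum_lim. auto.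
  - replace (PI ^ 2 / (12 * INR N) + / INR N * (PI ^ 2 / (12 * INR 1)))
      with (/ INR N * (PI ^ 2 / 6)) by (simpl (INR 1); field; lra).
    rewrite RtoC_mult, RtoC_inv, RtoC_div, RtoC_pow by lra.
    field. auto.
Qed.

(** * The case [k = 1] *)

Definition lnsum (n : nat) : R := rsum (fun i => ln (INR (S i)) / INR (S i)) n.

(** With [a = ln A] and [b = ln B], the increment is [(b - a)^2 / 2 - b ((b - a) - 1/B)]. As
    [1/B <= b - a <= 1/A], the parts are at most [2 / B^2] and [8 B^(1/4) / B^2], by
    [ln B <= 4 B^(1/4)]; hence the exponent [7/4] and the constant 10. *)
Lemma stieltjes_increment (n : nat) :
  Rabs ((lnsum (S (S n)) - ln (INR (S (S n))) ^ 2 / 2) - (lnsum (S n) - ln (INR (S n)) ^ 2 / 2))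
  <= Rpower (INR (S (S n))) (- (7 / 4)) * 10.
Proof.
  assert (HA := INR_S_ge_1 n). assert (E := S_INR (S n)). assert (Hd := ln_INR_S_diff n).
  assert (Hb := ln_INR_S_nonneg (S n)). assert (Hb4 := ln_INR_S_le (S n)).
  assert (Hp : Rpower (INR (S (S n))) (- (7 / 4)) =
    Rpower (INR (S (S n))) (1 / 4) * / (INR (S (S n)) * INR (S (S n)))).
  { replace (INR (S (S n)) * INR (S (S n))) with (Rpower (INR (S (S n))) (INR 2))
      by (rewrite Rpower_INR_S; simpl; ring).
    rewrite <- Rpower_Ropp, <- Rpower_plus. f_equal. simpl. lra. }
  assert (Hr1 : 1 <= Rpower (INR (S (S n))) (1 / 4)).
  { unfold Rpower. rewrite <- exp_0 at 1.
    assert (H : 0 <= 1 / 4 * ln (INR (S (S n)))) by nra.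
    destruct H as [H | <-]; [apply Rlt_le, exp_increasing; auto | lra]. }
  rewrite Hp. unfold lnsum at 1. cbn [rsum]. fold (lnsum (S n)).
  replace (rsum (fun i => ln (INR (S i)) / INR (S i)) n + ln (INR (S n)) / INR (S n))
    with (lnsum (S n)) by reflexivity.
  set (A := INR (S n)) in *. set (B := INR (S (S n))) in *.
  set (a := ln A) in *. set (b := ln B) in *. set (r := Rpower B (1 / 4)) in *.
  replace (lnsum (S n) + b / B - b ^ 2 / 2 - (lnsum (S n) - a ^ 2 / 2))
    with ((b - a) * (b - a) / 2 - b * ((b - a) - / B)) by (field; lra).
  assert (HAB : / A <= 2 * / B).
  { replace (2 * / B) with (/ (B / 2)) by (field; lra). apply Rinv_le_contravar; lra. }
  assert (HB : 0 < / B) by (apply Rinv_0_lt_compat; lra).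
  assert (HAB2 : / A - / B <= 2 * (/ B * / B)).
  { replace (/ A - / B) with (/ A * / B) by (rewrite E; field; lra). nra. }
  rewrite Rinv_mult.
  assert (H1 : 0 <= (b - a) * (b - a) / 2 <= 2 * (/ B * / B)) by nra.
  assert (H2 : 0 <= b * (b - a - / B) <= 8 * (r * (/ B * / B))).
  { split; [apply Rmult_le_pos; lra|].
    apply Rle_trans with (4 * r * (2 * (/ B * / B))); [|right; ring].
    apply Rmult_le_compat; lra. }
  assert (H3 : / B * / B <= r * (/ B * / B)) by nra.
  apply Rabs_le. lra.
Qed.

Lemma stieltjes_gamma1_lim :
  is_lim_seq (fun n => lnsum (S n) - ln (INR (S n)) ^ 2 / 2) stieltjes_gamma1.
Proof.
  set (u := fun n => lnsum (S n) - ln (INR (S n)) ^ 2 / 2).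
  assert (Hex : ex_series (fun n => u (S n) - u n)).
  { apply (@ex_series_le R_AbsRing R_CompleteNormedModule _
      (fun n => Rpower (INR (S (S n))) (- (7 / 4)) * 10)).
    - intros n. apply stieltjes_increment.
    - apply ex_series_scal_r, (ex_series_incr_1 (fun n => Rpower (INR (S n)) (- (7 / 4)))).
      apply ex_series_Rpower. lra. }
  destruct Hex as [l Hl]. apply is_series_rsum in Hl.
  assert (Hu : is_lim_seq u (l + u 0%nat)).
  { apply is_lim_seq_ext with (fun n => rsum (fun n => u (S n) - u n) n + u 0%nat).
    - intros n. induction n; cbn [rsum]; [ring|]. lra.
    - apply is_lim_seq_plus'; auto. apply is_lim_seq_const. }
  replace stieltjes_gamma1 with (l + u 0%nat); auto. symmetry. unfold stieltjes_gamma1.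
  rewrite (is_lim_seq_unique _ (l + u 0%nat)); [reflexivity|].
  apply is_lim_seq_incr_1. apply is_lim_seq_ext with (2 := Hu).
  intros n. unfold u. f_equal. unfold lnsum. apply (rsum_sum_n_m (fun m => ln (INR m) / INR m)).
Qed.

Lemma harmonic_le_ln (n : nat) : harmonic (S n) <= 1 + ln (INR (S n)).
Proof.
  induction n.
  - unfold harmonic; simpl. rewrite Rinv_1, ln_1. lra.
  - unfold harmonic in *. cbn [rsum] in *. generalize (proj1 (ln_INR_S_diff n)). lra.
Qed.

Lemma harmonic_nonneg (n : nat) : 0 <= harmonic n.
Proof.
  unfold harmonic. replace 0 with (rsum (fun _ => 0) n) by (rewrite rsum_const; ring).
  apply rsum_le. intros i _. apply Rlt_le, Rinv_0_lt_compat, INR_S_pos.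
Qed.

Lemma is_lim_seq_ln_div_INR : is_lim_seq (fun n => ln (INR (S n)) / INR (S n)) 0.
Proof.
  apply (is_lim_comp_seq (fun y => ln y / y) (fun n => INR (S n)) p_infty).
  - apply is_lim_div_ln_p.
  - exists 0%nat. intros n _. discriminate.
  - apply (is_lim_seq_incr_1 INR), is_lim_seq_INR.
Qed.

Lemma S_pow_pred (p N : nat) : S (S p ^ N - 1) = (S p ^ N)%nat.
Proof. generalize (pow_pos_nat p N). lia. Qed.

(** An error [O(1/P)] per summand, weighted by [1/m] for [m <= P^N], totals this expression. It
    tends to zero because the harmonic number grows only like [N ln P]. *)
Lemma is_lim_seq_harmonic_pow (N : nat) :
  is_lim_seq (fun p => harmonic (S p ^ N) * / INR (S p)) 0.
Proof.
  apply is_lim_seq_squeeze_0 with (fun p => / INR (S p) + INR N * (ln (INR (S p)) / INR (S p))).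
  - intros p. assert (HP := INR_S_pos p).
    assert (HiP : 0 < / INR (S p)) by (apply Rinv_0_lt_compat; auto).
    assert (H0 := harmonic_nonneg (S p ^ N)).
    assert (H1 := harmonic_le_ln (S p ^ N - 1)). rewrite S_pow_pred in H1.
    rewrite INR_pow, ln_pow in H1 by auto.
    split; [nra|]. apply (Rmult_le_compat_r (/ INR (S p))) in H1; [|lra].
    unfold Rdiv. lra.
  - apply is_lim_seq_plus_0; [apply is_lim_seq_inv_INR_S|].
    apply is_lim_seq_mult_0, is_lim_seq_ln_div_INR.
Qed.

Lemma phi_remainder (c : R) (y : C) (n : nat) : slit_plane y -> cone_bound c y -> (0 < n)%nat ->
  Cmod (phi y - (Clog (y + INR n) - Clog y - harm y n)) <= / (c * c) * / INR n.
Proof.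
  intros Hy Hc Hn. destruct (digamma1_lim_remainder c y Hy Hc) as [_ H]. specialize (H n).
  unfold phi.
  replace (digamma1 y - Clog y - (Clog (y + INR n) - Clog y - harm y n))%C
    with (digamma1 y - (Clog (y + INR n) - harm y n))%C by ring.
  eapply Rle_trans; [exact H|]. apply Rmult_le_compat_l.
  - destruct Hc as [Hc _]. apply Rlt_le, Rinv_0_lt_compat. nra.
  - apply Rinv_le_contravar; [apply lt_0_INR; auto|]. generalize (Cmod_ge_0 y). lra.
Qed.

(** Uniformity in [m] is the scale invariance of the cone constant. Uniformity over the finitely
    many [l] is obtained by adding their constants. *)
Lemma ypoint_phi_remainder (N : nat) (x : C) : slit_plane x ->
  exists K, 0 <= K /\ forall l m n, (l < N)%nat -> (0 < n)%nat ->
    Cmod (phi (ypoint N x l m) - (Clog (ypoint N x l m + INR n) - Clog (ypoint N x l m)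
      - harm (ypoint N x l m) n)) <= K * / INR n.
Proof.
  intros Hx.
  assert (H : forall L, (L <= N)%nat -> exists K, 0 <= K /\ forall l m n, (l < L)%nat -> (0 < n)%nat ->
    Cmod (phi (ypoint N x l m) - (Clog (ypoint N x l m + INR n) - Clog (ypoint N x l m)
      - harm (ypoint N x l m) n)) <= K * / INR n); [|apply H; auto].
  induction L as [|L IH]; intros HL.
  - exists 0. split; [lra|]. intros; lia.
  - destruct IH as [K [HK IH]]; [lia|].
    destruct (slit_plane_cone (upoint N x L)) as [c Hc]; [apply upoint_slit; auto; lia|].
    change (cone_bound c (upoint N x L)) in Hc.
    assert (Hcc : 0 < / (c * c)) by (destruct Hc; apply Rinv_0_lt_compat; nra).
    exists (K + / (c * c)). split; [lra|]. intros l m n Hl Hn.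
    assert (Hin : 0 < / INR n) by (apply Rinv_0_lt_compat, lt_0_INR; auto).
    destruct (Nat.eq_dec l L) as [-> | Hne].
    + eapply Rle_trans; [apply (phi_remainder c); auto|].
      * apply ypoint_slit; auto; lia.
      * apply cone_bound_scal; auto using Rpower_pos.
      * nra.
    + eapply Rle_trans; [apply IH; auto; lia|]. nra.
Qed.

Lemma csum_inv_bound (f : nat -> C) (K : R) (n : nat) :
  (forall i, (i < n)%nat -> Cmod (f i) <= K) ->
  Cmod (csum (fun i => f i / INR (S i))%C n) <= K * harmonic n.
Proof.
  intros H. unfold harmonic. rewrite <- rsum_scal. apply Cmod_csum_le. intros i Hi.
  assert (Hp := INR_S_pos i).
  rewrite Cmod_div, Cmod_RtoC_pos by (try apply RtoC_neq_0; lra).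
  apply Rmult_le_compat_r; auto. apply Rlt_le, Rinv_0_lt_compat; auto.
Qed.

Definition ypos (N : nat) (x : C) (n : nat) : C := (INR (S n) ^ N * x)%C.

Lemma ypos_slit (N : nat) (x : C) (n : nat) : slit_plane x -> slit_plane (ypos N x n).
Proof.
  intros Hx. unfold ypos. rewrite <- RtoC_pow. apply slit_plane_scal; auto. apply pow_lt, INR_S_pos.
Qed.

(** The outer sum stops at [P] and the inner one, inside [harm], at [P^N]; in [Bmain] these lengths
    are exchanged, so that both involve the kernel on the same rectangle. *)
Definition Amain (N p : nat) (x : C) : C :=
  csum (fun n => (Clog (ypos N x n + INR (S p ^ N)) - Clog (ypos N x n)
    - harm (ypos N x n) (S p ^ N)) / INR (S n))%C (S p).

Definition Bmain (N p : nat) (x : C) : C :=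
  csum (fun m => csum (fun l => Clog (ypoint N x l m + INR (S p)) - Clog (ypoint N x l m)
    - harm (ypoint N x l m) (S p)) N / INR (S m))%C (S p ^ N).

Lemma Amain_error (N : nat) (x : C) : (1 <= N)%nat -> slit_plane x ->
  Clim (fun p => csum (fun n => phi (ypos N x n) / INR (S n))%C (S p) - Amain N p x)%C 0.
Proof.
  intros HN Hx. destruct (slit_plane_cone x Hx) as [c Hc]. change (cone_bound c x) in Hc.
  assert (Hcc : 0 < / (c * c)) by (destruct Hc; apply Rinv_0_lt_compat; nra).
  (* The exponent 1 is written out so that [is_lim_seq_harmonic_pow] applies with [N = 1]. *)
  apply Clim_intro with (fun p => / (c * c) * (harmonic (S p ^ 1) * / INR (S p))).
  - intros p. unfold Cminus at 1. rewrite Copp_0, Cplus_0_r. unfold Amain. rewrite <- csum_minus.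
    rewrite (csum_ext _ (fun n => (phi (ypos N x n) - (Clog (ypos N x n + INR (S p ^ N))
      - Clog (ypos N x n) - harm (ypos N x n) (S p ^ N))) / INR (S n))%C)
      by (intros; unfold Cdiv; ring).
    rewrite Nat.pow_1_r.
    eapply Rle_trans; [apply (csum_inv_bound _ (/ (c * c) * / INR (S p)))|right; ring].
    intros n _. eapply Rle_trans; [apply (phi_remainder c)|].
    + apply ypos_slit; auto.
    + unfold ypos. rewrite <- RtoC_pow. apply cone_bound_scal; auto. apply pow_lt, INR_S_pos.
    + apply pow_pos_nat.
    + apply Rmult_le_compat_l; [lra|]. apply Rinv_le_contravar; [apply INR_S_pos|].
      apply le_INR, le_pow_nat; auto.
  - apply is_lim_seq_mult_0, is_lim_seq_harmonic_pow.
Qed.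

Lemma Bmain_error (N : nat) (x : C) : (1 <= N)%nat -> slit_plane x ->
  Clim (fun p => csum (fun m => csum (fun l => phi (ypoint N x l m)) N / INR (S m))%C (S p ^ N)
    - Bmain N p x)%C 0.
Proof.
  intros HN Hx. destruct (ypoint_phi_remainder N x Hx) as [K [HK H]].
  apply Clim_intro with (fun p => INR N * K * (harmonic (S p ^ N) * / INR (S p))).
  - intros p. unfold Cminus at 1. rewrite Copp_0, Cplus_0_r. unfold Bmain. rewrite <- csum_minus.
    rewrite (csum_ext _ (fun m => csum (fun l => phi (ypoint N x l m) -
      (Clog (ypoint N x l m + INR (S p)) - Clog (ypoint N x l m)
       - harm (ypoint N x l m) (S p))) N / INR (S m))%C)
      by (intros; rewrite (csum_minus (fun l => phi (ypoint N x l _))); unfold Cdiv; ring).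
    eapply Rle_trans; [apply (csum_inv_bound _ (INR N * (K * / INR (S p))))|right; ring].
    intros m _. rewrite <- rsum_const. apply Cmod_csum_le. intros l Hl. apply H; auto. lia.
  - apply is_lim_seq_mult_0, is_lim_seq_harmonic_pow.
Qed.

Lemma Rpow_ratio (n p N : nat) : (INR (S n) / INR (S p)) ^ N = INR (S n) ^ N / INR (S p ^ N).
Proof. unfold Rdiv. rewrite Rpow_mult_distr, pow_inv, INR_pow. reflexivity. Qed.

Lemma csum_lnsum (n : nat) : csum (fun i => ln (INR (S i)) / INR (S i))%C n = RtoC (lnsum n).
Proof.
  unfold lnsum. rewrite <- csum_RtoC. apply csum_ext. intros i _. rewrite RtoC_div; auto.
  generalize (INR_S_pos i). lra.
Qed.

Lemma csum_div_INR_const (a : C) (n : nat) : csum (fun i => a / INR (S i))%C n = (a * harmonic n)%C.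
Proof. rewrite <- csum_inv_INR, <- csum_scal. reflexivity. Qed.

Lemma Amain_eq (N p : nat) (x : C) : (1 <= N)%nat -> slit_plane x ->
  Amain N p x = (csum (fun i => / INR (S i) * Clog (1 + ((INR (S i) / INR (S p)) ^ N)%R * x)) (S p)
    + (INR N * ln (INR (S p)) - Clog x - harmonic (S p ^ N)) * harmonic (S p)
    - INR N * lnsum (S p)
    + csum (fun n => csum (fun m => bker 1 N x m n) (S p ^ N)) (S p))%C.
Proof.
  intros HN Hx. rewrite <- csum_div_INR_const, <- csum_lnsum, <- csum_scal, <- csum_plus,
    <- csum_minus, <- csum_plus.
  apply csum_ext. intros n _.
  assert (HP := INR_S_pos p). assert (Hn := INR_S_pos n).
  assert (HQ : 0 < INR (S p ^ N)) by (apply lt_0_INR, pow_pos_nat).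
  assert (HnC : RtoC (INR (S n)) <> 0%C) by (apply RtoC_neq_0; lra).
  assert (Hr : 0 < INR (S n) ^ N / INR (S p ^ N)) by (apply Rdiv_lt_0_compat; auto; apply pow_lt; auto).
  assert (E1 : Clog (ypos N x n + INR (S p ^ N)) = (INR N * ln (INR (S p)) +
    Clog (1 + ((INR (S n) / INR (S p)) ^ N)%R * x))%C).
  { rewrite Rpow_ratio.
    replace (ypos N x n + INR (S p ^ N))%C with
      (INR (S p ^ N) * (1 + (INR (S n) ^ N / INR (S p ^ N))%R * x))%C.
    - rewrite Clog_scal by (auto; apply slit_plane_affine; auto; lra).
      rewrite INR_pow at 1. rewrite ln_pow, RtoC_mult by auto. reflexivity.
    - unfold ypos. rewrite RtoC_div, RtoC_pow by lra. field. apply RtoC_neq_0; lra. }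
  assert (E2 : Clog (ypos N x n) = (INR N * ln (INR (S n)) + Clog x)%C).
  { unfold ypos. rewrite <- RtoC_pow, Clog_scal by (auto; apply pow_lt; auto).
    rewrite ln_pow, RtoC_mult by auto. reflexivity. }
  assert (E3 : csum (fun m => bker 1 N x m n) (S p ^ N) =
    ((harmonic (S p ^ N) - harm (ypos N x n) (S p ^ N)) / INR (S n))%C).
  { rewrite (csum_ext _ (fun m => / INR (S n) * (/ INR (S m) - / (ypos N x n + INR (S m))))%C).
    - rewrite csum_scal, csum_minus, csum_inv_INR. unfold Cdiv, harm. ring.
    - intros m _. rewrite <- bker_row by auto. rewrite Cpow_1_r. unfold Cdiv, ypos. ring. }
  rewrite E1, E2, E3. field. auto.
Qed.

Lemma Bmain_eq (N p : nat) (x : C) : (1 <= N)%nat -> slit_plane x ->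
  Bmain N p x = (csum (fun i => / INR (S i) * Clog (1 + (INR (S i) / INR (S p ^ N))%R * / x)) (S p ^ N)
    + (INR N * ln (INR (S p)) + Clog x) * harmonic (S p ^ N) - lnsum (S p ^ N)
    - INR N * csum (fun m => csum (bker 1 N x m) (S p)) (S p ^ N))%C.
Proof.
  intros HN Hx. rewrite <- csum_div_INR_const, <- csum_lnsum, <- csum_scal, <- csum_plus,
    <- !csum_minus.
  apply csum_ext. intros m _.
  assert (HP := INR_S_pos p). assert (Hm := INR_S_pos m).
  assert (HQ : 0 < INR (S p ^ N)) by (apply lt_0_INR, pow_pos_nat).
  assert (HmC : RtoC (INR (S m)) <> 0%C) by (apply RtoC_neq_0; lra).
  assert (Hr : 0 < INR (S m) / INR (S p ^ N)) by (apply Rdiv_lt_0_compat; auto).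
  rewrite !csum_minus, csum_Clog_ypoint by (auto; lra).
  rewrite (csum_ext (fun l => Clog (ypoint N x l m)) (fun l => Clog (ypoint N x l m + 0)))
    by (intros; rewrite Cplus_0_r; auto).
  rewrite csum_Clog_ypoint, pow_i, Cplus_0_r, Clog_INR_div by (auto; try lia; lra).
  assert (E1 : Clog (INR (S m) / x + (INR (S p) ^ N)%R) = (INR N * ln (INR (S p)) +
    Clog (1 + (INR (S m) / INR (S p ^ N))%R * / x))%C).
  { rewrite <- INR_pow.
    replace (INR (S m) / x + INR (S p ^ N))%C with
      (INR (S p ^ N) * (1 + (INR (S m) / INR (S p ^ N))%R * / x))%C.
    - rewrite Clog_scal by (auto; apply slit_plane_affine; auto using slit_plane_inv; lra).
      rewrite INR_pow at 1. rewrite ln_pow, RtoC_mult by auto. reflexivity.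
    - rewrite RtoC_div by lra. field.
      split; [apply slit_plane_neq_0; auto | apply RtoC_neq_0; lra]. }
  assert (E2 : csum (fun l => harm (ypoint N x l m) (S p)) N =
    (INR N * INR (S m) * csum (bker 1 N x m) (S p))%C).
  { rewrite (csum_ext _ (fun l => cis (jl N l * (PI * (INR 1 - 1) / INR N)) *
      harm (ypoint N x l m) (S p))%C) by (intros; rewrite cis_jl_k1; ring).
    rewrite csum_cis_harm_ypoint by (auto; lia). simpl (1 - 1)%nat. simpl (Cpow _ 0). ring. }
  rewrite E1, E2. field. auto.
Qed.

(** The finite kernel sums cancel by exchanging their order. Let [L = ln P] and let [hP], [hQ] be
    the harmonic numbers of [P] and [P^N]. Then [N L hP + L hQ - hP hQ = N L^2 - gP gQ], and the
    sums of [ln m / m] contribute [- N L^2 / 2] twice: every divergent term is absorbed into [gP],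
    [gQ], [sP], [sQ]. *)
Lemma Amain_Bmain_eq (N p : nat) (x : C) : (1 <= N)%nat -> slit_plane x ->
  let gP := harmonic (S p) - ln (INR (S p)) in
  let gQ := harmonic (S p ^ N) - ln (INR (S p ^ N)) in
  let sP := lnsum (S p) - ln (INR (S p)) ^ 2 / 2 in
  let sQ := lnsum (S p ^ N) - ln (INR (S p ^ N)) ^ 2 / 2 in
  (Amain N p x + / INR N * Bmain N p x)%C =
  (Tsum N (S p) x + (RtoC (- INR N * sP - / INR N * sQ - gP * gQ)
    + (/ INR N * gQ - gP)%R * Clog x))%C.
Proof.
  intros HN Hx. cbv zeta. assert (HN0 : 0 < INR N) by (apply lt_0_INR; lia).
  assert (HNC : RtoC (INR N) <> 0%C) by (apply RtoC_neq_0; lra).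
  rewrite Amain_eq, Bmain_eq by auto. unfold Tsum.
  rewrite (csum_switch (fun n m => bker 1 N x m n)).
  replace (ln (INR (S p ^ N))) with (INR N * ln (INR (S p)))
    by (rewrite INR_pow, ln_pow; auto using INR_S_pos).
  set (A := csum _ (S p)). set (D := csum _ (S p ^ N)). set (B := csum _ (S p ^ N)).
  clearbody A B D.
  generalize (ln (INR (S p))) (harmonic (S p)) (harmonic (S p ^ N)) (lnsum (S p)) (lnsum (S p ^ N)).
  intros L hP hQ lP lQ.
  repeat first [ rewrite RtoC_plus | rewrite RtoC_minus | rewrite RtoC_mult | rewrite RtoC_opp
    | rewrite RtoC_inv by lra | rewrite RtoC_div by lra | rewrite RtoC_pow ].
  field. auto.
Qed.

Lemma is_lim_seq_pow_subseq (u : nat -> R) (l : R) (N : nat) : (1 <= N)%nat ->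
  is_lim_seq (fun n => u (S n)) l -> is_lim_seq (fun p => u (S p ^ N)%nat) l.
Proof.
  intros HN H. apply (is_lim_seq_subseq u l (fun p => S p ^ N)%nat).
  - apply filterlim_pow_nat; auto.
  - apply is_lim_seq_incr_1; auto.
Qed.

Lemma Amain_Bmain_lim (N : nat) (x : C) : (1 <= N)%nat -> slit_plane x ->
  Clim (fun p => Amain N p x + / INR N * Bmain N p x)%C
    (/ INR N * (PI ^ 2 / 6 + Clog x ^ 2 / 2)
     + (RtoC (- INR N * stieltjes_gamma1 - / INR N * stieltjes_gamma1 - euler_gamma * euler_gamma)
        + (/ INR N * euler_gamma - euler_gamma)%R * Clog x))%C.
Proof.
  intros HN Hx.
  assert (HgP := euler_gamma_lim). assert (HsP := stieltjes_gamma1_lim).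
  assert (HgQ := is_lim_seq_pow_subseq (fun n => harmonic n - ln (INR n)) _ N HN HgP).
  assert (HsQ := is_lim_seq_pow_subseq (fun n => lnsum n - ln (INR n) ^ 2 / 2) _ N HN HsP).
  apply Clim_ext with (fun p => Tsum N (S p) x +
    (RtoC (- INR N * (lnsum (S p) - ln (INR (S p)) ^ 2 / 2)
      - / INR N * (lnsum (S p ^ N) - ln (INR (S p ^ N)) ^ 2 / 2)
      - (harmonic (S p) - ln (INR (S p))) * (harmonic (S p ^ N) - ln (INR (S p ^ N))))
     + Clog x * (/ INR N * (harmonic (S p ^ N) - ln (INR (S p ^ N)))
        - (harmonic (S p) - ln (INR (S p))))%R))%C.
  - intros p. rewrite Amain_Bmain_eq by auto. cbv zeta. do 2 f_equal. apply Cmult_comm.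
  - apply Clim_plus; [apply Tsum_lim; auto|]. apply Clim_plus.
    + apply Clim_RtoC. apply is_lim_seq_minus'; [apply is_lim_seq_minus'|].
      * apply is_lim_seq_mult'; [apply is_lim_seq_const | exact HsP].
      * apply is_lim_seq_mult'; [apply is_lim_seq_const | exact HsQ].
      * apply is_lim_seq_mult'; [exact HgP | exact HgQ].
    + rewrite Cmult_comm. apply Clim_scal, Clim_RtoC. apply is_lim_seq_minus'; [|exact HgP].
      apply is_lim_seq_mult'; [apply is_lim_seq_const | exact HgQ].
Qed.

Lemma csum_Herglotz_lim (N : nat) (x : C) : (1 <= N)%nat -> slit_plane x ->
  Clim (csum (fun m => csum (fun l => phi (ypoint N x l m)) N / INR (S m))%C)
    (csum (fun l => Herglotz 1 (1 / INR N) (upoint N x l)) N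
     + Czeta (1 + INR 1 / INR N)%R *
       (xroot N x * if Nat.eq_dec 1 N then INR N * (-1) ^ (N - 1) else 0))%C.
Proof.
  intros HN Hx. assert (HN0 : 0 < INR N) by (apply lt_0_INR; lia).
  assert (H := csum_cis_Herglotz_lim 1 N x ltac:(lia) Hx).
  replace ((INR N + INR 1 - 1) / INR N) with 1 in H by (simpl (INR 1); field; lra).
  rewrite (csum_ext _ (fun l => Herglotz 1 (1 / INR N) (upoint N x l))) in H
    by (intros; rewrite cis_jl_k1; ring).
  apply Clim_ext with (2 := H). intros M. apply csum_ext. intros m _.
  rewrite Rpower_1 by apply INR_S_pos. f_equal. apply csum_ext. intros l _.
  rewrite cis_jl_k1. ring.
Qed.

Lemma herglotz_transform_1 (N : nat) (x : C) : (1 <= N)%nat -> slit_plane x ->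
  (Herglotz 1 (INR N) x + Czeta (1 + INR N)%R / x
   + / INR N * (csum (fun l => Herglotz 1 (1 / INR N) (upoint N x l)) N
      + Czeta (1 + INR 1 / INR N)%R *
        (xroot N x * if Nat.eq_dec 1 N then INR N * (-1) ^ (N - 1) else 0)))%C =
  (/ INR N * (PI ^ 2 / 6 + Clog x ^ 2 / 2)
   + (RtoC (- INR N * stieltjes_gamma1 - / INR N * stieltjes_gamma1 - euler_gamma * euler_gamma)
      + (/ INR N * euler_gamma - euler_gamma)%R * Clog x))%C.
Proof.
  intros HN Hx.
  assert (HA := Herglotz_nat_lim 1 N x (le_n 1) HN Hx). simpl (INR 1) in HA at 1.
  apply Clim_incr_1 in HA.
  (* The second series converges along all partial sums, so its limit may be read along the lengths
     [P^N] imposed by the rectangle. *)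
  assert (HB := Clim_subseq _ _ _ (filterlim_pow_nat N HN) (csum_Herglotz_lim N x HN Hx)).
  apply Clim_unique with (fun p =>
    csum (fun n => phi (ypos N x n) / INR (S n))%C (S p)
    + / INR N * csum (fun m => csum (fun l => phi (ypoint N x l m)) N / INR (S m)) (S p ^ N))%C.
  - apply Clim_plus; [|apply Clim_scal; exact HB].
    apply Clim_ext with (2 := HA). intros p. apply csum_ext. intros n _.
    rewrite Cpow_1_r. reflexivity.
  - apply Clim_ext with (fun p => (Amain N p x + / INR N * Bmain N p x)
      + ((csum (fun n => phi (ypos N x n) / INR (S n))%C (S p) - Amain N p x)
      + / INR N * (csum (fun m => csum (fun l => phi (ypoint N x l m)) N / INR (S m)) (S p ^ N)
        - Bmain N p x)))%C.
    + intros p. ring.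
    + eapply Clim_eq.
      * apply Clim_plus; [apply Amain_Bmain_lim; auto|].
        apply Clim_plus; [apply Amain_error; auto|].
        apply Clim_scal, Bmain_error; auto.
      * ring.
Qed.

(** * Translation into the form of the statement *)

Lemma upoint_Cexp_IZR (N l : nat) (x : C) : (1 <= N)%nat ->
  (Cexp (- (Ci * PI * IZR (2 * Z.of_nat l - (Z.of_nat N - 1)) / INR N)) /
    Cpower x (1 / INR N)%R)%C = upoint N x l.
Proof.
  intros HN. assert (HN0 : 0 < INR N) by (apply lt_0_INR; lia).
  unfold upoint, xroot. rewrite IZR_jl, cis_Cexp. do 2 f_equal.
  rewrite RtoC_opp, RtoC_mult, RtoC_div by lra. field. apply RtoC_neq_0; lra.
Qed.

Lemma cis_Cexp_IZR (k N l : nat) : (1 <= N)%nat ->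
  Cexp (Ci * PI * IZR (2 * Z.of_nat l - (Z.of_nat N - 1)) * (INR k - 1) / INR N) =
  cis (jl N l * (PI * (INR k - 1) / INR N)).
Proof.
  intros HN. assert (HN0 : 0 < INR N) by (apply lt_0_INR; lia).
  rewrite IZR_jl, cis_Cexp. f_equal.
  rewrite RtoC_mult, RtoC_div, RtoC_mult, RtoC_minus by lra. field. apply RtoC_neq_0; lra.
Qed.

Theorem theorem2p1 (N : nat) (x : C) (hN : (1 <= N)%nat) (hx : slit_plane x) :
  (forall k : nat, (1 < k <= N)%nat ->
     (Cpower x ((1 - INR k) / INR N)%R * Herglotz (INR k) (INR N) x
      - (-1) ^ k / INR N *
        sum_step2 N (fun j =>
          Cexp (Ci * PI * IZR j * (INR k - 1) / INR N) *
          Herglotz ((INR N + INR k - 1) / INR N)%R (1 / INR N)%R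
            (Cexp (- (Ci * PI * IZR j / INR N)) / Cpower x (1 / INR N)%R))
      = PI / INR N *
          (Czeta (1 + (INR k - 1) / INR N)%R / sin (PI / INR N * (INR k - 1))%R)
        + Cpower x ((1 - INR k) / INR N)%R *
          (- ((euler_gamma + Clog x) * Czeta (INR k))
           + INR N * C_derive Czeta (INR k))
        - Czeta (INR k + INR N)%R / Cpower x ((INR N + INR k - 1) / INR N)%R
        + Bterm k N x)%C)
  /\
  (Herglotz 1 (INR N) x
   + 1 / INR N *
     sum_step2 N (fun j =>
       Herglotz 1 (1 / INR N)%R
         (Cexp (- (Ci * PI * IZR j / INR N)) / Cpower x (1 / INR N)%R))
   = 1 / INR N *
       ((PI ^ 2 / 6)%R - (INR N - 1) * euler_gamma * Clog x
        + 1 / 2 * Clog x ^ 2 - INR N * euler_gamma ^ 2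
        - (INR N ^ 2 + 1) * stieltjes_gamma1)
     - Czeta (INR N + 1)%R / x
     + Bterm 1 N x)%C.
Proof.
  assert (HN0 : 0 < INR N) by (apply lt_0_INR; lia).
  assert (HNC : RtoC (INR N) <> 0%C) by (apply RtoC_neq_0; lra).
  assert (Hxi := xroot_neq_0 N x). assert (Hx0 := slit_plane_neq_0 x hx).
  split.
  - intros k Hk.
    rewrite sum_step2_csum by auto.
    rewrite (csum_ext _ (fun l => cis (jl N l * (PI * (INR k - 1) / INR N)) *
      Herglotz ((INR N + INR k - 1) / INR N) (1 / INR N) (upoint N x l))%C)
      by (intros; rewrite cis_Cexp_IZR, upoint_Cexp_IZR; auto).
    assert (Ep : INR k - 1 = INR (k - 1)) by (rewrite minus_INR by lia; reflexivity).
    replace ((1 - INR k) / INR N) with (- (INR (k - 1) / INR N))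
      by (rewrite <- Ep; unfold Rdiv; ring).
    (* The exponent is [1 + (k - 1)/N], so this denominator combines the [1/x] of the shift with the
       prefactor [x^((1-k)/N)]. *)
    replace (Cpower x ((INR N + INR k - 1) / INR N)%R) with (x * xroot N x ^ (k - 1))%C.
    2:{ replace (INR N + INR k - 1) with (INR (N + (k - 1))) by (rewrite plus_INR, <- Ep; ring).
        rewrite Cpower_div_INR, Cpow_add_r, xroot_pow by auto. reflexivity. }
    rewrite Cpower_opp, Cpower_div_INR by auto.
    assert (H := herglotz_transform k N x Hk hx).
    assert (Hxk : (xroot N x ^ (k - 1))%C <> 0%C) by (apply Cpow_nz; auto).
    match type of H with _ = ?r => set (R0 := r) in * end.
    match goal with |- (?a - _ * ?w)%C = _ => set (W := w) in *; set (A := a) end.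
    unfold Bterm. fold (xroot N x).
    destruct (Nat.eq_dec k N) as [E | E].
    + transitivity (R0 - Czeta (INR k + INR N)%R / (x * xroot N x ^ (k - 1)) +
        (-1) ^ k * (-1) ^ (N - 1) * xroot N x * Czeta (1 + INR k / INR N)%R)%C.
      * rewrite <- H. unfold A. field. auto.
      * f_equal. do 2 f_equal.
        (* The sign of [Bterm] agrees with the product of [(-1)^k] and the [(-1)^(N-1)] of the
           root-of-unity sum, since the exponents differ by 2. *)
        replace (k + N + 1)%nat with (k + (N - 1) + 2)%nat by lia.
        rewrite !Cpow_add_r. simpl. ring.
    + transitivity (R0 - Czeta (INR k + INR N)%R / (x * xroot N x ^ (k - 1)) + 0)%C; [|reflexivity].
      rewrite <- H. unfold A. field. auto.
  - rewrite sum_step2_csum by auto.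
    rewrite (csum_ext _ (fun l => Herglotz 1 (1 / INR N) (upoint N x l)))
      by (intros; rewrite upoint_Cexp_IZR; auto).
    assert (H := herglotz_transform_1 N x hN hx).
    set (W := csum _ N) in *.
    match type of H with _ = ?r => set (R0 := r) in * end.
    assert (ER : R0 = (1 / INR N *
       ((PI ^ 2 / 6)%R - (INR N - 1) * euler_gamma * Clog x
        + 1 / 2 * Clog x ^ 2 - INR N * euler_gamma ^ 2
        - (INR N ^ 2 + 1) * stieltjes_gamma1))%C).
    { unfold R0. assert (H2C : RtoC 2 <> 0%C) by (apply RtoC_neq_0; lra).
      assert (H6C : RtoC 6 <> 0%C) by (apply RtoC_neq_0; lra).
      repeat first [ rewrite RtoC_plus | rewrite RtoC_minus | rewrite RtoC_mult | rewrite RtoC_opp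
        | rewrite RtoC_inv by lra | rewrite RtoC_div by lra | rewrite RtoC_pow ].
      field. auto. }
    rewrite <- ER, (Rplus_comm (INR N) 1), <- H.
    unfold Bterm. fold (xroot N x).
    destruct (Nat.eq_dec 1 N) as [E | E].
    + subst N. simpl. field. auto.
    + field. auto.
Qed.
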